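(* Let $I=(I_-,I_+)\subset\mathbb R$ be a nonempty open interval with closure $\overline I=[I_-,I_+]\subset[-\infty,\infty]$, and let $\lambda_\pm:\overline I\to[0,\infty)$ be continuous functions such that $\lambda_-$ is nonincreasing, $\lambda_+$ is nondecreasing, and $\lambda_-,\lambda_+>0$ on $I$. For $I_-<J_-<J_+<I_+$ let $$\Lambda_-(J_-,J_+):=\frac{1}{\lambda_-(J_-)\lambda_-(J_+)}-\int_{J_-}^{J_+}\frac{1}{\lambda_+}\,\mathrm d\Big(\frac1{\lambda_-}\Big),\qquad \Lambda_+(J_-,J_+):=\frac{1}{\lambda_+(J_-)\lambda_+(J_+)}+\int_{J_-}^{J_+}\frac{1}{\lambda_-}\,\mathrm d\Big(\frac1{\lambda_+}\Big),$$ and for $J_+\in I$ resp. $J_-\in I$ define $$\phi_-(J_+):=\sup\{J_-\in(I_-,J_+):\Lambda_-(J_-,J_+)\le0\},\qquad \phi_+(J_-):=\inf\{J_+\in(J_-,I_+):\Lambda_+(J_-,J_+)\le0\},$$ with the conventions $\sup\emptyset:=I_-$ and $\inf\emptyset:=I_+$. Then $\phi_-(J_+)<J_+$ and $J_-<\phi_+(J_-)$ for all $J_-,J_+\in I$. Moreover, a point $(J_-,J_+)\in I\times I$ belongs to the set $$R:=\{(J_-,J_+)\in I\times I:J_-<J_+\text{ and the restricted model on }J=(J_-,J_+)\text{ is positive recurrent}\}$$ if and only if $\phi_-(J_+)<J_-$, $J_+<\phi_+(J_-)$, and $J_-<J_+$.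
   Context: Integrals $\int g\,\mathrm df$ are Lebesgue-Stieltjes integrals with respect to continuous monotone $f$. **Restricted model.** For $J=(J_-,J_+)$ with $\overline J=[J_-,J_+]\subset I$, the restricted model on $J$ is the Stigler-Luckock model (defined next) with the interval $I$ replaced by $J$ and with $\lambda_\pm$ replaced by their restrictions to $\overline J$. **Stigler-Luckock model on an interval $I$ with demand and supply functions $\lambda_\pm:\overline I\to[0,\infty)$.** Let $\mu_\pm$ be the finite measures on $\overline I$ with $\mu_-([x,I_+])=\lambda_-(x)$ and $\mu_+([I_-,x])=\lambda_+(x)$ for $x\in\overline I$. Let $\mu$ be the finite measure on $\overline I\times\{-,+\}$ with $\mu(A\times\{\sigma\})=\mu_\sigma(A)$, let $|\mu|$ be its total mass, and $\overline\mu:=|\mu|^{-1}\mu$. A counting measure is a finite or countable sum of delta measures. $\mathcal S_{\rm ord}$ is the set of all $\mathcal X=\mathcal X^+-\mathcal X^-$, where $\mathcal X^\pm$ are counting measures on $I$ such that: there are no $x\le y$ in $I$ with $\mathcal X^+(\{x\})>0$ and $\mathcal X^-(\{y\})>0$; and $\mathcal X^-((x,I_+))<\infty$ and $\mathcal X^+((I_-,x))<\infty$ for all $x\in I$. Put $$M_-(\mathcal X):=\max(\{I_-\}\cup\{x\in I:\mathcal X(\{x\})<0\}),\quad M_+(\mathcal X):=\min(\{I_+\}\cup\{x\in I:\mathcal X(\{x\})>0\}).$$ For $(u,\sigma)\in\overline I\times\{-,+\}$ the Luckock map $L_{u,\sigma}:\mathcal S_{\rm ord}\to\mathcal S_{\rm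 ord}$ is: $L_{u,-}(\mathcal X)=\mathcal X-\delta_{u\wedge M_+(\mathcal X)}$ if $u\wedge M_+(\mathcal X)\in I$; $L_{u,+}(\mathcal X)=\mathcal X+\delta_{u\vee M_-(\mathcal X)}$ if $u\vee M_-(\mathcal X)\in I$; and $L_{u,\sigma}(\mathcal X)=\mathcal X$ otherwise. The model is the Markov chain $X_k:=L_{U_k,\sigma_k}(X_{k-1})$ $(k\ge1)$, where $(U_k,\sigma_k)_{k\ge1}$ are i.i.d. with law $\overline\mu$, independent of $X_0$. **Positive recurrence.** Let $X_0=0$ (the empty state) and $\tau:=\inf\{k>0:X_k=0\}$. The model is positive recurrent if $\mathbb E[\tau]<\infty$. *)

(* Defs.v *)
From HB Require Import structures.
From mathcomp Require Import all_boot all_order all_algebra.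
From mathcomp Require Import all_classical all_reals all_analysis.
From mathcomp Require Import measurable_realfun.
Set Implicit Arguments.
Unset Strict Implicit.
Unset Printing Implicit Defensive.
Import Order.TTheory GRing.Theory Num.Theory.
Import numFieldNormedType.Exports.
Local Open Scope classical_set_scope.
Local Open Scope ring_scope.

(* An interval I = (I_-, I_+) is given by its endpoints a < b in \bar R;
   functions on its closure are total functions on \bar R of which only the
   values on [a, b] matter.  Hence restricting a model to a subinterval only
   changes the endpoints. *)

Section Stieltjes.
Context {R : realType}.
Implicit Types f g : R -> R.

Definition is_cumulative f : Prop :=
  {homo f : x y / x <= y} /\ (forall x, f @ at_right x --> f x).

Definition cumulative_of f (H : is_cumulative f) : cumulative R R :=
  HB.pack f (isCumulative.Build R _ R f (proj1 H) (proj2 H)).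

(* f on [a, b], extended by constants to a function on the whole line. *)
Definition clamp (a b : R) f (x : R) : R := f (Num.max a (Num.min x b)).

(* Integral of g over [a, b] against the Lebesgue-Stieltjes measure of f, for
   f nondecreasing and continuous on [a, b] (junk value 0 if the measure does
   not exist). *)
Definition nd_stieltjes_integral g f (a b : R) : R :=
  if pselect (is_cumulative (clamp a b f)) is left H then
    fine (\int[lebesgue_stieltjes_measure (cumulative_of H)]_(x in `[a, b])
            (g x)%:E)
  else 0.

(* For f nonincreasing, int g df = - int g d(-f). *)
Definition stieltjes_integral g f (a b : R) : R :=
  if `[< {in `[a, b] &, {homo f : x y / x <= y}} >]
  then nd_stieltjes_integral g f a b
  else - nd_stieltjes_integral g (fun x => - f x) a b.

End Stieltjes.

Section OrderBook.
Context {R : realType}.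
Variables a b : \bar R.

Definition in_itv_oo (x : \bar R) : bool := (a < x)%E && (x < b)%E.

(* A state X = X^+ - X^- is encoded by its multiplicities x |-> X({x}); for
   states satisfying [ordered_book] the counting measures X^+ and X^- have
   finite multiplicities and disjoint supports, so they are recovered as the
   positive and negative parts of the multiplicity function. *)
Definition book := R -> int.

Definition ordered_book (X : book) : Prop :=
  [/\ forall x : R, ~~ in_itv_oo x%:E -> X x = 0,
      forall x y : R, x <= y -> 0 < X x -> X y < 0 -> False,
      forall x : R, in_itv_oo x%:E -> finite_set [set y | x < y /\ X y < 0] &
      forall x : R, in_itv_oo x%:E -> finite_set [set y | y < x /\ 0 < X y]].

(* Supremum and infimum are attained for ordered books, see [best_bid_max]
   and [best_ask_min]. *)
Definition best_bid (X : book) : \bar R :=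
  ereal_sup ([set a] `|` [set x%:E | x in [set x | in_itv_oo x%:E /\ X x < 0]]).

Definition best_ask (X : book) : \bar R :=
  ereal_inf ([set b] `|` [set x%:E | x in [set x | in_itv_oo x%:E /\ 0 < X x]]).

Definition delta (p : \bar R) : book := fun x => (x%:E == p)%:R.

(* An order (u, s) has sign s = false for "-" and s = true for "+". *)
Definition luckock_map (o : \bar R * bool) (X : book) : book :=
  let: (u, s) := o in
  if s then
    let p := Order.max u (best_bid X) in
    if in_itv_oo p then fun x => X x + delta p x else X
  else
    let p := Order.min u (best_ask X) in
    if in_itv_oo p then fun x => X x - delta p x else X.

(* The chain started from the empty state; xi k is the (k+1)-st order. *)
Fixpoint luckock_chain (xi : nat -> \bar R * bool) (k : nat) : book :=
  if k is k'.+1 then luckock_map (xi k') (luckock_chain xi k')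
  else fun=> 0.

Definition return_time (xi : nat -> \bar R * bool) : \bar R :=
  ereal_inf [set (k%:R)%:E | k in
    [set k : nat | (0 < k)%N /\ luckock_chain xi k = (fun=> 0)]].

End OrderBook.

Section Model.
Context {R : realType}.

(* mu on [a, b] x {-, +}, viewed as a measure on \bar R * bool; its sections
   A |-> mu (A x {s}) are mu_- and mu_+. *)
Definition is_order_measure (a b : \bar R) (lm lp : \bar R -> R)
    (mu : {finite_measure set (\bar R * bool)%type -> \bar R}) : Prop :=
  [/\ mu ((~` `[a, b]) `*` setT) = 0%E,
      forall x, x \in `[a, b] -> mu (`[x, b] `*` [set false]) = (lm x)%:E &
      forall x, x \in `[a, b] -> mu (`[a, x] `*` [set true]) = (lp x)%:E].

Definition mutually_independent d d' (Om : measurableType d)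
    (T : measurableType d') (P : probability Om R)
    (xi : nat -> {RV P >-> T}) : Prop :=
  forall (s : seq nat) (B : nat -> set T), uniq s ->
    (forall k, measurable (B k)) ->
    P (\bigcap_(k in [set` s]) (xi k @^-1` B k)) =
    (\prod_(k <- s) P (xi k @^-1` B k))%E.

Definition iid_normalized d d' (Om : measurableType d) (T : measurableType d')
    (P : probability Om R) (xi : nat -> {RV P >-> T})
    (mu : {finite_measure set T -> \bar R}) : Prop :=
  mutually_independent xi /\
  forall k (A : set T), measurable A ->
    distribution P (xi k) A = (((fine (mu setT))^-1)%:E * mu A)%E.

(* E[tau] depends only on the law of the order sequence, so it is finite for
   one realization of the sequence iff it is for all. *)
Definition positive_recurrent (a b : \bar R) (lm lp : \bar R -> R) : Prop :=
  exists (mu : {finite_measure set (\bar R * bool)%type -> \bar R})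
         (d : measure_display) (Om : measurableType d) (P : probability Om R)
         (xi : nat -> {RV P >-> (\bar R * bool)%type}),
    [/\ is_order_measure a b lm lp mu,
        iid_normalized xi mu &
        (\int[P]_w return_time a b (fun k => xi k w) < +oo)%E].

End Model.

Section Phi.
Context {R : realType}.
Variables (Im Ip : \bar R) (lm lp : \bar R -> R).

Definition Lambda_minus (Jm Jp : R) : R :=
  (lm Jm%:E * lm Jp%:E)^-1 -
  stieltjes_integral (fun x => (lp x%:E)^-1) (fun x => (lm x%:E)^-1) Jm Jp.

Definition Lambda_plus (Jm Jp : R) : R :=
  (lp Jm%:E * lp Jp%:E)^-1 +
  stieltjes_integral (fun x => (lm x%:E)^-1) (fun x => (lp x%:E)^-1) Jm Jp.

Definition phi_minus (Jp : R) : \bar R :=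
  let A := [set Jm%:E | Jm in
    [set Jm : R | [/\ (Im < Jm%:E)%E, Jm < Jp & Lambda_minus Jm Jp <= 0]]] in
  if A == set0 then Im else ereal_sup A.

Definition phi_plus (Jm : R) : \bar R :=
  let A := [set Jp%:E | Jp in
    [set Jp : R | [/\ Jm < Jp, (Jp%:E < Ip)%E & Lambda_plus Jm Jp <= 0]]] in
  if A == set0 then Ip else ereal_inf A.

Definition recurrent_set : set (R * R) :=
  [set J | [/\ in_itv_oo Im Ip J.1%:E, in_itv_oo Im Ip J.2%:E, J.1 < J.2 &
               positive_recurrent J.1%:E J.2%:E lm lp]].

End Phi.

Section OrderBookTheory.
Context {R : realType}.
Variables a b : \bar R.
Implicit Types X : @book R.

Let seq_min (s : seq R) : s != [::] ->
  exists2 m, m \in s & {in s, forall y, m <= y}.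
Proof.
elim: s => //= x [|z s] IH _.
  by exists x; rewrite ?mem_head// => y; rewrite inE => /eqP->.
have [//|m ms mle] := IH; have [xm|mx] := leP x m.
  exists x; rewrite ?mem_head// => y; rewrite in_cons => /orP[/eqP->//|].
  by move=> /mle; exact: le_trans.
exists m; first by rewrite in_cons ms orbT.
by move=> y; rewrite in_cons => /orP[/eqP->|/mle//]; exact: ltW.
Qed.

Let set_min (A : set R) (x0 : R) : finite_set [set y | y < x0 /\ A y] ->
  A x0 -> exists2 m, A m & forall y, A y -> m <= y.
Proof.
move=> /finite_seqP[s sE] Ax0; have [//|m ms mle] := @seq_min (x0 :: s).
have inS y : (y \in s) <-> y < x0 /\ A y.
  by rewrite -[_ < _ /\ _]/([set y | y < x0 /\ A y] y) sE.
exists m; first by move: ms; rewrite in_cons => /orP[/eqP->//|/inS[]].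
move=> y Ay; have [yx0|x0y] := ltP y x0.
  by apply: mle; rewrite in_cons; apply/orP; right; apply/inS.
by apply: le_trans x0y; apply: mle; exact: mem_head.
Qed.

Lemma best_ask_min X : ordered_book a b X ->
  ([set b] `|` [set x%:E | x in [set x | in_itv_oo a b x%:E /\ 0 < X x]])
    (best_ask a b X).
Proof.
move=> [X0 _ _ fX]; set S := [set x | _]; rewrite /best_ask -/S.
have [[x0 [Ix0 Xx0]]|nS] := pselect (exists x, S x); last first.
  left; rewrite (_ : [set x%:E | x in S] = set0) ?setU0 ?ereal_inf1//.
  by rewrite -subset0 => y [x Sx _]; apply: nS; exists x.
have [|//|m [Im Xm] mle] := @set_min S x0.
  by apply: sub_finite_set (fX _ Ix0) => y [? []].
right; exists m => //; apply/le_anti/andP; split.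
  apply: le_ereal_inf_tmp => _ [->|[y Sy <-]]; first by case/andP: Im => _ /ltW.
  by rewrite lee_fin mle.
by apply: ereal_inf_lbound; right; exists m.
Qed.

Lemma best_bid_max X : ordered_book a b X ->
  ([set a] `|` [set x%:E | x in [set x | in_itv_oo a b x%:E /\ X x < 0]])
    (best_bid a b X).
Proof.
move=> [X0 _ fX _]; set S := [set x | _]; rewrite /best_bid -/S.
have [[x0 [Ix0 Xx0]]|nS] := pselect (exists x, S x); last first.
  left; rewrite (_ : [set x%:E | x in S] = set0) ?setU0 ?ereal_sup1//.
  by rewrite -subset0 => y [x Sx _]; apply: nS; exists x.
have [||m] := @set_min [set - x | x in S] (- x0).
- apply: sub_finite_set (finite_image (fun x => - x) (fX _ Ix0)) => z [].
  by move=> + [y [Iy Xy] yz]; rewrite -yz ltrN2 => ?; exists y.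
- by exists x0.
move=> [m' [Im Xm] <-] mle; right; exists m' => //; apply/le_anti/andP; split.
  by apply: ereal_sup_ubound; right; exists m'.
apply: ge_ereal_sup => _ [->|[y Sy <-]]; first by case/andP: Im => /ltW.
by rewrite lee_fin -lerN2 mle//; exists y.
Qed.

Lemma ordered_book0 : ordered_book a b (fun=> 0).
Proof.
split=> // x _; rewrite (_ : [set y | _] = set0) //;
  by rewrite -subset0 => y [_]; rewrite ltxx.
Qed.

Lemma luckock_map_ordered o X :
  ordered_book a b X -> ordered_book a b (luckock_map a b o X).
Proof.
move: o => [u s] oX; have [X0 Xord Xbid Xask] := oX.
have Iout y : X y != 0 -> in_itv_oo a b y%:E by apply: contraNT => /X0 ->.
case: s => /=; case: ifPn => //.
- set p := Order.max _ _ => Ip.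
  have [q pE] : exists q, p = q%:E.
    case: (p) Ip => [q _|/andP[_]|/andP[]]; first by exists q.
      by rewrite ltNge leey.
    by rewrite ltNge leNye.
  rewrite pE in Ip *.
  have dE x : delta q%:E x = (x == q)%:R by rewrite /delta eqe.
  have subd y : X y + delta q%:E y < 0 -> X y < 0.
    by apply: le_lt_trans; rewrite lerDl dE.
  have bidq y : X y < 0 -> y <= q.
    move=> Xy; rewrite -lee_fin -pE le_max; apply/orP; right.
    by apply: ereal_sup_ubound; right; exists y => //; rewrite /= Iout ?lt_eqF.
  split.
  + move=> x Ix; rewrite X0// dE add0r; case: eqP => // xq.
    by rewrite xq Ip in Ix.
  + move=> x y xy Xx Xy; have := Xx; rewrite dE.
    have [xq _|_] := eqVneq x q; last first.
      by rewrite addr0 => Xx'; exact: Xord xy Xx' (subd _ Xy).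
    have yx : y = x by apply/le_anti; rewrite xy xq bidq ?subd.
    by move: Xy; rewrite yx => /(lt_trans Xx); rewrite ltxx.
  + by move=> x Ix; apply: sub_finite_set (Xbid x Ix) => y [xy /subd].
  + move=> x Ix; apply: (@sub_finite_set _ _
      ([set y | y < x /\ 0 < X y] `|` [set q])); last first.
      by rewrite finite_setU; split; [exact: Xask|exact: finite_set1].
    move=> y [yx]; rewrite dE; case: eqVneq => [->|_]; first by right.
    by rewrite addr0; left.
- set p := Order.min _ _ => Ip.
  have [q pE] : exists q, p = q%:E.
    case: (p) Ip => [q _|/andP[_]|/andP[]]; first by exists q.
      by rewrite ltNge leey.
    by rewrite ltNge leNye.
  rewrite pE in Ip *.
  have dE x : delta q%:E x = (x == q)%:R by rewrite /delta eqe.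
  have subd y : 0 < X y - delta q%:E y -> 0 < X y.
    by move=> /lt_le_trans; apply; rewrite gerBl dE.
  have askq y : 0 < X y -> q <= y.
    move=> Xy; rewrite -lee_fin -pE ge_min; apply/orP; right.
    by apply: ereal_inf_lbound; right; exists y => //; rewrite /= Iout ?gt_eqF.
  split.
  + move=> x Ix; rewrite X0// dE sub0r; case: eqP => [xq|_]; last exact: oppr0.
    by rewrite xq Ip in Ix.
  + move=> x y xy Xx Xy; have := Xy; rewrite dE.
    have [yq _|_] := eqVneq y q; last first.
      by rewrite subr0 => Xy'; exact: Xord xy (subd _ Xx) Xy'.
    have yx : y = x by apply/le_anti; rewrite xy yq askq ?subd.
    by move: Xy; rewrite yx => /(lt_trans Xx); rewrite ltxx.
  + move=> x Ix; apply: (@sub_finite_set _ _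
      ([set y | x < y /\ X y < 0] `|` [set q])); last first.
      by rewrite finite_setU; split; [exact: Xbid|exact: finite_set1].
    move=> y [yx]; rewrite dE; case: eqVneq => [->|_]; first by right.
    by rewrite subr0; left.
  + by move=> x Ix; apply: sub_finite_set (Xask x Ix) => y [xy /subd].
Qed.

End OrderBookTheory.

(* Main.v *)
(* Write l for lambda_-, L for lambda_+ and work on J = (a, b).  Give each buy
   order at y a weight wm y and each sell order at y a weight wp y, where
   d wp = (1/L) d(1/l) and wm + wp = 1/(l L); this leaves one free constant c.
   For such weights the expected change of the total weight F of the book in one
   step depends only on whether buy or sell orders are present.  With c = cm the
   sell weights are nonpositive and, as long as there are buy orders, the drift
   is a negative multiple of Lambda_-; with c = cp the buy weights are nonpositive
   and, as long as there are sell orders, the drift is a negative multiple of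
   Lambda_+.  Without these orders the drift is larger by a positive constant.

   If Lambda_- <= 0 (or Lambda_+ <= 0), E[F(X_n); tau > n] is nondecreasing and
   eventually positive while F(X_n) <= K n, so P(tau > n) >= const / n, which is
   not summable.  If both are positive, suitable multiples A and B of the two
   functions satisfy A + B >= de N, N being the number of orders, and
   (A^+)^2 + (B^+)^2 plus a bounded increasing function of N is a Lyapunov
   function, so that E[tau] < oo.

   Positive recurrence also asks for a realization of the i.i.d. orders; it is
   obtained on [0, 1] by splitting base-4 digits into even and odd bits and
   applying a quantile transform.  Finally Lambda_- is monotone and continuous
   in J_-, hence Lambda_-(J_-, J_+) > 0 iff phi_-(J_+) < J_-, and similarly for
   Lambda_+. *)

From HB Require Import structures.
Require Import Defs.
From mathcomp Require Import all_boot all_order all_algebra.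
From mathcomp Require Import all_classical all_reals all_analysis.
From mathcomp Require Import measurable_realfun ring lra zify.
Set Implicit Arguments.
Unset Strict Implicit.
Unset Printing Implicit Defensive.
Import Order.TTheory GRing.Theory Num.Theory.
Import numFieldNormedType.Exports.
Local Open Scope classical_set_scope.
Local Open Scope ring_scope.

(** * Stieltjes integrals *)

(** Where the weights come from: leave aside that there may be no order to remove. Up to
    normalization, buy orders facing a best ask at M then contribute -wp(M) l(M) plus the integral
    of wm against -dl over prices below M. This is constant in M when l dwp = -(wm + wp) dl; for the
    best bid the condition is L dwm = -(wm + wp) dL. Together they make wm + wp proportional to 1/(l
    L), give dwp = (1/L) d(1/l), and leave one constant to be moved between wm and wp. Two obstacles
    shape the proof. First, l and L are only continuous and monotone, so nothing can be
    differentiated: each differential identity becomes a pair of bounds on increments whose gap is a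
    product of two increments, and [product_bound_eq] turns this into an equality. Second, a state
    is a function on the line, for which no sigma-algebra is given. Books are therefore encoded as
    pairs of lists, and measurability is shown for real functionals of the state, on any
    sigma-algebra that makes the orders so far measurable; this allows the next order to be
    integrated out separately. *)

Lemma le_halving_eq0 (R : realType) (x K : R) :
  0 <= x -> (forall k, x <= K / 2 ^+ k) -> x = 0.
Proof.
move=> x0 h; apply/eqP; rewrite eq_le x0 andbT leNgt; apply/negP => xp.
have Kp : 0 < K by have := h 0%N; rewrite expr0 divr1; exact: lt_le_trans.
(* Since k <= 2^k, such a k gives K < 2^k x, against the assumed bound. *)
have [k hk] : exists k : nat, K / x < k%:R.
  by exists (Num.bound (K / x)); apply: archi_boundP; rewrite divr_ge0// ltW.
have : (k%:R : R) <= 2 ^+ k.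
  by rewrite -natrX ler_nat ltnW// ltn_expl.
move=> k2; have := h k; rewrite ler_pdivlMr ?exprn_gt0//.
rewrite leNgt => /negP; apply.
by move: hk; rewrite ltr_pdivrMr// mulrC => /lt_le_trans; apply; rewrite ler_pM2l.
Qed.

(* Splitting [x, y] at a point where n takes its middle value halves the
   product bound, which is therefore zero. *)
Lemma product_bound_eq (R : realType) (a b C : R) (H m n : R -> R) :
  {within `[a, b], continuous n} ->
  (forall x y, a <= x -> x <= y -> y <= b -> m x <= m y) ->
  (forall x y, a <= x -> x <= y -> y <= b -> n x <= n y) ->
  (forall x y, a <= x -> x <= y -> y <= b ->
    `|H y - H x| <= C * (m y - m x) * (n y - n x)) ->
  forall x y, a <= x -> x <= y -> y <= b -> H x = H y.
Proof.
move=> nc mm nn HC x y ax xy yb.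
suff h k : forall x y, a <= x -> x <= y -> y <= b ->
    `|H y - H x| <= C * (m y - m x) * (n y - n x) / 2 ^+ k.
  apply/esym/eqP; rewrite -subr_eq0 -normr_eq0; apply/eqP.
  by apply: (@le_halving_eq0 _ _ (C * (m y - m x) * (n y - n x))) => // k; exact: h.
elim: k => [|k IH] {ax xy yb}x {}y ax xy yb; first by rewrite expr0 divr1 HC.
have [z /[!in_itv]/= /andP[xz zy] nz] :
    exists2 z, z \in `[x, y] & n z = (n x + n y) / 2.
  apply: IVT => //.
    apply: continuous_subspaceW nc => z /=; rewrite !in_itv/= => /andP[xz zy].
    by rewrite (le_trans ax)// (le_trans zy).
  have := nn x y ax xy yb => nxy.
  rewrite min_l// max_r//; lra.
have az := le_trans ax xz; have zb := le_trans zy yb.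
have -> : H y - H x = (H y - H z) + (H z - H x) by ring.
apply: le_trans (ler_normD _ _) _.
apply: le_trans (lerD (IH _ _ az zy yb) (IH _ _ ax xz zb)) _.
have : (2 : R) ^+ k != 0 by rewrite expf_neq0// pnatr_eq0.
rewrite nz exprS; move: (2 ^+ k) => t t0.
by rewrite le_eqVlt; apply/orP; left; apply/eqP; field.
Qed.

Section LS.
Context {R : realType}.
Implicit Types f g : R -> R.

Definition nd_on (a b : R) f := forall x y, a <= x -> x <= y -> y <= b -> f x <= f y.

Lemma clamp_cumulative (a b : R) f : a <= b -> nd_on a b f ->
  (forall x, a <= x <= b -> {for x, continuous f}) -> is_cumulative (clamp a b f).
Proof.
move=> ab ndf cf; split.
  move=> x y xy; apply: ndf; first by rewrite le_max lexx.
    rewrite ge_max le_max lexx/= le_max; apply/orP; right.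
    by rewrite le_min ge_min xy/= ge_min lexx orbT.
  by rewrite ge_max ab ge_min lexx orbT.
move=> x; apply: cvg_at_right_filter.
apply: (@continuous_comp _ _ _ (fun x => Num.max a (Num.min x b)) f).
  apply: continuous_max; first exact: cvg_cst.
  by apply: continuous_min; [exact: cvg_id|exact: cvg_cst].
by apply: cf; rewrite le_max lexx/= ge_max ab ge_min lexx orbT.
Qed.

Lemma clamp_id (a b : R) f x : a <= x <= b -> clamp a b f x = f x.
Proof. by move=> /andP[ax xb]; rewrite /clamp min_l// max_r. Qed.

Lemma ls_ocitv (F : cumulative R R) (u v : R) : u <= v ->
  lebesgue_stieltjes_measure F `]u, v] = (F v - F u)%:E.
Proof.
move=> uv; rewrite /lebesgue_stieltjes_measure /= /measure_extension/= measurable_mu_extE/=.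
  by rewrite wlength_itv_bnd.
by exists (u, v).
Qed.

(** [nd_stieltjes_integral] uses a different measure on every interval, that of [f] clamped to it.
    Comparing values on half-open intervals shows that all of them are restrictions of the single
    measure of [f] clamped to [a, b]; additivity rests on this. *)
Lemma ls_clamp_restr (a b x y : R) f
    (Hab : is_cumulative (clamp a b f)) (Hxy : is_cumulative (clamp x y f)) :
  a <= x -> x <= y -> y <= b ->
  forall A : set R, measurable A ->
  lebesgue_stieltjes_measure (cumulative_of Hxy) A =
  lebesgue_stieltjes_measure (cumulative_of Hab) (A `&` `]x, y]).
Proof.
move=> ax xy yb A mA.
have mI : measurable (`]x, y]%classic : set (measurableTypeR R)) by exact: measurable_itv.
have -> : lebesgue_stieltjes_measure (cumulative_of Hab) (A `&` `]x, y]) =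
  mrestr (lebesgue_stieltjes_measure (cumulative_of Hab)) mI A by [].
apply: lebesgue_stieltjes_measure_unique => // _ [[u v] _ <-] /=.
rewrite /mrestr.
have [uv|vu] := leP u v; last by rewrite set_itv_ge ?set0I ?measure0// -leNgt/= bnd_simp ltW.
rewrite ls_ocitv//=.
have -> : `]u, v] `&` `]x, y] = `]Num.max u x, Num.min v y]%classic.
  apply/seteqP; split => z /=; rewrite !in_itv/= gt_max le_min.
    by move=> [/andP[-> ->] /andP[-> ->]].
  by move=> /andP[/andP[-> ->] /andP[-> ->]].
(* If the intersection is empty, u and v lie on the same side of [x, y] and are clamped to the same
   endpoint, so the increment is 0 as well. *)
have [uxvy|] := leP (Num.max u x) (Num.min v y); last first.
  move=> h; rewrite set_itv_ge ?measure0 -?leNgt/= ?bnd_simp ?ltW//.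
  congr EFin; apply/eqP; rewrite subr_eq0; apply/eqP; congr (f _).
  move: h; rewrite /Num.max/Num.min.
  by case: (ltP u x) => ?; case: (ltP v y) => ?; case: (ltP u y) => ?;
    case: (ltP x v) => ?; case: (ltP x u) => ?; case: (ltP x y) => ? ?; lra.
rewrite ls_ocitv//=; congr EFin.
have /andP[uu xx] : (u <= Num.max u x) && (x <= Num.max u x) by rewrite !le_max !lexx orbT.
have /andP[vv yy] : (Num.min v y <= v) && (Num.min v y <= y) by rewrite !ge_min !lexx orbT.
rewrite !(@clamp_id a b) /clamp; last 2 first.
- by rewrite (le_trans ax)//= (le_trans _ yb)// (le_trans uxvy).
- by rewrite (le_trans _ (le_trans xx uxvy))//= (le_trans yy).
rewrite (max_r (le_trans xx uxvy)) (min_l (le_trans uu (le_trans uxvy yy))).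
by rewrite maxC.
Qed.

Lemma itv_bounded (g : R -> R) (A : set R) (c C : R) :
  (forall x, A x -> c <= g x <= C) -> [bounded g x | x in A].
Proof.
move=> h; exists (Num.max `|c| `|C|); split; first exact: num_real.
move=> M cM x Ax /=; apply: le_trans (ltW cM).
have /andP[cg gC] := h _ Ax; rewrite ler_norml; apply/andP; split.
  rewrite lerNl le_max; apply/orP; left; apply: le_trans (_ : - c <= _).
    by rewrite lerN2.
  by rewrite -normrN ler_norm.
by rewrite le_max; apply/orP; right; apply: (le_trans gC); exact: ler_norm.
Qed.

Section onab.
Variables (a b : R) (f g : R -> R) (c C : R).
Hypothesis ndf : nd_on a b f.
Hypothesis cf : forall x, a <= x <= b -> {for x, continuous f}.
Hypothesis mg : measurable_fun `[a, b] g.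
Hypothesis gb : forall x, a <= x <= b -> c <= g x <= C.
Local Notation S := (nd_stieltjes_integral g f).

Let sub_cum x y : a <= x -> x <= y -> y <= b -> is_cumulative (clamp x y f).
Proof.
move=> ax xy yb; apply: clamp_cumulative => // [u v xu uv vy|u /andP[xu uy]].
  by apply: ndf => //; [exact: le_trans xu|exact: le_trans vy yb].
by apply: cf; rewrite (le_trans ax)//= (le_trans uy).
Qed.

Let nu_itv (Hab : is_cumulative (clamp a b f)) x y : a <= x -> x <= y -> y <= b ->
  lebesgue_stieltjes_measure (cumulative_of Hab) `]x, y] = (f y - f x)%:E.
Proof.
move=> ax xy yb; rewrite ls_ocitv//= !clamp_id// ?ax ?(le_trans xy)//=.
by rewrite yb (le_trans ax).
Qed.

Let nu_lty (Hab : is_cumulative (clamp a b f)) x y : a <= x -> x <= y -> y <= b ->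
  (lebesgue_stieltjes_measure (cumulative_of Hab) `]x, y] < +oo)%E.
Proof. by move=> ax xy yb; rewrite nu_itv// ltry. Qed.

Let g_int (Hab : is_cumulative (clamp a b f)) x y : a <= x -> x <= y -> y <= b ->
  (lebesgue_stieltjes_measure (cumulative_of Hab)).-integrable `]x, y] (EFin \o g).
Proof.
move=> ax xy yb; have xyab : (`]x, y] `<=` `[a, b])%classic.
  move=> z /=; rewrite !in_itv/= => /andP[xz zy].
  by rewrite (le_trans ax (ltW xz))/= (le_trans zy yb).
apply: measurable_bounded_integrable.
- exact: measurable_itv.
- exact: nu_lty.
- by apply: measurable_funS mg => //; exact: measurable_itv.
- by apply: (@itv_bounded g _ c C) => z /xyab /=; rewrite in_itv/=; exact: gb.
Qed.

(** The measure of [f] clamped to [x, y] gives no mass to the point x, so the closed interval of the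
    definition may be replaced by the half-open one. There this measure agrees with the one clamped
    to [a, b]. *)
Let SE (Hab : is_cumulative (clamp a b f)) x y : a <= x -> x <= y -> y <= b ->
  S x y = \int[lebesgue_stieltjes_measure (cumulative_of Hab)]_(t in `]x, y]) g t.
Proof.
move=> ax xy yb; rewrite /nd_stieltjes_integral.
case: pselect => [Hxy|]; last by case; exact: sub_cum.
have Dm : measurable `[x, y]%classic by exact: measurable_itv.
have Nm : measurable [set x] by exact: measurable_set1.
have restr := ls_clamp_restr Hab Hxy ax xy yb.
have lty : (lebesgue_stieltjes_measure (cumulative_of Hxy) `[x, y] < +oo)%E.
  rewrite restr//; apply: le_lt_trans (nu_lty Hab ax xy yb).
  have mI : measurable (`]x, y]%classic : set (measurableTypeR R)) by exact: measurable_itv.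
  apply: le_measure; rewrite ?inE//; exact: (measurableI _ _ Dm mI).
have N0 : lebesgue_stieltjes_measure (cumulative_of Hxy) [set x] = 0%E.
  rewrite restr// (_ : _ `&` _ = set0) ?measure0//.
  by rewrite -subset0 => z /= [->]; rewrite in_itv/= ltxx.
congr fine; transitivity (\int[lebesgue_stieltjes_measure (cumulative_of Hxy)]_(t in `[x, y] `\` [set x]) (g t)%:E)%E.
apply: (@negligible_integral _ _ R (lebesgue_stieltjes_measure (cumulative_of Hxy)) `[x, y] [set x]) => //.
- apply: measurable_bounded_integrable => //.
  + apply: measurable_funS mg => //.
    by move=> z /=; rewrite !in_itv/= => /andP[xz zy]; rewrite (le_trans ax xz)/= (le_trans zy yb).
  + apply: (@itv_bounded g _ c C) => z /=; rewrite in_itv/= => /andP[xz zy].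
    by apply: gb; rewrite (le_trans ax xz)/= (le_trans zy yb).
have -> : (`[x, y] `\` [set x] = `]x, y])%classic.
  apply/seteqP; split => z /=; rewrite !in_itv/=.
    by move=> [/andP[xz ->] /eqP]; rewrite lt_neqAle xz eq_sym => ->.
  by move=> /andP[xz ->]; rewrite (ltW xz); split => //; apply/eqP; rewrite gt_eqF.
apply: eq_measure_integral => A mA AI; apply: etrans (restr _ mA) _; congr (lebesgue_stieltjes_measure _ _).
by apply/seteqP; split => z; [case|split => //; exact: AI].
Qed.

Lemma nd_stieltjes_add x y z : a <= x -> x <= y -> y <= z -> z <= b ->
  S x z = S x y + S y z.
Proof.
move=> ax xy yz zb.
have xz := le_trans xy yz; have yb := le_trans yz zb.
have ay := le_trans ax xy.
have Hab : is_cumulative (clamp a b f) by apply: sub_cum => //; exact: le_trans yb.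
rewrite !(SE Hab)// -Rintegral_setU//; try exact: measurable_itv.
- by rewrite -itv_bndbnd_setU//= bnd_simp.
- by rewrite -itv_bndbnd_setU ?bnd_simp//; exact: g_int.
- apply/disj_setPS => t /= []; rewrite !in_itv/= => /andP[_ ty] /andP[yt _].
  by have := lt_le_trans yt ty; rewrite ltxx.
Qed.

(** Together with additivity, these bounds carry all later estimates of the integrals. *)
Lemma nd_stieltjes_bounds x y k K : a <= x -> x <= y -> y <= b ->
  (forall t, x <= t <= y -> k <= g t <= K) ->
  k * (f y - f x) <= S x y <= K * (f y - f x).
Proof.
move=> ax xy yb kgK.
have Hab : is_cumulative (clamp a b f) by apply: sub_cum => //; apply: le_trans yb => //; exact: le_trans xy.
rewrite (SE Hab)//.
have cstE h : h * (f y - f x) = \int[lebesgue_stieltjes_measure (cumulative_of Hab)]_(t in `]x, y]) h.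
  rewrite Rintegral_cst//; exact: (congr1 (fun z => h * fine z) (esym (nu_itv Hab ax xy yb))).
have ci h : (lebesgue_stieltjes_measure (cumulative_of Hab)).-integrable `]x, y] (EFin \o cst h).
  have mI : measurable (`]x, y]%classic : set (measurableTypeR R)) by exact: measurable_itv.
  apply: measurable_bounded_integrable => //; first exact: nu_lty.
  by apply: (@itv_bounded _ _ h h) => t _; rewrite lexx.
rewrite (cstE k) (cstE K); apply/andP; split; apply: le_Rintegral;
  try exact: measurable_itv; try exact: g_int; try exact: ci.
  by move=> t /=; rewrite in_itv/= => /andP[xt ty]; have /andP[] : k <= g t <= K by apply: kgK; rewrite (ltW xt).
by move=> t /=; rewrite in_itv/= => /andP[xt ty]; have /andP[] : k <= g t <= K by apply: kgK; rewrite (ltW xt).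
Qed.

End onab.
End LS.

(** * The integrals of 1/L against 1/l and of 1/l against -1/L *)

Section weights.
Context {R : realType}.
Variables (l L : R -> R).

Definition regular_on (a b : R) := forall x, a <= x <= b ->
  [/\ 0 < l x, 0 < L x, {for x, continuous l} & {for x, continuous L}].
Definition monotone_on (a b : R) := forall x y, a <= x -> x <= y -> y <= b ->
  l y <= l x /\ L x <= L y.

Local Notation p := (fun x => (l x)^-1).
Local Notation r := (fun x => (L x)^-1).

Section onab.
Variables a b : R.
Hypothesis ab : a <= b.
Hypothesis reg : regular_on a b.
Hypothesis mon : monotone_on a b.

Lemma inv_demand_nd : nd_on a b p.
Proof.
move=> x y ax xy yb; have [yx _] := mon ax xy yb.
have [] := @reg x; first by rewrite ax (le_trans xy).
have [] := @reg y; first by rewrite yb (le_trans ax).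
by move=> ly _ _ _ lx _ _ _; rewrite lef_pV2.
Qed.

Lemma inv_supply_ni x y : a <= x -> x <= y -> y <= b -> r y <= r x.
Proof.
move=> ax xy yb; have [_ yx] := mon ax xy yb.
have [] := @reg x; first by rewrite ax (le_trans xy).
have [] := @reg y; first by rewrite yb (le_trans ax).
by move=> _ Ly _ _ _ Lx _ _; rewrite lef_pV2.
Qed.

Lemma inv_demand_cont x : a <= x <= b -> {for x, continuous p}.
Proof. by move=> /reg[lx _ cl _]; apply: cvgV => //; rewrite gt_eqF. Qed.

Lemma inv_supply_cont x : a <= x <= b -> {for x, continuous r}.
Proof. by move=> /reg[_ lx _ cl]; apply: cvgV => //; rewrite gt_eqF. Qed.

Lemma cont_within (f : R -> R) :
  (forall x, a <= x <= b -> {for x, continuous f}) -> {within `[a, b], continuous f}.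
Proof.
move=> cf; apply: continuous_in_subspaceT => x; rewrite inE/= in_itv/=; exact: cf.
Qed.

Lemma cont_measurable (f : R -> R) :
  (forall x, a <= x <= b -> {for x, continuous f}) -> measurable_fun `[a, b] f.
Proof.
move=> cf; apply: subspace_continuous_measurable_fun; first exact: measurable_itv.
exact: cont_within.
Qed.

Lemma inv_demand_gt0 x : a <= x <= b -> 0 < p x.
Proof. by move=> /reg[lx _ _ _]; rewrite invr_gt0. Qed.

Lemma inv_supply_gt0 x : a <= x <= b -> 0 < r x.
Proof. by move=> /reg[_ lx _ _]; rewrite invr_gt0. Qed.

Lemma int_inv_supply_add x y z : a <= x -> x <= y -> y <= z -> z <= b ->
  nd_stieltjes_integral r p x z =
  nd_stieltjes_integral r p x y + nd_stieltjes_integral r p y z.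
Proof.
apply: (nd_stieltjes_add (c := r b) (C := r a) inv_demand_nd inv_demand_cont).
  exact: cont_measurable inv_supply_cont.
by move=> t /andP[ta tb]; rewrite !inv_supply_ni.
Qed.

Lemma int_inv_supply_bounds x y : a <= x -> x <= y -> y <= b ->
  r y * (p y - p x) <= nd_stieltjes_integral r p x y <= r x * (p y - p x).
Proof.
move=> ax xy yb; apply: (nd_stieltjes_bounds (c := r b) (C := r a) inv_demand_nd inv_demand_cont) => //.
- exact: cont_measurable inv_supply_cont.
- by move=> t /andP[ta tb]; rewrite !inv_supply_ni.
- by move=> t /andP[xt ty]; rewrite !inv_supply_ni// ?(le_trans ax)// (le_trans ty).
Qed.

Let opp_inv_supply_nd : nd_on a b (fun x => - r x).
Proof. by move=> x y ax xy yb; rewrite lerN2 inv_supply_ni. Qed.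

Let opp_inv_supply_cont x : a <= x <= b -> {for x, continuous (fun x => - r x)}.
Proof. by move=> h; apply: cvgN; exact: inv_supply_cont. Qed.

Lemma int_inv_demand_add x y z : a <= x -> x <= y -> y <= z -> z <= b ->
  nd_stieltjes_integral p (fun x => - r x) x z =
  nd_stieltjes_integral p (fun x => - r x) x y + nd_stieltjes_integral p (fun x => - r x) y z.
Proof.
apply: (nd_stieltjes_add (c := p a) (C := p b) opp_inv_supply_nd opp_inv_supply_cont).
  exact: cont_measurable inv_demand_cont.
by move=> t /andP[ta tb]; rewrite !inv_demand_nd.
Qed.

Lemma int_inv_demand_bounds x y : a <= x -> x <= y -> y <= b ->
  p x * (r x - r y) <= nd_stieltjes_integral p (fun x => - r x) x y <= p y * (r x - r y).
Proof.
move=> ax xy yb.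
have -> : r x - r y = - r y - - r x by rewrite opprK addrC.
apply: (nd_stieltjes_bounds (c := p a) (C := p b) opp_inv_supply_nd opp_inv_supply_cont) => //.
- exact: cont_measurable inv_demand_cont.
- by move=> t /andP[ta tb]; rewrite !inv_demand_nd.
- by move=> t /andP[xt ty]; rewrite !inv_demand_nd// ?(le_trans ax)// (le_trans ty).
Qed.

(** By the bounds on both integrals, the increments of [H] are at most (p y - p x) (r x - r y) in
    absolute value, a product of increments of p and -r. Hence [H] is constant. *)
Lemma stieltjes_by_parts :
  nd_stieltjes_integral p (fun x => - r x) a b =
  nd_stieltjes_integral r p a b - (p b * r b - p a * r a).
Proof.
pose W x := nd_stieltjes_integral r p a x.
pose V x := nd_stieltjes_integral p (fun x => - r x) a x.
pose H x := p x * r x - W x + V x.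
have HE : H a = H b.
  apply: (@product_bound_eq _ a b 1 H p (fun x => - r x)) => //.
    exact: cont_within.
    exact: inv_demand_nd.
  move=> x y ax xy yb.
  have -> : H y - H x = (p y * r y - p x * r x) - (W y - W x) + (V y - V x).
    by rewrite /H; ring.
  have /andP[s1 s2] := int_inv_supply_bounds ax xy yb.
  have /andP[t1 t2] := int_inv_demand_bounds ax xy yb.
  rewrite /W /V (int_inv_supply_add _ ax xy yb)// (int_inv_demand_add _ ax xy yb)//.
  move: s1 s2 t1 t2.
  set s := nd_stieltjes_integral r p x y; set t := nd_stieltjes_integral p _ x y.
  by move=> s1 s2 t1 t2; rewrite ler_norml; apply/andP; split; lra.
have aa : a <= a by [].
have /andP[w1 w2] := int_inv_supply_bounds aa aa ab; have /andP[v1 v2] := int_inv_demand_bounds aa aa ab.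
have W0 : W a = 0 by rewrite /W; lra.
have V0 : V a = 0 by rewrite /V; lra.
by move: HE; rewrite /H W0 V0 /V /W; lra.
Qed.

End onab.
End weights.

Section Lambda.
Context {R : realType}.
Variables (lm lp : \bar R -> R) (a b : R).
Let l x := lm x%:E.
Let L x := lp x%:E.
Hypothesis ab : a <= b.
Hypothesis reg : regular_on l L a b.
Hypothesis mon : monotone_on l L a b.

Lemma Lambda_minusE : Lambda_minus lm lp a b =
  (l a)^-1 * (l b)^-1 - nd_stieltjes_integral (fun x => (L x)^-1) (fun x => (l x)^-1) a b.
Proof.
rewrite /Lambda_minus /stieltjes_integral invfM asboolT// => x y /=.
by rewrite !in_itv/= => /andP[ax _] /andP[_ yb] xy; exact: (inv_demand_nd reg mon).
Qed.

(** [stieltjes_integral] first tests whether the integrator is nondecreasing. The function 1/L is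
    nonincreasing, so if it passes the test it is constant on [a, b], and then the integrals of both
    branches are 0. *)
Lemma Lambda_plusE : Lambda_plus lm lp a b =
  (L a)^-1 * (L b)^-1 - nd_stieltjes_integral (fun x => (l x)^-1) (fun x => - (L x)^-1) a b.
Proof.
rewrite /Lambda_plus /stieltjes_integral invfM; case: asboolP => // h.
have aa : a <= a by [].
have e : {in `[a, b], forall x, (L x)^-1 = (L a)^-1}.
  move=> x; rewrite in_itv/= => /andP[ax xb]; apply/eqP; rewrite eq_le (inv_supply_ni reg mon)//=.
  by apply: h; rewrite ?in_itv/= ?lexx ?ax.
have eb : (L b)^-1 = (L a)^-1 by apply: e; rewrite in_itv/= lexx ab.
have /andP := int_inv_demand_bounds reg mon aa ab (lexx b).
rewrite /= eb subrr !mulr0 => -[v1 v2].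
have -> : nd_stieltjes_integral (fun x => (l x)^-1) (fun x => - (L x)^-1) a b = 0.
  by apply/eqP; rewrite eq_le v1 v2.
have /andP[] : (l a)^-1 * ((L b)^-1 - (L a)^-1) <= nd_stieltjes_integral (fun x => (l x)^-1) (fun x => (L x)^-1) a b <= (l b)^-1 * ((L b)^-1 - (L a)^-1).
  apply: (@nd_stieltjes_bounds _ a b (fun x => (L x)^-1) (fun x => (l x)^-1) (l a)^-1 (l b)^-1) => //.
  - by move=> x y ax xy yb; apply: h => //; rewrite in_itv/= ?ax ?yb ?(le_trans xy)// (le_trans ax).
  - exact: (inv_supply_cont reg).
  - exact: (cont_measurable (inv_demand_cont reg)).
  - by move=> t /andP[ta tb]; rewrite !(inv_demand_nd reg mon).
  - by move=> t /andP[ta tb]; rewrite !(inv_demand_nd reg mon).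
by rewrite eb subrr !mulr0 /l /L => u1 u2; rewrite subr0 (_ : nd_stieltjes_integral _ _ a b = 0) ?addr0//; apply/eqP; rewrite eq_le u1 u2.
Qed.

(** Integration by parts expresses Lambda_+ through the same integral that occurs in Lambda_-, so
    that both can be read off from one family of weights. *)
Lemma Lambda_plusE_parts : Lambda_plus lm lp a b =
  (L a)^-1 * (L b)^-1 + ((l b)^-1 * (L b)^-1 - (l a)^-1 * (L a)^-1) -
  nd_stieltjes_integral (fun x => (L x)^-1) (fun x => (l x)^-1) a b.
Proof. by rewrite Lambda_plusE (stieltjes_by_parts ab reg mon); ring. Qed.

End Lambda.

(** * The thresholds *)

Section phi.
Context {R : realType}.
Variables (Im Ip : \bar R) (lm lp : \bar R -> R).
Hypothesis lm_cont : {within [set` `[Im, Ip]], continuous lm}.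
Hypothesis lp_cont : {within [set` `[Im, Ip]], continuous lp}.
Hypothesis lm_noninc : {in `[Im, Ip] &, forall x y, (x <= y)%E -> lm y <= lm x}.
Hypothesis lp_nondec : {in `[Im, Ip] &, forall x y, (x <= y)%E -> lp x <= lp y}.
Hypothesis lm_gt0 : forall x : R, in_itv_oo Im Ip x%:E -> 0 < lm x%:E.
Hypothesis lp_gt0 : forall x : R, in_itv_oo Im Ip x%:E -> 0 < lp x%:E.

Local Notation l := (fun x : R => lm x%:E).
Local Notation L := (fun x : R => lp x%:E).
Local Notation inI x := (in_itv_oo Im Ip x%:E).

Lemma in_itv_oo_le a b x : inI a -> inI b -> a <= x <= b -> inI x.
Proof.
move=> /andP[Ia _] /andP[_ bI] /andP[ax xb]; apply/andP; split.
  by apply: lt_le_trans Ia _; rewrite lee_fin.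
by apply: le_lt_trans bI; rewrite lee_fin.
Qed.

Lemma interior_continuous (f : \bar R -> R) x : {within [set` `[Im, Ip]], continuous f} ->
  inI x -> {for x, continuous (fun x : R => f x%:E)}.
Proof.
move=> cf Ix; apply: (@continuous_comp _ _ _ (@EFin R) f).
  by move=> A.
have : {in `]Im, Ip[%classic, continuous f}.
  rewrite -continuous_open_subspace.
    by apply: continuous_subspaceW cf => z /=; rewrite !in_itv/= => /andP[/ltW-> /ltW->].
  rewrite (_ : [set` _] = [set z | Im < z]%E `&` [set z | z < Ip]%E); last first.
    by apply/seteqP; split => z /=; rewrite in_itv/= => /andP.
  by apply: openI; [exact: open_ereal_gt_ereal|exact: open_ereal_lt_ereal].
by apply; rewrite inE /= in_itv.
Qed.

Lemma interior_regular a b : inI a -> inI b -> regular_on l L a b.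
Proof.
move=> Ia Ib x axb; have Ix := in_itv_oo_le Ia Ib axb.
by split; [exact: lm_gt0|exact: lp_gt0|exact: interior_continuous|exact: interior_continuous].
Qed.

Lemma interior_monotone a b : inI a -> inI b -> monotone_on l L a b.
Proof.
move=> Ia Ib x y ax xy yb.
have /andP[Ix xI] : inI x by apply: (in_itv_oo_le Ia Ib); rewrite ax (le_trans xy).
have /andP[Iy yI] : inI y by apply: (in_itv_oo_le Ia Ib); rewrite yb (le_trans ax).
by split; [apply: lm_noninc|apply: lp_nondec]; rewrite ?in_itv/= ?lee_fin ?(ltW Ix) ?(ltW Iy) ?(ltW xI) ?(ltW yI).
Qed.

(** The difference is (1/l(a)) (1/l(y) - 1/l(x)) plus the integral of 1/L against 1/l over [x, y].
    The lower bound is monotonicity in J_-, the upper bound yields continuity. *)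
Lemma Lambda_minus_incr a x y : inI x -> inI a -> x <= y -> y <= a ->
  0 <= Lambda_minus lm lp y a - Lambda_minus lm lp x a <=
  ((l y)^-1 - (l x)^-1) * ((l a)^-1 + (L x)^-1).
Proof.
move=> Ix Ia xy ya; have xa := le_trans xy ya.
have Iy : inI y by apply: (in_itv_oo_le Ix Ia); rewrite xy.
rewrite !Lambda_minusE//; try exact: interior_regular; try exact: interior_monotone.
have reg := interior_regular Ix Ia; have mon := interior_monotone Ix Ia.
rewrite (int_inv_supply_add reg mon (lexx x) xy ya (lexx a)).
have /andP[s1 s2] := int_inv_supply_bounds reg mon (lexx x) xy ya.
have pa : 0 < (l a)^-1 by apply: (inv_demand_gt0 reg); rewrite xa lexx.
have ry : 0 < (L y)^-1 by apply: (inv_supply_gt0 reg); rewrite xy.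
have pxy := inv_demand_nd reg mon (lexx x) xy ya.
have q1 : 0 <= (L y)^-1 * ((l y)^-1 - (l x)^-1) by rewrite mulr_ge0 ?subr_ge0// ltW.
have q2 : 0 <= (l a)^-1 * ((l y)^-1 - (l x)^-1) by rewrite mulr_ge0 ?subr_ge0// ltW.
move: s1 s2 q1 q2 => /=; set s := nd_stieltjes_integral _ _ x y => s1 s2 q1 q2.
by apply/andP; split; lra.
Qed.

Lemma Lambda_minus_diag a : inI a -> 0 < Lambda_minus lm lp a a.
Proof.
move=> Ia; rewrite Lambda_minusE//; try exact: interior_regular; try exact: interior_monotone.
have reg := interior_regular Ia Ia; have mon := interior_monotone Ia Ia.
have /andP[] := int_inv_supply_bounds reg mon (lexx a) (lexx a) (lexx a).
rewrite subrr !mulr0 => s1 s2.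
have pa : 0 < (l a)^-1 by apply: (inv_demand_gt0 reg); rewrite lexx.
have : 0 < (l a)^-1 * (l a)^-1 by rewrite mulr_gt0.
lra.
Qed.

Lemma Lambda_plus_incr a x y : inI a -> inI y -> a <= x -> x <= y ->
  0 <= Lambda_plus lm lp a x - Lambda_plus lm lp a y <=
  ((L x)^-1 - (L y)^-1) * ((L a)^-1 + (l y)^-1).
Proof.
move=> Ia Iy ax xy; have ay := le_trans ax xy.
have Ix : inI x by apply: (in_itv_oo_le Ia Iy); rewrite ax.
rewrite !Lambda_plusE//; try exact: interior_regular; try exact: interior_monotone.
have reg := interior_regular Ia Iy; have mon := interior_monotone Ia Iy.
rewrite (int_inv_demand_add reg mon (lexx a) ax xy (lexx y)).
have /andP[s1 s2] := int_inv_demand_bounds reg mon ax xy (lexx y).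
have ra : 0 < (L a)^-1 by apply: (inv_supply_gt0 reg); rewrite ay lexx.
have px : 0 < (l x)^-1 by apply: (inv_demand_gt0 reg); rewrite xy ax.
have pxy := inv_supply_ni reg mon ax xy (lexx y).
have q1 : 0 <= (l x)^-1 * ((L x)^-1 - (L y)^-1) by rewrite mulr_ge0 ?subr_ge0// ltW.
have q2 : 0 <= (L a)^-1 * ((L x)^-1 - (L y)^-1) by rewrite mulr_ge0 ?subr_ge0// ltW.
move: s1 s2 q1 q2 => /=; set s := nd_stieltjes_integral _ _ x y => s1 s2 q1 q2.
by apply/andP; split; lra.
Qed.

Lemma Lambda_plus_diag a : inI a -> 0 < Lambda_plus lm lp a a.
Proof.
move=> Ia; rewrite Lambda_plusE//; try exact: interior_regular; try exact: interior_monotone.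
have reg := interior_regular Ia Ia; have mon := interior_monotone Ia Ia.
have /andP[] := int_inv_demand_bounds reg mon (lexx a) (lexx a) (lexx a).
rewrite subrr !mulr0 => s1 s2.
have pa : 0 < (L a)^-1 by apply: (inv_supply_gt0 reg); rewrite lexx.
have : 0 < (L a)^-1 * (L a)^-1 by rewrite mulr_gt0.
lra.
Qed.

Lemma real_between_l (x : R) : (Im < x%:E)%E -> exists2 c, (Im < c%:E)%E & c < x.
Proof.
case: Im => [m||]; rewrite ?lte_fin//.
  by move=> mx; exists ((m + x) / 2); rewrite ?lte_fin; lra.
by move=> _; exists (x - 1); [exact: ltNyr|lra].
Qed.

Lemma real_between_r (x : R) : (x%:E < Ip)%E -> exists2 c, (c%:E < Ip)%E & x < c.
Proof.
case: Ip => [m||]; rewrite ?lte_fin//.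
  by move=> mx; exists ((m + x) / 2); rewrite ?lte_fin; lra.
by move=> _; exists (x + 1); [exact: ltry|lra].
Qed.

(** By continuity Lambda_- is still positive at some y < x, and by monotonicity it is positive on
    all of [y, a]. So y is an upper bound of the set defining [phi_minus], which makes the
    inequality strict. The case x = a is included and gives the first claim of the theorem. *)
Lemma phi_minus_lt (x a : R) : inI x -> inI a -> x <= a ->
  0 < Lambda_minus lm lp x a -> (phi_minus Im lm lp a < x%:E)%E.
Proof.
move=> Ix Ia xa Lx; have [c Ic cx] := real_between_l (andP Ix).1.
have Ic' : inI c by rewrite /in_itv_oo Ic (lt_trans _ (andP Ix).2)// lte_fin.
(* The point c keeps y away from [Im]: for y in [c, x] the factor 1/L(y) in [Lambda_minus_incr] is
   at most 1/L(c), so K does not depend on y. *)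
pose K := (l a)^-1 + (L c)^-1.
have reg := interior_regular Ic' Ia; have mon := interior_monotone Ic' Ia.
have K0 : 0 < K.
  rewrite addr_gt0//; first by apply: (inv_demand_gt0 reg); rewrite lexx (le_trans (ltW cx)).
  by apply: (inv_supply_gt0 reg); rewrite lexx (le_trans (ltW cx)).
have cp : {for x, continuous (fun x => (l x)^-1)}.
  by apply: (inv_demand_cont reg); rewrite (ltW cx).
have [y /andP[cy yx] py] : exists2 y, c <= y < x & ((l x)^-1 - (l y)^-1) * K < Lambda_minus lm lp x a.
  have /cvgrPdist_lt /(_ (Lambda_minus lm lp x a / K)) := cp.
  rewrite divr_gt0// => /(_ isT) [e /= e0 he].
  pose y := Num.max c (x - e / 2).
  have yx : y < x by rewrite gt_max cx; lra.
  exists y; first by rewrite le_max lexx.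
  have := he y; rewrite /ball_/= => /(_ _) h; rewrite -ltr_pdivlMr//.
  apply: le_lt_trans (ler_norm _) (h _); rewrite ger0_norm; last by rewrite subr_ge0 ltW.
  have : x - e / 2 <= y by rewrite le_max lexx orbT.
  lra.
have xy := ltW yx.
have Iy : inI y by apply: (in_itv_oo_le Ic' Ix); rewrite cy.
have Ly : 0 < Lambda_minus lm lp y a.
  have /andP[_] := Lambda_minus_incr Iy Ia xy xa.
  have pxy : (l y)^-1 <= (l x)^-1 by apply: (inv_demand_nd reg mon).
  have rcy : (L y)^-1 <= (L c)^-1 by apply: (inv_supply_ni reg mon) => //; exact: le_trans xa.
  have : ((l x)^-1 - (l y)^-1) * ((l a)^-1 + (L y)^-1) <= ((l x)^-1 - (l y)^-1) * K.
    by rewrite ler_wpM2l// ?subr_ge0// lerD2l.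
  move: py; lra.
rewrite /phi_minus; case: ifPn => _; first by case/andP: Ix.
apply: (@le_lt_trans _ _ y%:E); last by rewrite lte_fin.
apply: ge_ereal_sup => _ [z [Iz za Lz] <-]; rewrite lee_fin leNgt; apply/negP => yz.
have /andP[+ _] := Lambda_minus_incr Iy Ia (ltW yz) (ltW za).
lra.
Qed.

Lemma phi_minus_ltP (x a : R) : inI x -> inI a -> x < a ->
  (phi_minus Im lm lp a < x%:E)%E <-> 0 < Lambda_minus lm lp x a.
Proof.
move=> Ix Ia xa; split; last by apply: phi_minus_lt => //; exact: ltW.
move=> h; rewrite ltNge; apply/negP => Lx; move: h; rewrite ltNge => /negP; apply.
rewrite /phi_minus; case: ifPn => [/eqP A0|_].
  have : [set Jm%:E | Jm in [set Jm : R | [/\ (Im < Jm%:E)%E, Jm < a & Lambda_minus lm lp Jm a <= 0]]] x%:E.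
    by exists x => //; split => //; case/andP: Ix.
  by rewrite A0.
by apply: ereal_sup_ubound; exists x => //; split => //; case/andP: Ix.
Qed.

(** Mirror image of [phi_minus_lt]: Lambda_+ stays positive up to some y > x and decreases in
    J_+. *)
Lemma phi_plus_gt (x a : R) : inI x -> inI a -> a <= x ->
  0 < Lambda_plus lm lp a x -> (x%:E < phi_plus Ip lm lp a)%E.
Proof.
move=> Ix Ia ax Lx; have [c cI xc] := real_between_r (andP Ix).2.
have Ic' : inI c by rewrite /in_itv_oo cI (lt_trans (andP Ix).1)// lte_fin.
pose K := (L a)^-1 + (l c)^-1.
have reg := interior_regular Ia Ic'; have mon := interior_monotone Ia Ic'.
have K0 : 0 < K.
  rewrite addr_gt0//; first by apply: (inv_supply_gt0 reg); rewrite lexx (le_trans _ (ltW xc)).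
  by apply: (inv_demand_gt0 reg); rewrite lexx (le_trans _ (ltW xc)).
have cp : {for x, continuous (fun x => (L x)^-1)}.
  by apply: (inv_supply_cont reg); rewrite (ltW xc) ax.
have [y /andP[xy yc] py] : exists2 y, x < y <= c & ((L x)^-1 - (L y)^-1) * K < Lambda_plus lm lp a x.
  have /cvgrPdist_lt /(_ (Lambda_plus lm lp a x / K)) := cp.
  rewrite divr_gt0// => /(_ isT) [e /= e0 he].
  pose y := Num.min c (x + e / 2).
  have yx : x < y by rewrite lt_min xc; lra.
  exists y; first by rewrite ge_min lexx yx.
  have := he y; rewrite /ball_/= => /(_ _) h; rewrite -ltr_pdivlMr//.
  apply: le_lt_trans (ler_norm _) (h _); rewrite distrC ger0_norm; last by rewrite subr_ge0 ltW.
  have : y <= x + e / 2 by rewrite ge_min lexx orbT.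
  lra.
have yx := ltW xy.
have Iy : inI y by apply: (in_itv_oo_le Ix Ic'); rewrite yc yx.
have ay := le_trans ax yx.
have Ly : 0 < Lambda_plus lm lp a y.
  have /andP[_] := Lambda_plus_incr Ia Iy ax yx.
  have pxy : (L y)^-1 <= (L x)^-1 by apply: (inv_supply_ni reg mon).
  have rcy : (l y)^-1 <= (l c)^-1 by apply: (inv_demand_nd reg mon).
  have : ((L x)^-1 - (L y)^-1) * ((L a)^-1 + (l y)^-1) <= ((L x)^-1 - (L y)^-1) * K.
    by rewrite ler_wpM2l// ?subr_ge0// lerD2l.
  move: py; lra.
rewrite /phi_plus; case: ifPn => _; first by case/andP: Ix.
apply: (@lt_le_trans _ _ y%:E); first by rewrite lte_fin.
apply: le_ereal_inf_tmp => _ [z [az Iz Lz] <-]; rewrite lee_fin leNgt; apply/negP => zy.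
have /andP[+ _] := Lambda_plus_incr Ia Iy (ltW az) (ltW zy).
lra.
Qed.

Lemma phi_plus_gtP (x a : R) : inI x -> inI a -> a < x ->
  (x%:E < phi_plus Ip lm lp a)%E <-> 0 < Lambda_plus lm lp a x.
Proof.
move=> Ix Ia xa; split; last by apply: phi_plus_gt => //; exact: ltW.
move=> h; rewrite ltNge; apply/negP => Lx; move: h; rewrite ltNge => /negP; apply.
rewrite /phi_plus; case: ifPn => [/eqP A0|_].
  have : [set Jp%:E | Jp in [set Jp : R | [/\ a < Jp, (Jp%:E < Ip)%E & Lambda_plus lm lp a Jp <= 0]]] x%:E.
    by exists x => //; split => //; case/andP: Ix.
  by rewrite A0.
by apply: ereal_inf_lbound; exists x => //; split => //; case/andP: Ix.
Qed.

End phi.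

(** * Order books as pairs of lists *)

Section list_model.
Context {R : realType}.
Variables a b : R.
Implicit Types (x : seq R * seq R) (o : R * bool).

Definition bid x : R := \big[Num.max/a]_(y <- x.1) y.
Definition ask x : R := \big[Num.min/b]_(y <- x.2) y.

(** If there is no bid then [bid x] is a, and [rem] leaves the empty list unchanged; this agrees
    with the Luckock map, which ignores an order whose price ends up at an endpoint. Asks behave in
    the same way at b. *)
Definition step o x : seq R * seq R :=
  if o.2 then
    if o.1 <= bid x then (rem (bid x) x.1, x.2)
    else if o.1 < b then (x.1, o.1 :: x.2) else x
  else
    if ask x <= o.1 then (x.1, rem (ask x) x.2)
    else if a < o.1 then (o.1 :: x.1, x.2) else x.

Definition ordered x : Prop :=
  [/\ {in x.1, forall y, a < y < b}, {in x.2, forall y, a < y < b} &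
      {in x.1 & x.2, forall y z, y < z}].

Definition weight (wm wp : R -> R) x := \sum_(y <- x.1) wm y + \sum_(y <- x.2) wp y.

(* Change of [weight wm wp] caused by the order o when the best bid and ask are
   m and M; m = a and M = b mean that there is no bid, respectively no ask. *)
Definition jump (wm wp : R -> R) (m M : R) o : R :=
  if o.2 then
    if o.1 <= m then (if a < m then - wm m else 0)
    else if o.1 < b then wp o.1 else 0
  else
    if M <= o.1 then (if M < b then - wp M else 0)
    else if a < o.1 then wm o.1 else 0.

Lemma bid_nil : bid ([::], [::]) = a. Proof. by rewrite /bid big_nil. Qed.
Lemma ask_nil : ask ([::], [::]) = b. Proof. by rewrite /ask big_nil. Qed.

Lemma bid_ge x y : y \in x.1 -> y <= bid x.
Proof.
rewrite /bid; elim: x.1 => // z s IH; rewrite inE big_cons le_max.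
by move=> /orP[/eqP->|/IH->]; rewrite ?lexx ?orbT.
Qed.

Lemma ask_le x y : y \in x.2 -> ask x <= y.
Proof.
rewrite /ask; elim: x.2 => // z s IH; rewrite inE big_cons ge_min.
by move=> /orP[/eqP->|/IH->]; rewrite ?lexx ?orbT.
Qed.

Lemma bid_gea x : a <= bid x.
Proof. by rewrite /bid; elim: x.1 => [|z s IH]; rewrite ?big_nil ?big_cons ?le_max ?IH ?orbT. Qed.

Lemma ask_leb x : ask x <= b.
Proof. by rewrite /ask; elim: x.2 => [|z s IH]; rewrite ?big_nil ?big_cons ?ge_min ?IH ?orbT. Qed.

Lemma bid_mem x : a < bid x -> bid x \in x.1.
Proof.
rewrite /bid; elim: x.1 => [|z s IH]; first by rewrite big_nil ltxx.
rewrite big_cons inE; have [h|h] := leP z (\big[Num.max/a]_(j <- s) j).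
  by move=> /IH ->; rewrite orbT.
by rewrite eqxx.
Qed.

Lemma ask_mem x : ask x < b -> ask x \in x.2.
Proof.
rewrite /ask; elim: x.2 => [|z s IH]; first by rewrite big_nil ltxx.
rewrite big_cons inE; have [h|h] := leP z (\big[Num.min/b]_(j <- s) j).
  by rewrite eqxx.
by move=> /IH ->; rewrite orbT.
Qed.

Lemma bid_gt x : ordered x -> (a < bid x) = (x.1 != [::]).
Proof.
move=> [h _ _]; apply/idP/idP.
  by move=> /bid_mem; case: (x.1).
case: x h => -[//|y s] t /= h _; apply: (@lt_le_trans _ _ y).
  by have /andP[] := h y (mem_head _ _).
by apply: bid_ge; rewrite mem_head.
Qed.

Lemma ask_lt x : ordered x -> (ask x < b) = (x.2 != [::]).
Proof.
move=> [_ h _]; apply/idP/idP.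
  by move=> /ask_mem; case: (x.2).
case: x h => s [//|y t] /= h _; apply: (@le_lt_trans _ _ y).
  by apply: ask_le; rewrite mem_head.
by have /andP[] := h y (mem_head _ _).
Qed.

Lemma ordered_nil : ordered ([::], [::]). Proof. by split. Qed.

Lemma bid_lt_ask x : a < b -> ordered x -> bid x < ask x.
Proof.
move=> ab [h1 h2 h3].
have [hb|] := ltP a (bid x); have [ha|] := ltP (ask x) b.
- by apply: h3; [exact: bid_mem|exact: ask_mem].
- by apply: lt_le_trans; have /andP[] := h1 _ (bid_mem hb).
- by move=> ?; apply: (@le_lt_trans _ _ a) => //; have /andP[] := h2 _ (ask_mem ha).
- by move=> h h'; apply: le_lt_trans h' (lt_le_trans ab h).
Qed.

Lemma step_ordered o x : a < b -> a <= o.1 <= b -> ordered x -> ordered (step o x).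
Proof.
move=> ab /andP[ao ob] ox; have [h1 h2 h3] := ox; rewrite /step; case: ifP => _.
  case: (ltP (bid x) o.1) => [bo|_].
    case: (ltP o.1 b) => [oltb|_] //; split => //= [y|y z].
      by rewrite inE => /orP[/eqP->|/h2//]; rewrite oltb andbT (le_lt_trans (bid_gea x)).
    move=> y1; rewrite inE => /orP[/eqP->|]; last exact: h3.
    exact: le_lt_trans (bid_ge y1) bo.
  by split => //= [y /mem_rem/h1//|y z /mem_rem]; exact: h3.
case: (ltP o.1 (ask x)) => [bo|_].
  case: (ltP a o.1) => [oltb|_] //; split => //= [y|y z].
    by rewrite inE => /orP[/eqP->|/h1//]; rewrite oltb (lt_le_trans bo (ask_leb x)).
  rewrite inE => /orP[/eqP->|]; last exact: h3.
  by move=> z2; exact: lt_le_trans bo (ask_le z2).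
by split => //= [y /mem_rem/h2//|y z y1 /mem_rem]; exact: h3.
Qed.

Lemma sum_rem (w : R -> R) (y : R) s : y \in s ->
  \sum_(z <- rem y s) w z = \sum_(z <- s) w z - w y.
Proof. by move=> ys; rewrite [in RHS](big_rem y ys)/= [w y + _]addrC addrK. Qed.

Lemma weight_step wm wp o x : ordered x ->
  weight wm wp (step o x) = weight wm wp x + jump wm wp (bid x) (ask x) o.
Proof.
move=> ox; have [h1 h2 _] := ox; rewrite /step /jump /weight.
case: ifP => _; case: ifP => _ /=.
- case: ifPn => [ab|].
    by rewrite sum_rem ?bid_mem//; ring.
  by rewrite bid_gt// negbK => /eqP->; rewrite addr0.
- by case: ifP => _ /=; rewrite ?big_cons; ring.
- case: ifPn => [ab|].
    by rewrite sum_rem ?ask_mem//; ring.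
  by rewrite ask_lt// negbK => /eqP->; rewrite addr0.
- by case: ifP => _ /=; rewrite ?big_cons; ring.
Qed.

Definition book_of x : @book R := fun y => (count_mem y x.2)%:Z - (count_mem y x.1)%:Z.

Lemma book_pos x y : ordered x -> (0 < book_of x y) = (y \in x.2).
Proof.
move=> [h1 h2 h3]; rewrite /book_of subr_gt0 ltz_nat.
have [y2|/count_memPn->//] := boolP (y \in x.2).
have [y1|/count_memPn->] := boolP (y \in x.1); last by rewrite -has_count has_pred1.
by have := h3 _ _ y1 y2; rewrite ltxx.
Qed.

Lemma book_neg x y : ordered x -> (book_of x y < 0) = (y \in x.1).
Proof.
move=> [h1 h2 h3]; rewrite /book_of subr_lt0 ltz_nat.
have [y1|/count_memPn->//] := boolP (y \in x.1).
have [y2|/count_memPn->] := boolP (y \in x.2); last by rewrite -has_count has_pred1.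
by have := h3 _ _ y1 y2; rewrite ltxx.
Qed.

Lemma book_eq0 x : ordered x -> (book_of x = (fun=> 0)) <-> x = ([::], [::]).
Proof.
move=> ox; split; last by move=> ->; apply/funext.
move=> h; case: x ox h => -[|y s] [|z t] ox h //.
- by have := book_pos z ox; rewrite h mem_head.
- by have := book_neg y ox; rewrite h mem_head.
- by have := book_neg y ox; rewrite h mem_head.
Qed.

Lemma best_bid_book x : ordered x -> best_bid a%:E b%:E (book_of x) = (bid x)%:E.
Proof.
move=> ox; have [h1 h2 h3] := ox; rewrite /best_bid; apply/le_anti/andP; split.
  apply: ge_ereal_sup => w [->|[y [_ /=]]]; first by rewrite lee_fin bid_gea.
  by rewrite book_neg// => yx <-; rewrite lee_fin bid_ge.
apply: ereal_sup_ubound; have := bid_gea x; rewrite le_eqVlt => /orP[/eqP<-|ax]; [by left|right].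
exists (bid x) => //; have bm := bid_mem ax; rewrite /= book_neg//; split => //.
by rewrite /in_itv_oo !lte_fin h1.
Qed.

Lemma best_ask_book x : ordered x -> best_ask a%:E b%:E (book_of x) = (ask x)%:E.
Proof.
move=> ox; have [h1 h2 h3] := ox; rewrite /best_ask; apply/le_anti/andP; split; last first.
  apply: le_ereal_inf_tmp => w [->|[y [_ /=]]]; first by rewrite lee_fin ask_leb.
  by rewrite book_pos// => yx <-; rewrite lee_fin ask_le.
apply: ereal_inf_lbound; have := ask_leb x; rewrite le_eqVlt => /orP[/eqP->|ax]; [by left|right].
exists (ask x) => //; have bm := ask_mem ax; rewrite /= book_pos//; split => //.
by rewrite /in_itv_oo !lte_fin h2.
Qed.

Lemma book_rem1 x (y : R) : y \in x.1 ->
  book_of (rem y x.1, x.2) = fun z => book_of x z + delta y%:E z.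
Proof.
move=> yx; apply/funext => z; rewrite /book_of /delta eqe /= count_rem yx/=.
have [->|zy] := eqVneq z y; last by rewrite subn0 addr0.
have := yx; rewrite -has_pred1 has_count => c0; rewrite -subzn//=; ring.
Qed.

Lemma book_rem2 x (y : R) : y \in x.2 ->
  book_of (x.1, rem y x.2) = fun z => book_of x z - delta y%:E z.
Proof.
move=> yx; apply/funext => z; rewrite /book_of /delta eqe /= count_rem yx/=.
have [->|zy] := eqVneq z y; last by rewrite subn0 subr0.
have := yx; rewrite -has_pred1 has_count => c0; rewrite -subzn//=; ring.
Qed.

(** An order outside [a, b] acts like one at the nearer endpoint: it is executed against the same
    orders, and neither is ever placed in the book, since only prices strictly inside the interval
    are. *)
Lemma luckock_map_book (u : \bar R) (s : bool) x : a < b -> ordered x ->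
  luckock_map a%:E b%:E (u, s) (book_of x) =
  book_of (step (fine (Order.max a%:E (Order.min u b%:E)), s) x).
Proof.
move=> ab ox; have [h1 h2 h3] := ox.
have bb : bid x < b by apply: lt_le_trans (bid_lt_ask ab ox) (ask_leb x).
have aa : a < ask x by apply: le_lt_trans (bid_lt_ask ab ox); exact: bid_gea.
have [v vE] : exists v, Order.max a%:E (Order.min u b%:E) = v%:E.
  case: u => [u||].
  - by rewrite -EFin_min -EFin_max; eexists.
  - by rewrite min_r ?leey// -EFin_max; eexists.
  - by rewrite min_l ?leNye// max_l ?leNye//; eexists.
have /andP[av vb] : a <= v <= b.
  by rewrite -!lee_fin -vE le_max lexx/= ge_max ge_min lexx orbT andbT lee_fin ltW.
rewrite vE/= best_bid_book// best_ask_book// /step/= /in_itv_oo.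
(* Clamping u to v changes no comparison with a possible best ask or best bid, and if v is interior
   then u = v. *)
have ltE y : a < y <= b -> (u < y%:E)%E = (v < y).
  move=> /andP[ay yb]; rewrite -lte_fin -vE gt_max lte_fin ay/= gt_min lte_fin.
  by rewrite (ltNge b) yb orbF.
have gtE y : a <= y < b -> (y%:E < u)%E = (y < v).
  move=> /andP[ay yb]; rewrite -[RHS]lte_fin -vE lt_max lte_fin lt_min lte_fin.
  by rewrite (ltNge y) ay/= yb andbT.
have uE : a < v < b -> u = v%:E.
  move=> /andP[av' vb']; move: vE; have := av'; have := vb'; rewrite -(ltE b) ?ab ?lexx//.
  rewrite -(gtE a) ?lexx ?ab// => ub au.
  by rewrite (min_l (ltW ub)) (max_r (ltW au)).
case: s.
  have gE : ((bid x)%:E < u)%E = (bid x < v) by apply: gtE; rewrite bid_gea.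
  have [bv|vb'] := ltP (bid x) v.
    rewrite max_l; last by rewrite ltW// gE.
    have au : (a%:E < u)%E by rewrite gtE ?lexx// (le_lt_trans (bid_gea x)).
    rewrite au ltE ?ab ?lexx//=; case: ltP => // vb'.
    rewrite (uE _) ?vb' ?(le_lt_trans (bid_gea x))//.
    apply/funext => z; rewrite /book_of /delta eqe/= [z == v]eq_sym.
    by case: eqVneq => _; rewrite ?addr0// add1n -addn1 PoszD addrAC.
  rewrite max_r; last by rewrite leNgt gE -leNgt.
  rewrite !lte_fin bb andbT; case: ifPn => [ab'|].
    by rewrite book_rem1// bid_mem.
  by rewrite bid_gt// negbK => /eqP x1; rewrite x1/=; case: (x) x1 => ? ? /= ->.
have gE : (u < (ask x)%:E)%E = (v < ask x) by apply: ltE; rewrite aa ask_leb.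
have [bv|vb'] := ltP v (ask x).
  rewrite min_l; last by rewrite ltW// gE.
  have ub : (u < b%:E)%E by rewrite ltE ?lexx ?ab// (lt_le_trans bv (ask_leb x)).
  rewrite ub andbT gtE ?ab ?lexx//=; case: ltP => // av'.
  rewrite (uE _) ?av' ?(lt_le_trans bv (ask_leb x))//.
  apply/funext => z; rewrite /book_of /delta eqe/= [z == v]eq_sym.
  by case: eqVneq => _; rewrite ?subr0// add1n -addn1 PoszD opprD addrA.
rewrite min_r; last by rewrite leNgt gE -leNgt.
rewrite !lte_fin aa/=; case: ifPn => [ab'|].
  by rewrite book_rem2// ask_mem.
by rewrite ask_lt// negbK => /eqP x1; rewrite x1/=; case: (x) x1 => ? ? /= ->.
Qed.

Fixpoint lchain (eta : nat -> R * bool) (k : nat) : seq R * seq R :=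
  if k is k'.+1 then step (eta k') (lchain eta k') else ([::], [::]).

Lemma lchain_ordered eta k : a < b -> (forall i, a <= (eta i).1 <= b) ->
  ordered (lchain eta k).
Proof. by move=> ab h; elim: k => [|k IH] /=; [exact: ordered_nil|exact: step_ordered]. Qed.

Definition clamp_order (o : \bar R * bool) : R * bool :=
  (fine (Order.max a%:E (Order.min o.1 b%:E)), o.2).

Lemma clamp_orderE u : a < b ->
  Order.max a%:E (Order.min u b%:E) = (fine (Order.max a%:E (Order.min u b%:E)))%:E.
Proof.
move=> ab; case: u => [u||].
- by rewrite -EFin_min -EFin_max.
- by rewrite min_r ?leey// -EFin_max.
- by rewrite min_l ?leNye// max_l ?leNye.
Qed.

Lemma clamp_order_bound (o : \bar R * bool) : a < b -> a <= (clamp_order o).1 <= b.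
Proof.
move=> ab; rewrite /clamp_order/= -!lee_fin -clamp_orderE//.
by rewrite le_max lexx/= ge_max ge_min lexx orbT andbT lee_fin ltW.
Qed.

Lemma luckock_chain_book (xi : nat -> \bar R * bool) k : a < b ->
  luckock_chain a%:E b%:E xi k = book_of (lchain (fun i => clamp_order (xi i)) k).
Proof.
move=> ab; elim: k => [|k IH] /=; first by apply/funext.
rewrite IH; case: (xi k) => u s; rewrite luckock_map_book//.
by apply: lchain_ordered => // i; exact: clamp_order_bound.
Qed.

End list_model.

(** * Measurability of best prices and weights along the chain *)

Section measurability.
Context {R : realType}.
Variables a b : R.
Hypothesis ab : a < b.

Lemma jump_measurable (wm wp : R -> R) d (T : measurableType d) (m M : T -> R) (o : T -> R * bool) :
  measurable_fun setT wm -> measurable_fun setT wp ->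
  measurable_fun setT m -> measurable_fun setT M -> measurable_fun setT o ->
  measurable_fun setT (fun w => jump a b wm wp (m w) (M w) (o w)).
Proof.
move=> mwm mwp mm mM mo; rewrite /jump.
have m1 : measurable_fun setT (fun w => (o w).1) by exact: (measurableT_comp measurable_fst).
have m2 : measurable_fun setT (fun w => (o w).2) by exact: (measurableT_comp measurable_snd).
by do ![apply: measurable_fun_ifT => //]; do ?[exact: measurable_fun_ler|exact: measurable_fun_ltr];
  try apply: measurable_funN; apply: measurableT_comp.
Qed.

Variables (d : measure_display) (T : measurableType d) (eta : nat -> T -> R * bool).
Variable n : nat.
Hypothesis meta : forall i, (i < n)%N -> measurable_fun setT (eta i).
Hypothesis heta : forall i w, a <= (eta i w).1 <= b.

Local Notation St k := (fun w => lchain a b (eta ^~ w) k).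

Let ox k w : ordered a b (St k w). Proof. exact: lchain_ordered. Qed.

(** This turns a level set of the best bid into one of an additive weight, and for weights
    [weight_step] gives a recursion. *)
Lemma weight_indic_bid t x : ordered a b x -> a <= t ->
  (t < bid a x) = (0 < weight (\1_(`]t, +oo[%classic) : R -> R) (cst 0) x).
Proof.
move=> [h _ _] at_; rewrite /weight [X in _ + X]big1// addr0; apply/idP/idP => [tb|].
  have bx : bid a x \in x.1 by apply: bid_mem; exact: le_lt_trans tb.
  by rewrite (big_rem _ bx)//= indicE mem_set/= ?in_itv/= ?tb// ltr_pwDl// sumr_ge0.
move=> s0; rewrite ltNge; apply/negP => bt; move: s0; rewrite big1_seq ?ltxx// => y /= yx.
rewrite indicE memNset//= in_itv/= andbT => ty.
by have := lt_le_trans ty (le_trans (bid_ge a yx) bt); rewrite ltxx.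
Qed.

Lemma weight_indic_ask t x : ordered a b x -> t <= b ->
  (ask b x < t) = (0 < weight (cst 0) (\1_(`]-oo, t[%classic) : R -> R) x).
Proof.
move=> [_ h _] at_; rewrite /weight [X in X + _]big1// add0r; apply/idP/idP => [tb|].
  have bx : ask b x \in x.2 by apply: ask_mem; exact: lt_le_trans at_.
  by rewrite (big_rem _ bx)//= indicE mem_set/= ?in_itv/= ?tb// ltr_pwDl// sumr_ge0.
move=> s0; rewrite ltNge; apply/negP => bt; move: s0; rewrite big1_seq ?ltxx// => y /= yx.
rewrite indicE memNset//= in_itv/= => ty.
by have := le_lt_trans (le_trans bt (ask_le b yx)) ty; rewrite ltxx.
Qed.

(** The three claims need each other: a weight changes by a jump that depends on the previous best
    prices and the new order, and the level sets of the best prices are level sets of weights of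
    indicators. Only the first n orders have to be measurable, so the result also applies to the
    sigma-algebra of the past. *)
Lemma state_measurable k : (k <= n)%N ->
  [/\ measurable_fun setT (fun w => bid a (St k w)),
      measurable_fun setT (fun w => ask b (St k w)) &
      forall wm wp, measurable_fun setT wm -> measurable_fun setT wp ->
        measurable_fun setT (fun w => weight wm wp (St k w))].
Proof.
elim: k => [_|k IH kn].
  rewrite /=; split; [| |move=> wm wp _ _]; exact: measurable_cst.
have [mb ma mt] := IH (ltnW kn).
have mT wm wp : measurable_fun setT wm -> measurable_fun setT wp ->
    measurable_fun setT (fun w => weight wm wp (St k.+1 w)).
  move=> mwm mwp; rewrite [X in measurable_fun _ X](_ : _ =
     (fun w => weight wm wp (St k w) + jump a b wm wp (bid a (St k w)) (ask b (St k w)) (eta k w))).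
    by apply: measurable_funD; [exact: mt|apply: jump_measurable => //; exact: meta].
  by apply/funext => w /=; rewrite weight_step.
split => //.
- apply: (measurability (@RGenOInfty.G R)); first exact: RGenOInfty.measurableE.
  move=> _ [_ [t ->] <-]; rewrite setTI.
  have [ta|at_] := ltP t a.
    rewrite (_ : _ @^-1` _ = setT)//; apply/seteqP; split => // w _ /=.
    by rewrite in_itv/= andbT (lt_le_trans ta)// bid_gea.
  rewrite (_ : _ @^-1` _ = (fun w => weight (\1_(`]t, +oo[%classic) : R -> R) (cst 0) (St k.+1 w)) @^-1` `]0, +oo[).
    by rewrite -[X in measurable X]setTI; apply: mT => //; apply: measurable_indic; exact: measurable_itv.
  by apply/seteqP; split => w /=; rewrite !in_itv/= !andbT weight_indic_bid//; apply: (ox k.+1).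
- apply: (measurability (@RGenInftyO.G R)); first exact: RGenInftyO.measurableE.
  move=> _ [_ [t ->] <-]; rewrite setTI.
  have [ta|at_] := ltP b t.
    rewrite (_ : _ @^-1` _ = setT)//; apply/seteqP; split => // w _ /=.
    by rewrite in_itv/= (le_lt_trans _ ta)// ask_leb.
  rewrite (_ : _ @^-1` _ = (fun w => weight (cst 0) (\1_(`]-oo, t[%classic) : R -> R) (St k.+1 w)) @^-1` `]0, +oo[).
    by rewrite -[X in measurable X]setTI; apply: mT => //; apply: measurable_indic; exact: measurable_itv.
  by apply/seteqP; split => w /=; rewrite !in_itv/= !andbT weight_indic_ask//; apply: (ox k.+1).
Qed.

End measurability.

(** * Independence of the next order from the past *)

Section independence.
Context {R : realType} d (Om : measurableType d) (P : probability Om R).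
Context d1 (T : measurableType d1) (eta : nat -> Om -> T) (rho : probability T R).
Hypothesis meta : forall k, measurable_fun setT (eta k).

Definition cylinders (k : nat) : set (set Om) := [set A | exists2 B : nat -> set T,
  (forall i, measurable (B i)) & A = \bigcap_(i in [set i | (i < k)%N]) (eta i @^-1` B i)].

Hypothesis ind : forall k A B, cylinders k A -> measurable B ->
  P (A `&` eta k @^-1` B) = (P A * rho B)%E.

Let meta' k (B : set T) : measurable B -> measurable (eta k @^-1` B).
Proof. by move=> mB; rewrite -[X in measurable X]setTI; exact: meta. Qed.

Lemma cylinders_measurable k : cylinders k `<=` measurable.
Proof.
move=> _ [B mB ->]; apply: bigcap_measurableType => i _; exact: meta'.
Qed.

Lemma cylinders_setI k : setI_closed (cylinders k).
Proof.
move=> _ _ [B mB ->] [C mC ->]; exists (fun i => B i `&` C i).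
  by move=> i; exact: measurableI.
by rewrite -bigcapI; apply: eq_bigcapr => i _; rewrite preimage_setI.
Qed.

Lemma cylindersT k : cylinders k setT.
Proof. by exists (fun=> setT) => //; apply/seteqP; split. Qed.

Lemma past_measurable k i : (i < k)%N ->
  measurable_fun (setT : set (g_sigma_algebraType (cylinders k))) (eta i).
Proof.
move=> ik _ B mB; rewrite setTI; apply: sub_sigma_algebra.
exists (fun j => if j == i then B else setT); first by move=> j; case: ifP.
apply/seteqP; split => w /=.
  by move=> wB j _ /=; case: eqP => [->|].
by move=> /(_ i ik); rewrite eqxx.
Qed.

(** Both sides are finite measures in A that agree on the cylinders, a family closed under
    intersection that contains the whole space. *)
Lemma past_independent k A B : <<s cylinders k >> A -> measurable B ->
  P (A `&` eta k @^-1` B) = (P A * rho B)%E.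
Proof.
move=> sA mB; have mE := meta' k mB.
have r0 : (0 <= fine (rho B)) by exact: fine_ge0.
pose m1 := mrestr P mE; pose m2 := mscale (NngNum r0) P.
have e2 X : m2 X = (P X * rho B)%E.
  by rewrite /m2 /mscale/= fineK ?fin_num_measure// muleC.
rewrite -e2; have -> : P (A `&` eta k @^-1` B) = m1 A by [].
apply: (@g_sigma_algebra_measure_unique _ R Om (cylinders k) _ (fun=> setT)) => //.
- exact: cylinders_measurable.
- by move=> _; exact: cylindersT.
- by rewrite bigcup_const.
- exact: cylinders_setI.
- by move=> X cX; apply: etrans (esym (e2 X)); exact: ind.
- by move=> _; rewrite /m1 /mrestr/= (le_lt_trans (probability_le1 _ _)) ?ltry// setTI.
Qed.

(** If Y depends on the first k orders only, the joint law of Y and order k is the product of the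
    law of Y and [rho], so Tonelli's theorem applies. *)
Lemma past_tonelli k d2 (T' : measurableType d2) (Y : Om -> T') (f : T' * T -> \bar R) :
  measurable_fun (setT : set (g_sigma_algebraType (cylinders k))) Y ->
  measurable_fun setT f -> (forall z, (0 <= f z)%E) ->
  (\int[P]_w f (Y w, eta k w) = \int[P]_w \int[rho]_o f (Y w, o))%E.
Proof.
move=> mYk mf f0.
have pY B : measurable B -> <<s cylinders k >> (Y @^-1` B).
  by move=> mB; have := mYk measurableT B mB; rewrite setTI.
have mY : measurable_fun setT Y.
  move=> _ B mB; rewrite setTI.
  by have := smallest_sub (@sigma_algebra_measurable _ Om) (@cylinders_measurable k); apply; exact: pY.
pose Ym : {mfun Om >-> T'} := HB.pack Y (isMeasurableFun.Build _ _ _ _ _ mY).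
have mZ : measurable_fun setT (fun w => (Y w, eta k w)) by exact: measurable_fun_pair.
pose Zm : {mfun Om >-> (T' * T)%type} := HB.pack (fun w => (Y w, eta k w)) (isMeasurableFun.Build _ _ _ _ _ mZ).
pose mu1 : probability T' R := distribution P Ym.
pose mu2 : probability (T' * T)%type R := distribution P Zm.
have e (X : set (T' * T)) : measurable X -> (mu1 \x rho)%E X = mu2 X.
  apply: product_measure_unique => A B mA mB.
  exact: (past_independent (pY A mA) mB).
transitivity (\int[mu2]_z f z)%E.
  by rewrite /mu2 /distribution ge0_integral_pushforward.
transitivity (\int[mu1 \x rho]_z f z)%E.
  by apply: eq_measure_integral => A mA _; exact/esym/e.
rewrite fubini_tonelli1// /mu1 /distribution ge0_integral_pushforward//.
- exact: measurable_fun_fubini_tonelli_F.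
- by move=> y _; apply: integral_ge0.
Qed.

End independence.

Section bounded_integrals.
Context {R : realType} d (T : measurableType d) (P : probability T R).

Lemma bounded_integrable (f : T -> R) (K : R) : measurable_fun setT f ->
  (forall x, `|f x| <= K) -> P.-integrable setT (EFin \o f).
Proof.
move=> mf fK; apply: measurable_bounded_integrable => //.
  exact: le_lt_trans (probability_le1 P measurableT) (ltry 1).
exists K; split; first exact: num_real.
by move=> M KM x _ /=; apply: le_trans (ltW KM).
Qed.

Lemma Rintegral_pred (A : pred T) : measurable [set x | A x] ->
  \int[P]_x (A x)%:R = fine (P [set x | A x]).
Proof.
move=> mA; rewrite /Rintegral; congr fine.
have := integral_indic P measurableT mA; rewrite setIT => <-.
by apply: eq_integral => x _; rewrite indicE mem_setE.
Qed.

Lemma eq_Rintegral_null (f g : T -> R) (N : set T) : measurable N -> P N = 0%E ->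
  measurable_fun setT f -> measurable_fun setT g ->
  (forall x, ~ N x -> f x = g x) -> \int[P]_x f x = \int[P]_x g x.
Proof.
move=> mN N0 mf mg fg; rewrite /Rintegral; congr fine.
apply: ae_eq_integral => //; [exact/measurable_EFinP|exact/measurable_EFinP|].
exists N; split => // x /= h; apply: contrapT => Nx; apply: h => _.
by rewrite /= fg.
Qed.

End bounded_integrals.

(** * Drift of linear weights *)

Section drift.
Context {R : realType} (rho : probability (R * bool)%type R).
Variables (a b tot K : R) (l L wm wp : R -> R).
Hypothesis ab : a < b.
Hypothesis reg : regular_on l L a b.
Hypothesis mon : monotone_on l L a b.
Hypothesis tot0 : 0 < tot.
Hypothesis rho_bid : forall x, a <= x <= b -> rho [set o | ~~ o.2 && (x <= o.1)] = (l x / tot)%:E.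
Hypothesis rho_ask : forall x, a <= x <= b -> rho [set o | o.2 && (o.1 <= x)] = (L x / tot)%:E.
Hypothesis rho_out : rho [set o | ~~ (a <= o.1 <= b)] = 0%E.
Hypothesis mwm : measurable_fun setT wm.
Hypothesis mwp : measurable_fun setT wp.
Hypothesis wmK : forall x, `|wm x| <= K.
Hypothesis wpK : forall x, `|wp x| <= K.
(** Increment form of d wp = (1/L) d(1/l). *)
Hypothesis wpE : forall x y, a <= x -> x <= y -> y <= b ->
  (L y)^-1 * ((l y)^-1 - (l x)^-1) <= wp y - wp x <= (L x)^-1 * ((l y)^-1 - (l x)^-1).
Hypothesis wmE : forall x, a <= x <= b -> wm x + wp x = (l x)^-1 * (L x)^-1.

Local Notation p := (fun x => (l x)^-1).
Local Notation r := (fun x => (L x)^-1).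

Let ge_false x : pred (R * bool) := fun o => ~~ o.2 && (x <= o.1).
Let le_true x : pred (R * bool) := fun o => o.2 && (o.1 <= x).

Lemma measurable_ge_false x : measurable_fun setT (ge_false x).
Proof.
apply: measurable_and; first by apply: measurable_neg; exact: measurable_snd.
by apply: measurable_fun_ler => //; exact: measurable_fst.
Qed.

Lemma measurable_le_true x : measurable_fun setT (le_true x).
Proof.
apply: measurable_and; first exact: measurable_snd.
by apply: measurable_fun_ler => //; exact: measurable_fst.
Qed.

Let measurable_pred_set (A : pred (R * bool)) : measurable_fun setT A -> measurable [set o | A o].
Proof.
move=> mA; rewrite (_ : [set o | A o] = A @^-1` [set true]).
  by rewrite -[X in measurable X]setTI; exact: mA.
by apply/seteqP; split => o /=.
Qed.

Let measurable_natr (A : pred (R * bool)) : measurable_fun setT A ->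
  measurable_fun setT (fun o => (A o)%:R : R).
Proof.
move=> mA; rewrite [X in measurable_fun _ X](_ : _ = fun o => if A o then 1 else 0).
  by apply: measurable_fun_ifT.
by apply/funext => o; case: ifP.
Qed.

Let int_ge x : a <= x <= b -> \int[rho]_o (ge_false x o)%:R = l x / tot.
Proof.
move=> axb; rewrite (Rintegral_pred rho (measurable_pred_set (@measurable_ge_false x))).
by rewrite rho_bid.
Qed.

Let int_le x : a <= x <= b -> \int[rho]_o (le_true x o)%:R = L x / tot.
Proof.
move=> axb; rewrite (Rintegral_pred rho (measurable_pred_set (@measurable_le_true x))).
by rewrite rho_ask.
Qed.

Let jm M (o : R * bool) := if o.2 then 0 else if M <= o.1 then - wp M else wm o.1.
Let jp m (o : R * bool) := if o.2 then if o.1 <= m then - wm m else wp o.1 else 0.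

Let K0 : 0 <= K. Proof. exact: le_trans (wmK 0). Qed.

Let mjm M : measurable_fun setT (jm M).
Proof.
apply: measurable_fun_ifT => //; apply: measurable_fun_ifT => //.
  exact: measurable_fun_ler.
exact: (measurableT_comp mwm).
Qed.

Let mjp M : measurable_fun setT (jp M).
Proof.
apply: measurable_fun_ifT => //; apply: measurable_fun_ifT => //.
  exact: measurable_fun_ler.
exact: (measurableT_comp mwp).
Qed.

(* jm M and jp m are what jump contributes at best ask M and best bid m if one
   ignores that there may be no order to remove; their integrals turn out not to
   depend on M and m by [product_bound_eq]. *)
Let ijm M : rho.-integrable setT (EFin \o jm M).
Proof.
apply: (@bounded_integrable _ _ _ _ _ K) => // o.
by rewrite /jm; case: ifP => _; [rewrite normr0|case: ifP => _; rewrite ?normrN].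
Qed.

Let ijp M : rho.-integrable setT (EFin \o jp M).
Proof.
apply: (@bounded_integrable _ _ _ _ _ K) => // o.
by rewrite /jp; case: ifP => _; [case: ifP => _; rewrite ?normrN|rewrite normr0].
Qed.

Let inat (A : pred (R * bool)) (c : R) : measurable_fun setT A ->
  rho.-integrable setT (EFin \o (fun o => c * (A o)%:R)).
Proof.
move=> mA; apply: (@bounded_integrable _ _ _ _ _ `|c|) => [|o].
  by apply: measurable_funM => //; exact: measurable_natr.
by rewrite normrM ler_piMr//; case: (A o); rewrite ?normr0 ?normr1.
Qed.

Let int_cge (x y c e : R) : a <= x <= b -> a <= y <= b ->
  \int[rho]_o (c * (ge_false x o)%:R + e * (ge_false y o)%:R) = (c * l x + e * l y) / tot.
Proof.
move=> hx hy; have ix z : rho.-integrable setT (EFin \o (fun o => (ge_false z o)%:R : R)).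
  apply: (@bounded_integrable _ _ _ _ _ 1) => [|o]; first exact: (measurable_natr (@measurable_ge_false z)).
  by case: (ge_false z o); rewrite ?normr0 ?normr1.
rewrite RintegralD//; try exact: inat (measurable_ge_false _).
by rewrite !RintegralZl// !int_ge//; ring.
Qed.

Let int_cle (x y c e : R) : a <= x <= b -> a <= y <= b ->
  \int[rho]_o (c * (le_true x o)%:R + e * (le_true y o)%:R) = (c * L x + e * L y) / tot.
Proof.
move=> hx hy; have ix z : rho.-integrable setT (EFin \o (fun o => (le_true z o)%:R : R)).
  apply: (@bounded_integrable _ _ _ _ _ 1) => [|o]; first exact: (measurable_natr (@measurable_le_true z)).
  by case: (le_true z o); rewrite ?normr0 ?normr1.
rewrite RintegralD//; try exact: inat (measurable_le_true _).
by rewrite !RintegralZl// !int_le//; ring.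
Qed.

(** Increment form of d wm = (1/l) d(1/L): subtract [wpE] from the increment of 1/(l L). *)
Lemma wm_diff x y : a <= x -> x <= y -> y <= b ->
  p y * (r y - r x) <= wm y - wm x <= p x * (r y - r x).
Proof.
move=> ax xy yb; have /andP[w1 w2] := wpE ax xy yb.
have := @wmE x; rewrite ax (le_trans xy)// => /(_ isT) ex.
have := @wmE y; rewrite yb (le_trans ax)// => /(_ isT) ey.
have -> : wm y - wm x = p y * r y - p x * r x - (wp y - wp x) by rewrite -ex -ey; ring.
by apply/andP; split; lra.
Qed.

Lemma wm_ni x y : a <= x -> x <= y -> y <= b -> wm y <= wm x.
Proof.
move=> ax xy yb; have /andP[_ h] := wm_diff ax xy yb.
rewrite -subr_le0; apply: (le_trans h); rewrite mulr_ge0_le0//.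
  by rewrite ltW// (inv_demand_gt0 reg)// ax (le_trans xy).
by rewrite subr_le0 (inv_supply_ni reg mon).
Qed.

Lemma wp_nd x y : a <= x -> x <= y -> y <= b -> wp x <= wp y.
Proof.
move=> ax xy yb; have /andP[h _] := wpE ax xy yb.
rewrite -subr_ge0; apply: (le_trans _ h); rewrite mulr_ge0//.
  by rewrite ltW// (inv_supply_gt0 reg)// yb (le_trans ax).
by rewrite subr_ge0 (inv_demand_nd reg mon).
Qed.

Let nat_bool (A : bool) : (A : nat)%:R = if A then 1 else 0 :> R.
Proof. by case: A. Qed.

(** Raising the ask from x to y changes the contribution of buy orders above y by wp x - wp y, and
    that of buy orders in between by about wm x + wp x. The first amounts to about -r x (l x - l y)
    / l x and the second to r x (l x - l y) / l x; they cancel up to l x - l y times increments of r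
    and wm. *)
Let jm_cst M : a <= M <= b -> \int[rho]_o jm M o = \int[rho]_o jm a o.
Proof.
move=> /andP[aM Mb]; apply/esym; have lb := ltW ab.
apply: (@product_bound_eq _ a b tot^-1 (fun M => \int[rho]_o jm M o)
  (fun x => - (p b * r x) - wm x) (fun x => - l x)) => //.
- by apply: (cont_within) => x /reg[_ _ cl _]; apply: cvgN.
- move=> x y ax xy yb; apply: lerB; last exact: wm_ni.
  rewrite lerN2 ler_wpM2l//; last exact: (inv_supply_ni reg mon).
  by rewrite ltW// (inv_demand_gt0 reg)// lexx lb.
- by move=> x y ax xy yb; rewrite lerN2; have [] := mon ax xy yb.
move=> x y ax xy yb.
have xb := le_trans xy yb; have ay := le_trans ax xy.
have hx : a <= x <= b by rewrite ax.
have hy : a <= y <= b by rewrite ay.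
have lxy : 0 <= l x - l y by rewrite subr_ge0; have [] := mon ax xy yb.
have lx0 := inv_demand_gt0 reg hx; have ly0 : 0 < l y by have [] := reg hy.
have lx0' : 0 < l x by have [] := reg hx.
have /andP[w1 w2] := wpE ax xy yb.
have rxy := inv_supply_ni reg mon ax xy yb.
have pxb : p x <= p b by apply: (inv_demand_nd reg mon).
have wmxy := wm_ni ax xy yb.
(* Exact discrete form of l d(1/l) = -(1/l) dl. *)
have key : (p y - p x) * l y = p x * (l x - l y).
  by rewrite /=; field; rewrite !gt_eqF.
rewrite -RintegralB//.
(* For a buy order at u in [x, y[ the difference is wm u + wp x, with wm u between wm y and wm x.
   Written with the indicators of buy orders above x and above y, both bounds have explicit
   integrals. *)
have pt o : (wp x - wp y - wm y - wp x) * (ge_false y o)%:R + (wm y + wp x) * (ge_false x o)%:R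
   <= jm y o - jm x o <=
  (wp x - wp y - wm x - wp x) * (ge_false y o)%:R + (wm x + wp x) * (ge_false x o)%:R.
  rewrite /jm /ge_false !nat_bool; case: o => u [] /=; first by rewrite !mulr0 addr0 subrr lexx.
  case: (leP y u) => yu; case: (leP x u) => xu; rewrite ?mulr0 ?mulr1 ?addr0 ?add0r ?subrr ?lexx//; try lra.
  have := wm_ni ax xu (le_trans (ltW yu) yb); have := wm_ni (le_trans ax xu) (ltW yu) yb.
  by move=> ? ?; apply/andP; split; lra.
have i2 c e : rho.-integrable setT (EFin \o (fun o => c * (ge_false y o)%:R + e * (ge_false x o)%:R)).
  exact: (integrableD measurableT (inat c (@measurable_ge_false y)) (inat e (@measurable_ge_false x))).
have i1 : rho.-integrable setT (EFin \o (fun o => jm y o - jm x o)).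
  exact: (integrableB measurableT (ijm y) (ijm x)).
have lo : (wp x - wp y - wm y - wp x) * l y + (wm y + wp x) * l x <= tot * \int[rho]_o (jm y o - jm x o).
  rewrite -[leLHS](mulfVK (lt0r_neq0 tot0)) mulrC ler_pM2l// -int_cge//.
  by apply: le_Rintegral => // o _; have /andP[] := pt o.
have up : tot * \int[rho]_o (jm y o - jm x o) <= (wp x - wp y - wm x - wp x) * l y + (wm x + wp x) * l x.
  rewrite -[leRHS](mulfVK (lt0r_neq0 tot0)) [leRHS]mulrC ler_pM2l// -int_cge//.
  by apply: le_Rintegral => // o _; have /andP[] := pt o.
have ex := wmE hx.
have k1 : (wp y - wp x) * l y <= r x * (p x * (l x - l y)).
  by rewrite -key mulrA ler_pM2r.
have k2 : r y * (p x * (l x - l y)) <= (wp y - wp x) * l y.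
  by rewrite -key mulrA ler_pM2r.
rewrite -(ler_pM2l tot0) -(mulrA tot^-1) mulVKf ?gt_eqF// -[in leLHS](gtr0_norm tot0) -normrM.
have q : p x * (r x - r y) * (l x - l y) <= p b * (r x - r y) * (l x - l y).
  by rewrite ler_wpM2r// ler_wpM2r// subr_ge0.
have q0 : 0 <= p x * (r x - r y) * (l x - l y).
  by rewrite mulr_ge0// mulr_ge0// ?subr_ge0// ltW.
have q1 : 0 <= (wm x - wm y) * (l x - l y) by rewrite mulr_ge0// subr_ge0.
have ex2 : (wm x + wp x) * (l x - l y) = p x * r x * (l x - l y) by rewrite ex.
move: lo up k1 k2 q q0 q1 ex2 => /=.
set J := \int[rho]_o _ => lo up k1 k2 q q0 q1 ex2.
rewrite ler_norml; apply/andP; split; nra.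
Qed.

(** Same cancellation for sell orders, now with d wm = (1/l) d(1/L) from [wm_diff]; the error is an
    increment of L times increments of wp and p. *)
Let jp_cst m : a <= m <= b -> \int[rho]_o jp m o = \int[rho]_o jp b o.
Proof.
move=> /andP[am mb].
have lb := ltW ab.
apply: (@product_bound_eq _ a b tot^-1 (fun M => \int[rho]_o jp M o)
  (fun x => wp x + r a * p x) L) => //.
- by apply: (cont_within) => x /reg[].
- move=> x y ax xy yb; apply: lerD; first exact: wp_nd.
  rewrite ler_wpM2l//; last exact: (inv_demand_nd reg mon).
  by rewrite ltW// (inv_supply_gt0 reg)// lexx lb.
- by move=> x y ax xy yb; have [] := mon ax xy yb.
move=> x y ax xy yb.
have xb := le_trans xy yb; have ay := le_trans ax xy.
have hx : a <= x <= b by rewrite ax.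
have hy : a <= y <= b by rewrite ay.
have lxy : 0 <= L y - L x by rewrite subr_ge0; have [] := mon ax xy yb.
have ry0 := inv_supply_gt0 reg hy; have ly0 : 0 < L y by have [] := reg hy.
have lx0 : 0 < L x by have [] := reg hx.
have /andP[w1 w2] := wm_diff ax xy yb.
have pxy := inv_demand_nd reg mon ax xy yb.
have rya : r y <= r a by apply: (inv_supply_ni reg mon).
have wpxy := wp_nd ax xy yb.
have key : (r x - r y) * L x = r y * (L y - L x).
  by rewrite /=; field; rewrite !gt_eqF.
rewrite -RintegralB//.
have pt o : (wm x + wp y) * (le_true x o)%:R + (- wm y - wp y) * (le_true y o)%:R
   <= jp y o - jp x o <=
  (wm x + wp x) * (le_true x o)%:R + (- wm y - wp x) * (le_true y o)%:R.
  rewrite /jp /le_true !nat_bool; case: o => u [] /=; last by rewrite !mulr0 addr0 subrr lexx.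
  case: (leP u y) => yu; case: (leP u x) => xu; rewrite ?mulr0 ?mulr1 ?addr0 ?add0r ?subrr ?lexx//; try lra.
  have := wp_nd ax (ltW xu) (le_trans yu yb); have := wp_nd (le_trans ax (ltW xu)) yu yb.
  by move=> ? ?; apply/andP; split; lra.
have i2 c e : rho.-integrable setT (EFin \o (fun o => c * (le_true x o)%:R + e * (le_true y o)%:R)).
  exact: (integrableD measurableT (inat c (@measurable_le_true x)) (inat e (@measurable_le_true y))).
have i1 : rho.-integrable setT (EFin \o (fun o => jp y o - jp x o)).
  exact: (integrableB measurableT (ijp y) (ijp x)).
have lo : (wm x + wp y) * L x + (- wm y - wp y) * L y <= tot * \int[rho]_o (jp y o - jp x o).
  rewrite -[leLHS](mulfVK (lt0r_neq0 tot0)) mulrC ler_pM2l// -int_cle//.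
  by apply: le_Rintegral => // o _; have /andP[] := pt o.
have up : tot * \int[rho]_o (jp y o - jp x o) <= (wm x + wp x) * L x + (- wm y - wp x) * L y.
  rewrite -[leRHS](mulfVK (lt0r_neq0 tot0)) [leRHS]mulrC ler_pM2l// -int_cle//.
  by apply: le_Rintegral => // o _; have /andP[] := pt o.
have ey := wmE hy.
have k1 : p x * (r y * (L y - L x)) <= (wm x - wm y) * L x.
  by rewrite -key mulrA ler_pM2r//; move: w1 w2 => /=; lra.
have k2 : (wm x - wm y) * L x <= p y * (r y * (L y - L x)).
  by rewrite -key mulrA ler_pM2r//; move: w1 w2 => /=; lra.
rewrite -(ler_pM2l tot0) -(mulrA tot^-1) mulVKf ?gt_eqF// -[in leLHS](gtr0_norm tot0) -normrM.
have q : r y * (p y - p x) * (L y - L x) <= r a * (p y - p x) * (L y - L x).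
  by rewrite ler_wpM2r// ler_wpM2r// subr_ge0.
have q0 : 0 <= r y * (p y - p x) * (L y - L x).
  by rewrite mulr_ge0// mulr_ge0// ?subr_ge0// ltW.
have q1 : 0 <= (wp y - wp x) * (L y - L x) by rewrite mulr_ge0// subr_ge0.
have ex2 : (wm y + wp y) * (L y - L x) = p y * r y * (L y - L x) by rewrite ey.
move: lo up k1 k2 q q0 q1 ex2 => /=.
set J := \int[rho]_o _ => lo up k1 k2 q q0 q1 ex2.
rewrite ler_norml; apply/andP; split; nra.
Qed.

Let mout : measurable [set o : R * bool | ~~ (a <= o.1 <= b)].
Proof.
apply: measurable_pred_set; apply: measurable_neg.
by apply: measurable_and; apply: measurable_fun_ler.
Qed.

Lemma small_drop (f : R -> R) (x e : R) (h : {for x, continuous f}) : 0 < e ->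
  exists2 t, 0 < t & forall y, `|x - y| < t -> `|f x - f y| < e.
Proof.
move=> e0; have /cvgrPdist_lt /(_ _ e0) [t /= t0 ht] := h.
by exists t => // y xy; apply: ht.
Qed.

Let null_of (N A B : pred (R * bool)) (u v : R) : measurable_fun setT A -> measurable_fun setT B ->
  measurable_fun setT N ->
  rho [set o | A o] = (u / tot)%:E -> rho [set o | B o] = (v / tot)%:E ->
  (forall o, B o -> A o) -> (forall o, N o -> ~~ (a <= o.1 <= b) \/ A o && ~~ B o) ->
  fine (rho [set o | N o]) <= (u - v) / tot.
Proof.
move=> mA mB mN eA eB BA NAB.
have sA := measurable_pred_set mA; have sB := measurable_pred_set mB.
have sN := measurable_pred_set mN.
rewrite -lee_fin fineK ?fin_num_measure//.
apply: (@le_trans _ _ (rho ([set o | ~~ (a <= o.1 <= b)] `|` ([set o | A o] `\` [set o | B o])))).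
  apply: le_measure; rewrite ?inE//; first by apply: measurableU => //; exact: measurableD.
  by move=> o /NAB[?|/andP[? /negP ?]]; [left|right].
apply: le_trans (measureU2 _ _ _) _ => //; first exact: measurableD.
have ro : (rho [set o | ~~ (a <= o.1 <= b)%R] <= 0)%E by rewrite rho_out.
rewrite -[leRHS]add0e; apply: leeD => //.
have -> : (((u - v) / tot)%:E = rho [set o | A o] - rho ([set o | A o] `&` [set o | B o]))%E.
  by rewrite setIidr// eA eB -EFinB mulrBl.
rewrite le_eqVlt; apply/orP; left; apply/eqP; apply: measureD => //.
by apply: le_lt_trans (probability_le1 rho sA) (ltry 1).
Qed.

Let haa : a <= a <= b. Proof. by rewrite lexx ltW. Qed.
Let hbb : a <= b <= b. Proof. by rewrite lexx ltW. Qed.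

(** Up to a null set these are buy orders in [a, x[ for every x > a, whose mass (l a - l x) / tot
    vanishes as x tends to a by continuity of l. *)
Let null_bid : rho [set o | ~~ o.2 && (o.1 <= a)] = 0%E.
Proof.
have mN : measurable_fun setT (fun o : R * bool => ~~ o.2 && (o.1 <= a)).
  by apply: measurable_and; [apply: measurable_neg|exact: measurable_fun_ler].
have fN : rho [set o | ~~ o.2 && (o.1 <= a)] \is a fin_num.
  by apply: fin_num_measure; exact: (measurable_pred_set mN).
rewrite -(fineK fN); congr EFin; apply/eqP; rewrite eq_le fine_ge0// andbT leNgt.
apply/negP => c0; have cl : {for a, continuous l} by have [] := reg haa.
have [t t0 ht] := small_drop cl (mulr_gt0 c0 tot0).
pose x := Num.min b (a + t / 2).
have /andP[ax xb] : a < x <= b by rewrite lt_min ab ge_min lexx ltrDl divr_gt0.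
have : `|l a - l x| < fine (rho [set o | ~~ o.2 && (o.1 <= a)]) * tot.
  apply: ht; rewrite distrC gtr0_norm ?subr_gt0//.
  have : x <= a + t / 2 by rewrite ge_min lexx orbT.
  lra.
rewrite ltNge => /negP; apply; apply: (@le_trans _ _ (l a - l x)); last exact: ler_norm.
rewrite -ler_pdivlMr//; apply: (@null_of _ (ge_false a) (ge_false x)) => //.
- exact: (@measurable_ge_false a).
- exact: (@measurable_ge_false x).
- by apply: rho_bid; rewrite lexx ltW.
- by apply: rho_bid; rewrite xb ltW.
- by move=> o /andP[s2 xo]; rewrite /ge_false s2 (le_trans (ltW ax)).
- move=> o /andP[s2 ua]; have [ao|ua'] := leP a o.1; last by left.
  by right; rewrite /ge_false s2 ao/= -ltNge (le_lt_trans ua).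
Qed.

Let null_ask : rho [set o | o.2 && (b <= o.1)] = 0%E.
Proof.
have mN : measurable_fun setT (fun o : R * bool => o.2 && (b <= o.1)).
  by apply: measurable_and => //; exact: measurable_fun_ler.
have fN : rho [set o | o.2 && (b <= o.1)] \is a fin_num.
  by apply: fin_num_measure; exact: (measurable_pred_set mN).
rewrite -(fineK fN); congr EFin; apply/eqP; rewrite eq_le fine_ge0// andbT leNgt.
apply/negP => c0; have cl : {for b, continuous L} by have [] := reg hbb.
have [t t0 ht] := small_drop cl (mulr_gt0 c0 tot0).
pose x := Num.max a (b - t / 2).
have /andP[ax xb] : a <= x < b by rewrite gt_max ab le_max lexx ltrBlDr ltrDl divr_gt0.
have : `|L b - L x| < fine (rho [set o | o.2 && (b <= o.1)]) * tot.
  apply: ht; rewrite gtr0_norm ?subr_gt0//.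
  have : b - t / 2 <= x by rewrite le_max lexx orbT.
  lra.
rewrite ltNge => /negP; apply; apply: (@le_trans _ _ (L b - L x)); last exact: ler_norm.
rewrite -ler_pdivlMr//; apply: (@null_of _ (le_true b) (le_true x)) => //.
- exact: (@measurable_le_true b).
- exact: (@measurable_le_true x).
- by apply: rho_ask; rewrite lexx ltW.
- by apply: rho_ask; rewrite ax ltW.
- by move=> o /andP[s2 xo]; rewrite /le_true s2 (le_trans xo)// ltW.
- move=> o /andP[s2 ua]; have [ao|ua'] := leP o.1 b; last by left; rewrite andbF.
  by right; rewrite /le_true s2 ao/= -ltNge (lt_le_trans xb).
Qed.

(** By [jm_cst] and [jp_cst] the quotes may be moved to M = a and m = b. There almost every buy
    order removes weight wp a and almost every sell order removes weight wm b, which gives the first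
    two terms. *)
Lemma jump_integral m M : a <= m <= b -> a <= M <= b ->
  tot * \int[rho]_o jump a b wm wp m M o =
  - wp a * l a - wm b * L b +
  (if M < b then 0 else wp b * l b) + (if a < m then 0 else wm a * L a).
Proof.
move=> hm hM.
(* The added terms undo the removal of a nonexistent order: with no ask, [jm] charges -wp b to buy
   orders at b, and with no bid, [jp] charges -wm a to sell orders at a. The rest of the difference
   from [jump] sits on buy orders at a and sell orders at b, which are null. *)
pose g o := (jm M o + (if M < b then 0 else wp b) * (ge_false b o)%:R) +
            (jp m o + (if a < m then 0 else wm a) * (le_true a o)%:R).
pose N := [set o : R * bool | ~~ o.2 && (o.1 <= a)] `|` [set o : R * bool | o.2 && (b <= o.1)].
have m1 : measurable [set o : R * bool | ~~ o.2 && (o.1 <= a)].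
  apply: measurable_pred_set.
  by apply: measurable_and; [apply: measurable_neg|exact: measurable_fun_ler].
have m2 : measurable [set o : R * bool | o.2 && (b <= o.1)].
  by apply: measurable_pred_set; apply: measurable_and => //; exact: measurable_fun_ler.
have mN : measurable (N `|` [set o : R * bool | ~~ (a <= o.1 <= b)]).
  by apply: measurableU => //; exact: measurableU.
have N0 : rho (N `|` [set o : R * bool | ~~ (a <= o.1 <= b)]) = 0%E.
  apply/eqP; rewrite eq_le measure_ge0 andbT.
  apply: le_trans (measureU2 _ _ _) _ => //; first exact: measurableU.
  have ro : (rho [set o | ~~ (a <= o.1 <= b)%R] <= 0)%E by rewrite rho_out.
  have rb : (rho [set o | ~~ o.2 && (o.1 <= a)%R] <= 0)%E by rewrite null_bid.
  have ra : (rho [set o | o.2 && (b <= o.1)%R] <= 0)%E by rewrite null_ask.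
  rewrite -[leRHS]adde0; apply: leeD => //.
  apply: le_trans (measureU2 _ _ _) _ => //.
  by rewrite -[leRHS]adde0; apply: leeD.
have ig1 := inat (if M < b then 0 else wp b) (@measurable_ge_false b).
have ig2 := inat (if a < m then 0 else wm a) (@measurable_le_true a).
have i1 := integrableD measurableT (ijm M) ig1.
have i2 := integrableD measurableT (ijp m) ig2.
have mg : measurable_fun setT g.
  by have /measurable_int/measurable_EFinP := integrableD measurableT i1 i2.
have mj : measurable_fun setT (fun o => jump a b wm wp m M o).
  by apply: (@jump_measurable R a b wm wp _ _ (fun=> m) (fun=> M) (fun o => o)).
rewrite (eq_Rintegral_null mN N0 mj mg); last first.
  move=> o No; have [h1 h2] : ~~ (~~ o.2 && (o.1 <= a)) /\ ~~ (o.2 && (b <= o.1)).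
    by split; apply/negP => h; apply: No; left; [left|right].
  rewrite /g /jump /jm /jp /ge_false /le_true !nat_bool; move: h1 h2.
  have /andP[Ma Mb] := hM; have /andP[ma mb] := hm.
  case: o {No} => u [] /=; rewrite -?ltNge ?mulr0 ?addr0 ?add0r.
    move=> _ ub; rewrite ub; case: (leP u m) => um.
      case: (ltP a m) => am; first by rewrite mul0r addr0.
      have -> : m = a by apply/le_anti; rewrite am ma.
      have -> : u <= a by apply: (le_trans um).
      by rewrite mulr1 addNr.
    have -> : (u <= a) = false by apply/negbTE; rewrite -ltNge (le_lt_trans ma).
    by rewrite mulr0 addr0.
  move=> au _; rewrite au; case: (leP M u) => um.
    case: (ltP M b) => am; first by rewrite mul0r addr0.
    have -> : M = b by apply/le_anti; rewrite am Mb.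
    have -> : b <= u by apply: (le_trans am).
    by rewrite mulr1 addNr.
  have -> : (b <= u) = false by apply/negbTE; rewrite -ltNge (lt_le_trans um).
  by rewrite mulr0 addr0.
have n1 (A : pred (R * bool)) : measurable_fun setT A ->
    rho.-integrable setT (EFin \o (fun o => (A o)%:R : R)).
  move=> mA; apply: (@bounded_integrable _ _ _ _ _ 1) => [|o]; first exact: measurable_natr.
  by case: (A o); rewrite ?normr0 ?normr1.
have j1 : \int[rho]_o jm a o = - wp a * (l a / tot).
  rewrite -int_ge// -RintegralZl//; last exact: (n1 _ (@measurable_ge_false a)).
  apply: (eq_Rintegral_null mout rho_out) => //.
    by apply: measurable_funM => //; exact: (measurable_natr (@measurable_ge_false a)).
  move=> o /negP; rewrite negbK => /andP[ao _].
  by rewrite /jm /ge_false ao andbT nat_bool; case: (o.2); rewrite ?mulr0 ?mulr1.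
have j2 : \int[rho]_o jp b o = - wm b * (L b / tot).
  rewrite -int_le// -RintegralZl//; last exact: (n1 _ (@measurable_le_true b)).
  apply: (eq_Rintegral_null mout rho_out) => //.
    by apply: measurable_funM => //; exact: (measurable_natr (@measurable_le_true b)).
  move=> o /negP; rewrite negbK => /andP[_ ob].
  by rewrite /jp /le_true ob andbT nat_bool; case: (o.2); rewrite ?mulr0 ?mulr1.
rewrite /g RintegralD// RintegralD// ?[X in _ + X]RintegralD// !RintegralZl//; last 2 first.
  exact: (n1 _ (@measurable_le_true a)).
  exact: (n1 _ (@measurable_ge_false b)).
rewrite jm_cst// jp_cst// j1 j2 int_ge// int_le//.
by case: ifP => _; case: ifP => _; field; rewrite gt_eqF.
Qed.

End drift.

(** * The weights and the two choices of the free constant *)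

Section weight_family.
Context {R : realType}.
Variables (a b : R) (l L : R -> R).
Hypothesis ab : a < b.
Hypothesis reg : regular_on l L a b.
Hypothesis mon : monotone_on l L a b.

Local Notation p := (fun x => (l x)^-1).
Local Notation r := (fun x => (L x)^-1).

(* The weights are extended by constants outside [a, b], so that they are
   monotone, hence measurable and bounded, on the whole line. *)
Definition clampx (x : R) : R := Num.max a (Num.min x b).
Definition askw0 (x : R) : R := nd_stieltjes_integral r p a x.
Definition askw (c x : R) : R := askw0 (clampx x) + c.
Definition bidw (c x : R) : R :=
  (l (clampx x))^-1 * (L (clampx x))^-1 - askw0 (clampx x) - c.

Lemma clampx_bound x : a <= clampx x <= b.
Proof. by rewrite /clampx le_max lexx/= ge_max ge_min lexx orbT ltW. Qed.

Lemma clampx_id x : a <= x <= b -> clampx x = x.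
Proof. by move=> /andP[ax xb]; rewrite /clampx min_l// max_r. Qed.

Lemma clampx_nd x y : x <= y -> clampx x <= clampx y.
Proof.
move=> xy; rewrite /clampx ge_max le_max lexx/= le_max; apply/orP; right.
by rewrite le_min ge_min xy/= ge_min lexx orbT.
Qed.

Let lb : a <= b. Proof. exact: ltW. Qed.

Lemma askw0_a : askw0 a = 0.
Proof.
have /andP[] := int_inv_supply_bounds reg mon (lexx a) (lexx a) lb.
by rewrite subrr !mulr0 => h1 h2; apply/eqP; rewrite eq_le h1 h2.
Qed.

Lemma askwE c x y : a <= x -> x <= y -> y <= b ->
  (L y)^-1 * ((l y)^-1 - (l x)^-1) <= askw c y - askw c x <= (L x)^-1 * ((l y)^-1 - (l x)^-1).
Proof.
move=> ax xy yb; have hx : a <= x <= b by rewrite ax (le_trans xy).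
have hy : a <= y <= b by rewrite yb (le_trans ax).
rewrite /askw (clampx_id hx) (clampx_id hy).
rewrite (_ : askw0 y + c - (askw0 x + c) = askw0 y - askw0 x); last by ring.
rewrite /askw0 (int_inv_supply_add reg mon (lexx a) ax xy yb) addrAC subrr add0r.
exact: (int_inv_supply_bounds reg mon ax xy yb).
Qed.

Lemma bidwE c x : a <= x <= b -> bidw c x + askw c x = (l x)^-1 * (L x)^-1.
Proof. by move=> h; rewrite /bidw /askw clampx_id//; ring. Qed.

Lemma askw_nd c x y : x <= y -> askw c x <= askw c y.
Proof.
move=> xy; have /andP[? ?] := clampx_bound x; have /andP[? ?] := clampx_bound y.
have := @wp_nd R a b l L (askw c) reg mon (askwE c) (clampx x) (clampx y).
by rewrite /askw !(clampx_id (clampx_bound _)); apply => //; exact: clampx_nd.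
Qed.

Lemma bidw_ni c x y : x <= y -> bidw c y <= bidw c x.
Proof.
move=> xy; have /andP[? ?] := clampx_bound x; have /andP[? ?] := clampx_bound y.
have := @wm_ni R a b l L (bidw c) (askw c) reg mon (askwE c) (@bidwE c) (clampx x) (clampx y).
by rewrite /bidw !(clampx_id (clampx_bound _)); apply => //; exact: clampx_nd.
Qed.

Lemma measurable_askw c : measurable_fun setT (askw c).
Proof. by apply: nondecreasing_measurable => // x y; exact: askw_nd. Qed.

Lemma measurable_bidw c : measurable_fun setT (bidw c).
Proof. by apply: nonincreasing_measurable => // x y; exact: bidw_ni. Qed.

Definition weight_bound (c : R) : R :=
  Num.max (Num.max `|askw c a| `|askw c b|) (Num.max `|bidw c a| `|bidw c b|).

Let norm_between (x u v : R) : u <= x -> x <= v -> `|x| <= Num.max `|u| `|v|.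
Proof.
move=> ux xv; rewrite ler_norml; apply/andP; split.
  rewrite lerNl le_max; apply/orP; left; apply: (@le_trans _ _ (- u)); first by rewrite lerN2.
  by rewrite -normrN ler_norm.
by rewrite le_max; apply/orP; right; rewrite (le_trans xv)// ler_norm.
Qed.

Lemma askw_clampx c x : askw c (clampx x) = askw c x.
Proof. by rewrite /askw (clampx_id (clampx_bound x)). Qed.

Lemma bidw_clampx c x : bidw c (clampx x) = bidw c x.
Proof. by rewrite /bidw (clampx_id (clampx_bound x)). Qed.

Lemma askw_bound c x : `|askw c x| <= weight_bound c.
Proof.
have /andP[? ?] := clampx_bound x; rewrite -(askw_clampx c x).
by rewrite /weight_bound le_max norm_between// askw_nd.
Qed.

Lemma bidw_bound c x : `|bidw c x| <= weight_bound c.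
Proof.
have /andP[? ?] := clampx_bound x; rewrite -(bidw_clampx c x).
rewrite /weight_bound le_max; apply/orP; right; rewrite maxC; apply: norm_between; exact: bidw_ni.
Qed.

Let haa : a <= a <= b. Proof. by rewrite lexx lb. Qed.
Let hbb : a <= b <= b. Proof. by rewrite lexx lb. Qed.

(* Lm and Lp are Lambda_- and Lambda_+ on [a, b], the latter integrated by parts. *)
Definition Lm := (l a)^-1 * (l b)^-1 - askw0 b.
Definition Lp := (L a)^-1 * (L b)^-1 + ((l b)^-1 * (L b)^-1 - (l a)^-1 * (L a)^-1) - askw0 b.
(** The constant [cm] makes the sell weight vanish at b, and [cp] makes the buy weight vanish at a.
    The drift correction for an empty ask side, respectively an empty bid side, then drops out, and
    by monotonicity the weight in question is nonpositive everywhere. *)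
Definition cm := - askw0 b.
Definition cp := (l a)^-1 * (L a)^-1.

Lemma askw_cm_le0 x : askw cm x <= 0.
Proof.
have /andP[_ h] := clampx_bound x; have := askw_nd cm h.
by rewrite askw_clampx {2}/askw clampx_id// /cm subrr.
Qed.

Lemma bidw_cp_le0 x : bidw cp x <= 0.
Proof.
have /andP[h _] := clampx_bound x; have := bidw_ni cp h.
by rewrite bidw_clampx {2}/bidw clampx_id// askw0_a /cp subr0 subrr.
Qed.

Lemma askw0_ge0 : 0 <= askw0 b.
Proof. by have := askw_nd 0 lb; rewrite /askw !clampx_id// askw0_a !addr0. Qed.

Lemma bidw_cm_a : 0 < bidw cm a.
Proof.
rewrite /bidw clampx_id// askw0_a subr0 /cm opprK.
by rewrite ltr_wpDr ?askw0_ge0// mulr_gt0// ?(inv_demand_gt0 reg)// (inv_supply_gt0 reg).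
Qed.

(** The right-hand side is nonincreasing in x, and at x = b it equals the left-hand side. The
    multipliers l b and L a are chosen so that the minimum is a multiple of Lambda_+ here and of
    Lambda_- in [ask_comb], where it is attained at a. *)
Lemma bid_comb x : Lp * L a <= l b * bidw cm x + L a * bidw cp x.
Proof.
have lb0 : 0 < l b by have [] := reg hbb.
have La0 : 0 < L a by have [] := reg haa.
have Lb0 : 0 < L b by have [] := reg hbb.
have la0 : 0 < l a by have [] := reg haa.
have /andP[_ h] := clampx_bound x.
have := bidw_ni cm h; have := bidw_ni cp h.
rewrite !bidw_clampx => h1 h2.
apply: (@le_trans _ _ (l b * bidw cm b + L a * bidw cp b)); last first.
  by apply: lerD; rewrite ler_pM2l.
rewrite /bidw !clampx_id// /Lp /cm /cp le_eqVlt; apply/orP; left; apply/eqP.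
by field; rewrite !gt_eqF.
Qed.

Lemma ask_comb x : Lm * l b <= l b * askw cm x + L a * askw cp x.
Proof.
have lb0 : 0 < l b by have [] := reg hbb.
have La0 : 0 < L a by have [] := reg haa.
have la0 : 0 < l a by have [] := reg haa.
have /andP[h _] := clampx_bound x.
have := askw_nd cm h; have := askw_nd cp h.
rewrite !askw_clampx => h1 h2.
apply: (@le_trans _ _ (l b * askw cm a + L a * askw cp a)); last first.
  by apply: lerD; rewrite ler_pM2l.
rewrite /askw !clampx_id// askw0_a /Lm /cm /cp le_eqVlt; apply/orP; left; apply/eqP.
by field; rewrite !gt_eqF.
Qed.

Lemma cm_drift (m : R) :
  - askw cm a * l a - bidw cm b * L b + 0 + (if a < m then 0 else bidw cm a * L a) =
  - l a * Lm + (if a < m then 0 else bidw cm a * L a).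
Proof.
have lb0 : 0 < l b by have [] := reg hbb.
have Lb0 : 0 < L b by have [] := reg hbb.
have la0 : 0 < l a by have [] := reg haa.
congr (_ + _); rewrite addr0 /askw /bidw !clampx_id// askw0_a /Lm /cm; field.
by rewrite !gt_eqF.
Qed.

Lemma askw_cm_b : askw cm b = 0.
Proof. by rewrite /askw clampx_id// /cm subrr. Qed.

Lemma bidw_cp_a : bidw cp a = 0.
Proof. by rewrite /bidw clampx_id// askw0_a /cp subr0 subrr. Qed.

Lemma cp_drift : - askw cp a * l a - bidw cp b * L b = - L b * Lp.
Proof.
have lb0 : 0 < l b by have [] := reg hbb.
have Lb0 : 0 < L b by have [] := reg hbb.
have la0 : 0 < l a by have [] := reg haa.
have La0 : 0 < L a by have [] := reg haa.
rewrite /askw /bidw !clampx_id// askw0_a /Lp /cp; field.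
by rewrite !gt_eqF.
Qed.

Section integrals.
Variables (rho : probability (R * bool)%type R) (tot : R).
Hypothesis tot0 : 0 < tot.
Hypothesis rho_bid : forall x, a <= x <= b -> rho [set o | ~~ o.2 && (x <= o.1)] = (l x / tot)%:E.
Hypothesis rho_ask : forall x, a <= x <= b -> rho [set o | o.2 && (o.1 <= x)] = (L x / tot)%:E.
Hypothesis rho_out : rho [set o | ~~ (a <= o.1 <= b)] = 0%E.

Lemma cm_integral m M : a <= m <= b -> a <= M <= b ->
  tot * \int[rho]_o jump a b (bidw cm) (askw cm) m M o =
  - l a * Lm + (if a < m then 0 else bidw cm a * L a).
Proof.
move=> hm hM; rewrite (jump_integral ab reg mon tot0 rho_bid rho_ask rho_out
  (measurable_bidw cm) (measurable_askw cm) (bidw_bound cm) (askw_bound cm)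
  (askwE cm) (@bidwE cm) hm hM).
by rewrite askw_cm_b mul0r if_same cm_drift.
Qed.

Lemma cp_integral m M : a <= m <= b -> a <= M <= b ->
  tot * \int[rho]_o jump a b (bidw cp) (askw cp) m M o =
  - L b * Lp + (if M < b then 0 else askw cp b * l b).
Proof.
move=> hm hM; rewrite (jump_integral ab reg mon tot0 rho_bid rho_ask rho_out
  (measurable_bidw cp) (measurable_askw cp) (bidw_bound cp) (askw_bound cp)
  (askwE cp) (@bidwE cp) hm hM).
by rewrite bidw_cp_a mul0r if_same addr0 cp_drift.
Qed.

End integrals.
End weight_family.

(** * Return times *)

Lemma all_iota_min (Z : nat -> bool) k : (0 < k)%N -> Z k ->
  (forall j, (0 < j)%N -> Z j -> (k <= j)%N) ->
  forall n, all (fun i => ~~ Z i) (iota 1 n) = (n < k)%N.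
Proof.
move=> k0 Zk kmin n; apply/idP/idP.
  move=> /allP h; rewrite ltnNge; apply/negP => kn.
  by have := h k; rewrite mem_iota k0 add1n ltnS kn Zk => /(_ isT).
move=> nk; apply/allP => i; rewrite mem_iota add1n ltnS => /andP[i0 iN].
by apply/negP => /(kmin _ i0); rewrite leqNgt (leq_ltn_trans iN nk).
Qed.

(** A return time tau is the sum over n of the indicators of tau > n, also when it is infinite. The
    term n = 0 is 1 because its list of conditions is empty. *)
Lemma return_time_series (R : realType) (Z : nat -> bool) :
  ereal_inf [set (k%:R : R)%:E | k in [set k : nat | (0 < k)%N /\ Z k]] =
  (\sum_(n <oo) ((all (fun i => ~~ Z i) (iota 1 n))%:R : R)%:E)%E.
Proof.
have [[k0 [k00 Zk0]]|nZ] := pselect (exists k, (0 < k)%N /\ Z k).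
  have exZ : exists k, (0 < k)%N && Z k by exists k0; rewrite k00.
  case: (ex_minnP exZ) => k /andP[kp Zk] kmin.
  have allE := all_iota_min kp Zk (fun j j0 Zj => kmin j (introT andP (conj j0 Zj))).
  transitivity ((k%:R : R)%:E).
    apply/le_anti/andP; split; first by apply: ereal_inf_lbound; exists k.
    apply: le_ereal_inf_tmp => _ [j [j0 Zj] <-]; rewrite lee_fin ler_nat.
    by apply: kmin; rewrite j0.
  rewrite (nneseries_split 0 k); last by move=> n _; rewrite lee_fin.
  rewrite add0n eseries0 ?adde0; last by move=> n kn _; rewrite allE ltnNge kn.
  rewrite big_nat (eq_bigr (fun=> 1%E)); last by move=> n /andP[_ nk]; rewrite allE nk.
  by rewrite -big_nat sumEFin big_const_nat subn0 iter_addr_0.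
rewrite (_ : [set _ | _ in _] = set0); last first.
  by rewrite -subset0 => z [k Hk _]; apply: nZ; exists k.
rewrite ereal_inf0; apply/esym/eqyP => A A0.
have allT n : all (fun i => ~~ Z i) (iota 1 n).
  by apply/allP => i; rewrite mem_iota => /andP[i0 _]; apply/negP => Zi; apply: nZ; exists i.
apply: (@le_trans _ _ (\sum_(0 <= i < Num.bound A) ((all (fun i => ~~ Z i) (iota 1 i))%:R : R)%:E)%E); last first.
  by apply: nneseries_lim_ge => n _ _; rewrite lee_fin.
rewrite (eq_bigr (fun=> 1%E)); last by move=> n _; rewrite allT.
rewrite sumEFin big_const_nat subn0 iter_addr_0 lee_fin ltW//.
by rewrite archi_boundP// ltW.
Qed.

Lemma harmonic_bound_dvg (R : realType) (u : (\bar R)^nat) (k : R) : 0 < k ->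
  (forall n, (0 <= u n)%E) -> (forall n, ((k / n.+1%:R)%:E <= u n.+1)%E) ->
  ~ (\sum_(n <oo) u n < +oo)%E.
Proof.
move=> k0 u0 ku uoo; set S := (\sum_(n <oo) u n)%E in uoo.
have S0 : (0 <= S)%E by apply: nneseries_ge0.
have bnd N : series harmonic N <= fine S / k.
  rewrite ler_pdivlMr// -lee_fin fineK ?ge0_fin_numE//.
  apply: (@le_trans _ _ (\sum_(0 <= i < N.+1) u i)%E); last first.
    exact: nneseries_lim_ge.
  rewrite /series/= big_nat_recl//= -[leLHS]add0e leeD//.
  rewrite mulr_suml -sumEFin; apply: lee_sum => i _.
  by apply: le_trans (ku i); rewrite lee_fin mulrC.
apply: (@dvg_harmonic R); apply: nondecreasing_is_cvgn.
  by apply/nondecreasing_seqP => n; rewrite /series/= big_nat_recr//= lerDl ltW// harmonic_gt0.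
by exists (fine S / k) => _ [n _ <-].
Qed.

(** * The chain driven by independent orders *)

Section process.
Context {R : realType} d (Om : measurableType d) (P : probability Om R).
Variables (eta : nat -> Om -> R * bool) (rho : probability (R * bool)%type R).
Variables (a b tot : R) (l L : R -> R).
Hypothesis ab : a < b.
Hypothesis reg : regular_on l L a b.
Hypothesis mon : monotone_on l L a b.
Hypothesis tot0 : 0 < tot.
Hypothesis rho_bid : forall x, a <= x <= b -> rho [set o | ~~ o.2 && (x <= o.1)] = (l x / tot)%:E.
Hypothesis rho_ask : forall x, a <= x <= b -> rho [set o | o.2 && (o.1 <= x)] = (L x / tot)%:E.
Hypothesis rho_out : rho [set o | ~~ (a <= o.1 <= b)] = 0%E.
Hypothesis meta : forall k, measurable_fun setT (eta k).
Hypothesis heta : forall k w, a <= (eta k w).1 <= b.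
Hypothesis ind : forall k A B, cylinders eta k A -> measurable B ->
  P (A `&` eta k @^-1` B) = (P A * rho B)%E.

Local Notation St k := (fun w => lchain a b (eta ^~ w) k).
Local Notation nilS := ([::] : seq R, [::] : seq R).

(** The event tau > k; time 0 is left out because the chain starts in the empty state. *)
Definition alive (k : nat) (w : Om) : bool := all (fun i => St i w != nilS) (iota 1 k).
Definition clamp_o (o : R * bool) : R * bool := (clampx a b o.1, o.2).

(** Quantifying over spaces and order sequences allows the same functional to be used on [Om] and on
    the product of the past with one fresh order. *)
Definition state_measurable_fun (phi : seq R * seq R -> R) : Prop :=
  forall d' (T : measurableType d') (xi : nat -> T -> R * bool) k,
  (forall i, (i < k)%N -> measurable_fun setT (xi i)) -> (forall i w, a <= (xi i w).1 <= b) ->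
  measurable_fun setT (fun w => phi (lchain a b (xi ^~ w) k)).

Lemma weight_smf wm wp : measurable_fun setT wm -> measurable_fun setT wp ->
  state_measurable_fun (weight wm wp).
Proof.
move=> mwm mwp d' T xi k mxi hxi.
by have [_ _] := state_measurable ab mxi hxi (leqnn k); apply.
Qed.

Lemma ordered_nilP x : ordered a b x -> (x != nilS) = (0 < weight (cst 1) (cst 1) x).
Proof.
case: x => -[|y s] [|z t] _; rewrite /weight/= ?big_nil ?big_cons.
- by rewrite addr0 ltxx.
- by rewrite add0r ltr_pwDl// sumr_ge0.
- by rewrite addr0 ltr_pwDl// sumr_ge0.
- by rewrite addr_gt0// ltr_pwDl// sumr_ge0.
Qed.

Let ox k w : ordered a b (St k w). Proof. exact: lchain_ordered. Qed.

Lemma lchain_ext (u v : nat -> R * bool) k : (forall i, (i < k)%N -> u i = v i) ->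
  lchain a b u k = lchain a b v k.
Proof.
elim: k => //= k IH h; rewrite h// IH// => i ik; apply: h; exact: ltnW.
Qed.

Lemma alive_measurable_gen d' (T : measurableType d') (xi : nat -> T -> R * bool) k :
  (forall i, (i < k)%N -> measurable_fun setT (xi i)) -> (forall i w, a <= (xi i w).1 <= b) ->
  measurable_fun setT (fun w => all (fun i => lchain a b (xi ^~ w) i != nilS) (iota 1 k)).
Proof.
move=> mxi hxi; have : forall j, (j <= k)%N -> measurable_fun setT
    (fun w => all (fun i => lchain a b (xi ^~ w) i != nilS) (iota 1 j)).
  elim=> [_|j IH jk]; first exact: measurable_cst.
  rewrite [X in measurable_fun _ X](_ : _ = (fun w =>
      all (fun i => lchain a b (xi ^~ w) i != nilS) (iota 1 j) &&
      (0 < weight (cst 1) (cst 1) (lchain a b (xi ^~ w) j.+1)))).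
    apply: measurable_and; first exact/IH/ltnW.
    apply: measurable_fun_ltr => //; apply: weight_smf => // i ij; apply: mxi.
    exact: leq_trans ij jk.
  apply/funext => w; rewrite -[X in iota 1 X]addn1 iotaD all_cat/= andbT.
  by rewrite -ordered_nilP//; apply: (@lchain_ordered _ a b (xi ^~ w) j.+1).
by apply.
Qed.

Lemma alive_measurable k : measurable_fun setT (alive k).
Proof. exact: alive_measurable_gen. Qed.

Lemma alive_natr_measurable k : measurable_fun setT (fun w => (alive k w)%:R : R).
Proof.
rewrite [X in measurable_fun _ X](_ : _ = fun w => if alive k w then 1 else 0).
  by apply: measurable_fun_ifT => //; exact: alive_measurable.
by apply/funext => w; case: ifP.
Qed.

Lemma aliveS k w : alive k.+1 w = alive k w && (St k.+1 w != nilS).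
Proof. by rewrite /alive -[X in iota 1 X]addn1 iotaD all_cat/= andbT. Qed.

Lemma expected_return_time :
  (\int[P]_w ereal_inf [set (k%:R : R)%:E | k in
      [set k : nat | (0 < k)%N /\ St k w = nilS]] =
   \sum_(n <oo) P [set w | alive n w])%E.
Proof.
transitivity (\int[P]_w \sum_(n <oo) ((alive n w)%:R : R)%:E)%E.
  apply: eq_integral => w _; rewrite -return_time_series; congr ereal_inf.
  by apply/seteqP; split => _ [k [k0 /= Zk] <-]; exists k => //; split => //; apply/eqP.
rewrite integral_nneseries//.
- apply: eq_eseriesr => n _.
  have mA : measurable [set w | alive n w].
    rewrite (_ : [set _ | _] = alive n @^-1` [set true]); last by apply/seteqP; split.
    by rewrite -[X in measurable X]setTI; exact: alive_measurable.
  have := integral_indic P measurableT mA; rewrite setIT => <-.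
  by apply: eq_integral => w _; rewrite indicE mem_setE.
- by move=> n; apply/measurable_EFinP; exact: alive_natr_measurable.
Qed.

(** Order k is replaced by an independent variable, clamped so that prices lie in [a, b] everywhere
    and not just almost surely. The values at i > k do not influence the first k + 1 steps. *)
Definition shift_order k (z : Om * (R * bool)) (i : nat) : R * bool :=
  if (i < k)%N then eta i z.1 else clamp_o z.2.

Lemma clamp_o_id o : a <= o.1 <= b -> clamp_o o = o.
Proof. by case: o => u s /= h; rewrite /clamp_o/= clampx_id. Qed.

Lemma measurable_clamp_o : measurable_fun setT clamp_o.
Proof.
apply: measurable_fun_pair => //; apply: (@measurableT_comp _ _ _ _ _ _ (clampx a b)) => //.
by apply: nondecreasing_measurable => // x y; exact: clampx_nd.
Qed.

Lemma lchain_shift k w o : lchain a b (shift_order k (w, o)) k.+1 = step a b (clamp_o o) (St k w).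
Proof.
have e : shift_order k (w, o) k = clamp_o o by rewrite /shift_order ltnn.
by rewrite /= e (@lchain_ext _ (eta ^~ w))// => i ik; rewrite /shift_order ik.
Qed.

Let mshift k i : measurable_fun
  (setT : set (g_sigma_algebraType (cylinders eta k) * (R * bool))) (fun z => shift_order k z i).
Proof.
rewrite /shift_order; case ik: (i < k)%N.
  have := @measurableT_comp _ _ _ (g_sigma_algebraType (cylinders eta k) * (R * bool))%type
    (g_sigma_algebraType (cylinders eta k)) _ (eta i) setT fst (past_measurable (eta := eta) ik) measurable_fst.
  exact.
have := @measurableT_comp _ _ _ (g_sigma_algebraType (cylinders eta k) * (R * bool))%type
    _ _ clamp_o setT snd measurable_clamp_o measurable_snd.
exact.
Qed.

Let hshift k i z : a <= (shift_order k z i).1 <= b.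
Proof. by rewrite /shift_order; case: ifP => _ //; exact: clampx_bound. Qed.

Let f_meas phi k : state_measurable_fun phi -> measurable_fun
  (setT : set (g_sigma_algebraType (cylinders eta k) * (R * bool)))
  (fun z => ((alive k z.1)%:R * phi (step a b (clamp_o z.2) (St k z.1)))%:E).
Proof.
move=> mphi; apply/measurable_EFinP; apply: measurable_funM.
  rewrite [X in measurable_fun _ X](_ : _ = fun z => if alive k z.1 then 1 else 0); last first.
    by apply/funext => w; case: ifP.
  apply: measurable_fun_ifT => //.
  apply: (measurableT_comp (_ : measurable_fun setT (alive k : g_sigma_algebraType (cylinders eta k) -> bool))); last exact: measurable_fst.
  by apply: alive_measurable_gen => // i ik; exact: past_measurable.
rewrite [X in measurable_fun _ X](_ : _ = fun z => phi (lchain a b (shift_order k z) k.+1)).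
  by apply: (mphi _ (g_sigma_algebraType (cylinders eta k) * (R * bool))%type (fun i z => shift_order k z i) k.+1) => [i ik|i z]; [exact: mshift|exact: hshift].
by apply/funext => -[w o]; rewrite lchain_shift.
Qed.

(** The Markov property at time k: [past_tonelli] is used with Y the identity, viewed as a map into
    [Om] with the sigma-algebra of the first k orders. *)
Lemma step_tonelli k phi : (forall x, 0 <= phi x) -> state_measurable_fun phi ->
  (\int[P]_w ((alive k w)%:R * phi (St k.+1 w))%:E =
   \int[P]_w \int[rho]_o ((alive k w)%:R * phi (step a b (clamp_o o) (St k w)))%:E)%E.
Proof.
move=> phi0 mphi.
have := @past_tonelli R d Om P _ _ eta rho meta ind k _ (g_sigma_algebraType (cylinders eta k)) id
  (fun z => ((alive k z.1)%:R * phi (step a b (clamp_o z.2) (St k z.1)))%:E).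
move=> /(_ _ _ _)/= <-//.
- by apply: eq_integral => w _ /=; rewrite clamp_o_id.
- exact: f_meas.
- by move=> z; rewrite lee_fin mulr_ge0.
Qed.

Lemma step_int_measurable k phi : (forall x, 0 <= phi x) -> state_measurable_fun phi ->
  measurable_fun setT (fun w =>
    \int[rho]_o ((alive k w)%:R * phi (step a b (clamp_o o) (St k w)))%:E)%E.
Proof.
move=> phi0 mphi _ B mB.
have mF : measurable_fun (setT : set (g_sigma_algebraType (cylinders eta k))) (fun w =>
    \int[rho]_o ((alive k w)%:R * phi (step a b (clamp_o o) (St k w)))%:E)%E.
  apply: (measurable_fun_fubini_tonelli_F (m2 := rho)
    (fun z : g_sigma_algebraType (cylinders eta k) * (R * bool) =>
      ((alive k z.1)%:R * phi (step a b (clamp_o z.2) (St k z.1)))%:E)).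
  - exact: f_meas.
  - by move=> z; rewrite lee_fin mulr_ge0.
have := mF measurableT B mB; apply: smallest_sub; last exact: cylinders_measurable.
exact: sigma_algebra_measurable.
Qed.

Lemma weight_norm (wm wp : R -> R) (K : R) (x : seq R * seq R) : (forall y, `|wm y| <= K) -> (forall y, `|wp y| <= K) ->
  `|weight wm wp x| <= K * weight (cst 1) (cst 1) x.
Proof.
move=> hm hp; rewrite /weight mulrDr !mulr_sumr.
apply: le_trans (ler_normD _ _) _; apply: lerD; apply: le_trans (ler_norm_sum _ _ _) _;
  by apply: ler_sum => i _; rewrite mulr1.
Qed.

Lemma jump_norm (wm wp : R -> R) (K m M : R) (o : R * bool) : (forall y, `|wm y| <= K) -> (forall y, `|wp y| <= K) ->
  `|jump a b wm wp m M o| <= K.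
Proof.
move=> hm hp; have K0 : 0 <= K by apply: le_trans (hm 0).
by rewrite /jump; do ![case: ifP => _]; rewrite ?normrN ?normr0.
Qed.

Lemma weight1_step (o : R * bool) (x : seq R * seq R) : ordered a b x ->
  weight (cst 1) (cst 1) (step a b o x) <= weight (cst 1) (cst 1) x + 1.
Proof.
move=> hx; rewrite weight_step// lerD2l; apply: le_trans (ler_norm _) _.
by apply: jump_norm => y; rewrite normr1.
Qed.

Lemma weight1_le k w : weight (cst 1) (cst 1) (St k w) <= k%:R.
Proof.
elim: k => [|k IH] /=; first by rewrite /weight !big_nil addr0.
by apply: le_trans (weight1_step _ (ox k w)) _; rewrite -natr1 lerD2r.
Qed.

Lemma rho_clamp_int (f : R * bool -> R) : measurable_fun setT f ->
  \int[rho]_o f (clamp_o o) = \int[rho]_o f o.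
Proof.
move=> mf; have mN : measurable [set o : R * bool | ~~ (a <= o.1 <= b)].
  rewrite (_ : [set _ | _] = (fun o => ~~ (a <= o.1 <= b)) @^-1` [set true]).
    rewrite -[X in measurable X]setTI; suff: measurable_fun setT (fun o : R * bool => ~~ (a <= o.1 <= b)) by apply.
    apply: measurable_neg; apply: measurable_and; apply: measurable_fun_ler => //;
      exact: measurable_fst.
  by apply/seteqP; split.
apply: (eq_Rintegral_null mN rho_out) => //.
  exact: (measurableT_comp mf measurable_clamp_o).
by move=> o /negP; rewrite negbK => h; rewrite clamp_o_id.
Qed.

Lemma bounded_integralE d' (T : measurableType d') (Q : probability T R) (f : T -> R) (K : R) :
  measurable_fun setT f -> (forall x, `|f x| <= K) ->
  (\int[Q]_x (f x)%:E)%E = (\int[Q]_x f x)%:E.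
Proof.
move=> mf fK; rewrite /Rintegral fineK//; apply: integrable_fin_num => //.
exact: bounded_integrable fK.
Qed.

Lemma jump_clamp_int (wm wp : R -> R) (m M : R) : measurable_fun setT wm -> measurable_fun setT wp ->
  \int[rho]_o jump a b wm wp m M (clamp_o o) = \int[rho]_o jump a b wm wp m M o.
Proof.
move=> mwm mwp; apply: (rho_clamp_int (f := jump a b wm wp m M)).
by apply: (@jump_measurable R a b wm wp _ _ (fun=> m) (fun=> M) (fun o => o)).
Qed.

Let jump_clamp_meas (wm wp : R -> R) (m M : R) : measurable_fun setT wm -> measurable_fun setT wp ->
  measurable_fun setT (fun o => jump a b wm wp m M (clamp_o o)).
Proof.
by move=> mwm mwp; apply: (@jump_measurable R a b wm wp _ _ (fun=> m) (fun=> M)) => //;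
  exact: measurable_clamp_o.
Qed.

Lemma bid_range x : ordered a b x -> a <= bid a x <= b.
Proof. by move=> hx; rewrite bid_gea/= (le_trans (ltW (bid_lt_ask ab hx)))// ask_leb. Qed.

Lemma ask_range x : ordered a b x -> a <= ask b x <= b.
Proof. by move=> hx; rewrite ask_leb andbT (le_trans _ (ltW (bid_lt_ask ab hx)))// bid_gea. Qed.

(** * No positive recurrence when a linear weight has nonnegative drift *)

Section necessity.
Variables (wm wp : R -> R) (K : R) (J : seq R * seq R -> R) (CJ : R).
Hypothesis mwm : measurable_fun setT wm.
Hypothesis mwp : measurable_fun setT wp.
Hypothesis K0 : 0 < K.
Hypothesis bB : forall y, `|wm y| <= K.
Hypothesis aB : forall y, `|wp y| <= K.
Hypothesis mJ : state_measurable_fun J.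
Hypothesis JE : forall x, ordered a b x ->
  \int[rho]_o jump a b wm wp (bid a x) (ask b x) o = J x.
Hypothesis J_ge0 : forall x, 0 <= J x.
Hypothesis J_nil : 0 < J nilS.
Local Notation F := (weight wm wp).

Let F_step_int k x : ordered a b x -> weight (cst 1) (cst 1) x <= k%:R ->
  (\int[rho]_o (F (step a b (clamp_o o) x) + K * k.+1%:R)%:E)%E = (F x + K * k.+1%:R + J x)%:E.
Proof.
move=> hx xk.
have mj := jump_clamp_meas (bid a x) (ask b x) mwm mwp.
have -> : (fun o => (F (step a b (clamp_o o) x) + K * k.+1%:R)%:E) =
   (fun o => (F x + K * k.+1%:R + jump a b wm wp
      (bid a x) (ask b x) (clamp_o o))%:E).
  by apply/funext => o; rewrite weight_step//; congr EFin; ring.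
rewrite (@bounded_integralE _ _ _ _ (`|F x + K * k.+1%:R| + K)); last 2 first.
- by apply: measurable_funD.
- by move=> o; apply: le_trans (ler_normD _ _) _; rewrite lerD2l jump_norm.
congr EFin; rewrite RintegralD//; last 2 first.
- exact: (@bounded_integrable _ _ _ _ _ `|F x + K * k.+1%:R|).
- by apply: (@bounded_integrable _ _ _ _ _ K) => // o; exact: jump_norm.
rewrite Rintegral_cst// [X in _ * fine X](_ : _ = 1%E); last exact: probability_setT.
rewrite mulr1; congr (_ + _).
by rewrite jump_clamp_int// JE.
Qed.

Let v k := \int[P]_w ((alive k w)%:R * F (St k w)).
Let pk k := \int[P]_w ((alive k w)%:R).

Let mF k : measurable_fun setT (fun w => F (St k w)).
Proof. by apply: weight_smf => // i _; exact: meta. Qed.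

Let F_bound k w : `|F (St k w)| <= K * k%:R.
Proof.
apply: le_trans (weight_norm _ bB aB) _.
by rewrite ler_pM2l// weight1_le.
Qed.

Let alive_aff k (f : Om -> R) (C e : R) : measurable_fun setT f -> (forall w, `|f w| <= C) ->
  \int[P]_w ((alive k w)%:R * (f w + e)) = \int[P]_w ((alive k w)%:R * f w) + e * pk k.
Proof.
move=> mf fC; have mA := alive_natr_measurable k.
have iA : P.-integrable setT (EFin \o (fun w => (alive k w)%:R : R)).
  by apply: (@bounded_integrable _ _ _ _ _ 1) => // w; case: (alive k w); rewrite ?normr0 ?normr1.
rewrite -RintegralZl// -RintegralD//.
- by apply: eq_Rintegral => w _; rewrite mulrDr [e * _]mulrC.
- apply: (@bounded_integrable _ _ _ _ _ C); first exact: measurable_funM.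
  move=> w; have C0 : 0 <= C by apply: le_trans (fC w).
  by case: (alive k w); rewrite ?mul0r ?normr0 ?mul1r.
- apply: (@bounded_integrable _ _ _ _ _ `|e|); first exact: measurable_funM.
  by move=> w; case: (alive k w); rewrite ?mulr0 ?normr0 ?mulr1.
Qed.

Let alive_bound k (f : Om -> R) (C : R) w : `|f w| <= C -> `|(alive k w)%:R * f w| <= C.
Proof.
move=> fC; have C0 : 0 <= C by apply: le_trans fC.
by case: (alive k w); rewrite ?mul0r ?normr0 ?mul1r.
Qed.

(** F vanishes on the empty book, so paths that return at time k + 1 contribute nothing and may be
    kept in the integral for [v k.+1]. What remains is to integrate out order k, which adds J. *)
Let v_step k c : 0 <= c -> (forall w, c <= J (St k w)) -> v k + c * pk k <= v k.+1.
Proof.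
move=> c0 cJ.
have mA := alive_natr_measurable k.
(* After k + 1 steps there are at most k + 1 orders, so e dominates |F| and makes the integrands
   nonnegative for Tonelli. *)
pose e := K * k.+1%:R.
have e_ge k' x : (k' <= k.+1)%N -> `|F x| <= K * k'%:R -> 0 <= F x + e.
  move=> kk; rewrite ler_norml => /andP[h _]; rewrite -lerBlDr sub0r; apply: le_trans h.
  by rewrite lerN2 ler_pM2l// ler_nat.
have vE : v k.+1 = \int[P]_w ((alive k w)%:R * F (St k.+1 w)).
  apply: eq_Rintegral => w _; rewrite aliveS.
  have [->|_] := eqVneq (St k.+1 w) nilS; last by rewrite andbT.
  by rewrite /weight !big_nil addr0 !mulr0.
have kk : K * k%:R <= e by rewrite ler_pM2l// ler_nat.
have leI : (\int[P]_w ((alive k w)%:R * (F (St k w) + (e + c)))%:E <=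
    \int[P]_w ((alive k w)%:R * (F (St k.+1 w) + e))%:E)%E.
  (* [step_tonelli] asks for a function that is nonnegative on all states; on those reachable in k +
     1 steps the truncation has no effect. *)
  pose phi x := Num.max 0 (F x + e).
  have mphi : state_measurable_fun phi.
    move=> d' T xi k' mxi hxi; apply: measurable_maxr => //.
    by apply: measurable_funD => //; exact: weight_smf.
  have -> : (\int[P]_w ((alive k w)%:R * (F (St k.+1 w) + e))%:E =
             \int[P]_w ((alive k w)%:R * phi (St k.+1 w))%:E)%E.
    apply: eq_integral => w _; rewrite /phi max_r//.
    by apply: (e_ge k.+1) => //; exact: F_bound.
  rewrite step_tonelli//; last by move=> x; rewrite le_max lexx.
  rewrite [leRHS](_ : _ = \int[P]_w ((alive k w)%:R * (F (St k w) + e + J (St k w)))%:E)%E; last first.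
    apply: eq_integral => w _; case: (alive k w); last first.
      rewrite mul0r; under eq_integral do rewrite mul0r.
      by rewrite integral0.
    rewrite mul1r -F_step_int ?weight1_le//; apply: eq_integral => o _.
    rewrite mul1r /phi max_r//; apply: (e_ge k.+1) => //.
    apply: le_trans (weight_norm _ bB aB) _; rewrite ler_pM2l//.
    by apply: le_trans (weight1_step _ (ox k w)) _; rewrite -natr1 lerD2r weight1_le.
  apply: ge0_le_integral => //.
  - move=> w _; rewrite lee_fin mulr_ge0// addrA addr_ge0//.
    by apply: (e_ge k); [exact: leqnSn|exact: F_bound].
  - by apply/measurable_EFinP; apply: measurable_funM => //; exact: measurable_funD.
  - apply/measurable_EFinP; apply: measurable_funM => //; apply: measurable_funD.
      exact: measurable_funD.
    by apply: mJ => // i _; exact: meta.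
  - by move=> w _; rewrite lee_fin ler_wpM2l// addrA lerD2l.
move: leI; have mf1 : measurable_fun setT (fun w => (alive k w)%:R * (F (St k w) + (e + c))).
  by apply: measurable_funM => //; exact: measurable_funD.
have mf2 : measurable_fun setT (fun w => (alive k w)%:R * (F (St k.+1 w) + e)).
  by apply: measurable_funM => //; exact: measurable_funD.
rewrite (@bounded_integralE _ _ _ _ (K * k%:R + `|e + c|) mf1); last first.
  by move=> w; apply: (@alive_bound k (fun w => F (St k w) + (e + c))); rewrite (le_trans (ler_normD _ _))// lerD2r F_bound.
rewrite (@bounded_integralE _ _ _ _ (K * k.+1%:R + `|e|) mf2); last first.
  by move=> w; apply: (@alive_bound k (fun w => F (St k.+1 w) + e)); rewrite (le_trans (ler_normD _ _))// lerD2r F_bound.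
rewrite lee_fin (@alive_aff k (fun w => F (St k w)) _ (e + c) (mF k) (F_bound k)).
rewrite (@alive_aff k (fun w => F (St k.+1 w)) _ e (mF k.+1) (F_bound k.+1)) -vE.
by rewrite -/(v k) mulrDl; lra.
Qed.

Lemma not_recurrent : ~ (\sum_(n <oo) P [set w | alive n w] < +oo)%E.
Proof.
have pE n : P [set w | alive n w] = (pk n)%:E.
  have mA : measurable [set w | alive n w].
    rewrite (_ : [set _ | _] = alive n @^-1` [set true]); last by apply/seteqP; split.
    by rewrite -[X in measurable X]setTI; exact: alive_measurable.
  rewrite /pk (Rintegral_pred P mA) fineK//; exact: fin_num_measure.
have pk0 : pk 0 = 1.
  have : P [set w | alive 0 w] = 1%E.
    by rewrite (_ : [set _ | _] = setT) ?probability_setT//; apply/seteqP; split.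
  by rewrite pE => -[].
(* The first step starts from the empty book and gains J nilS > 0; from then on J >= 0 keeps v from
   decreasing. *)
have v1 : J nilS <= v 1.
  have v0 : v 0 = 0.
    transitivity (\int[P]_w (0 : R)); last by rewrite Rintegral_cst// mul0r.
    by apply: eq_Rintegral => w _; rewrite /= /weight !big_nil addr0 mulr0.
  by have := @v_step 0 (J nilS) (ltW J_nil); rewrite v0 add0r pk0 mulr1; apply.
have vn n : J nilS <= v n.+1.
  elim: n => // n IH; apply: (le_trans IH).
  by have := @v_step n.+1 0 (lexx 0) (fun w => J_ge0 _); rewrite mul0r addr0.
apply: (@harmonic_bound_dvg _ _ (J nilS / K)) => [|n|n]; first exact: divr_gt0.
  exact: measure_ge0.
rewrite pE lee_fin -mulrA -invfM ler_pdivrMr ?mulr_gt0//; apply: (le_trans (vn n)).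
have mA := alive_natr_measurable n.+1.
have iA : P.-integrable setT (EFin \o (fun w => (alive n.+1 w)%:R : R)).
  by apply: (@bounded_integrable _ _ _ _ _ 1) => // w; case: (alive n.+1 w); rewrite ?normr0 ?normr1.
rewrite /pk mulrC -RintegralZl//; apply: le_Rintegral => //.
- apply: (@bounded_integrable _ _ _ _ _ (K * n.+1%:R)); first exact: measurable_funM.
  by move=> w; apply: (@alive_bound _ (fun w => F (St n.+1 w))); exact: F_bound.
- apply: (@bounded_integrable _ _ _ _ _ (K * n.+1%:R)); first exact: measurable_funM.
  by move=> w; case: (alive n.+1 w); rewrite ?mulr0 ?normr0 ?mulr1 ?ger0_norm// ?mulr_ge0// ltW.
- move=> w _; rewrite mulrC ler_wpM2r//; apply: le_trans (F_bound n.+1 w); exact: ler_norm.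
Qed.

End necessity.

Let haa : a <= a <= b. Proof. by rewrite lexx ltW. Qed.
Let hbb : a <= b <= b. Proof. by rewrite lexx ltW. Qed.
Let la0 : 0 < l a. Proof. by have [] := reg haa. Qed.
Let La0 : 0 < L a. Proof. by have [] := reg haa. Qed.
Let lb0 : 0 < l b. Proof. by have [] := reg hbb. Qed.
Let Lb0 : 0 < L b. Proof. by have [] := reg hbb. Qed.

Lemma askw_cp_b : 0 < askw a b l L (cp a l L) b.
Proof.
rewrite /askw (clampx_id hbb) ltr_wpDl ?(askw0_ge0 ab reg mon)//.
by rewrite mulr_gt0// invr_gt0.
Qed.

Local Notation Lm := (Lm a b l L).
Local Notation Lp := (Lp a b l L).
Local Notation cm := (cm a b l L).
Local Notation cp := (cp a l L).
Local Notation bidw := (bidw a b l L).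
Local Notation askw := (askw a b l L).

Definition Jm x : R := (- l a * Lm + (if a < bid a x then 0 else bidw cm a * L a)) / tot.
Definition Jp x : R := (- L b * Lp + (if ask b x < b then 0 else askw cp b * l b)) / tot.

Lemma JmE x : ordered a b x ->
  \int[rho]_o jump a b (bidw cm) (askw cm) (bid a x) (ask b x) o = Jm x.
Proof.
move=> hx; rewrite /Jm -(cm_integral ab reg mon tot0 rho_bid rho_ask rho_out (bid_range hx) (ask_range hx)).
by rewrite mulrAC mulfV ?mul1r// gt_eqF.
Qed.

Lemma JpE x : ordered a b x ->
  \int[rho]_o jump a b (bidw cp) (askw cp) (bid a x) (ask b x) o = Jp x.
Proof.
move=> hx; rewrite /Jp -(cp_integral ab reg mon tot0 rho_bid rho_ask rho_out (bid_range hx) (ask_range hx)).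
by rewrite mulrAC mulfV ?mul1r// gt_eqF.
Qed.

Lemma Jm_smf : state_measurable_fun Jm.
Proof.
move=> d' T xi k mxi hxi; apply: measurable_funM => //; apply: measurable_funD => //.
apply: measurable_fun_ifT => //; apply: measurable_fun_ltr => //.
by have [] := state_measurable ab mxi hxi (leqnn k).
Qed.

Lemma Jp_smf : state_measurable_fun Jp.
Proof.
move=> d' T xi k mxi hxi; apply: measurable_funM => //; apply: measurable_funD => //.
apply: measurable_fun_ifT => //; apply: measurable_fun_ltr => //.
by have [] := state_measurable ab mxi hxi (leqnn k).
Qed.

Lemma recurrent_Lm_gt0 : (\sum_(n <oo) P [set w | alive n w] < +oo)%E -> 0 < Lm.
Proof.
move=> S; rewrite ltNge; apply/negP => L0; move: S.
have q : 0 <= - l a * Lm by rewrite mulNr -mulrN mulr_ge0 ?oppr_ge0// ltW.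
have q' : 0 < bidw cm a * L a by rewrite mulr_gt0// bidw_cm_a.
apply: (@not_recurrent (bidw cm) (askw cm) (weight_bound a b l L cm) Jm) => //.
- exact: measurable_bidw.
- exact: measurable_askw.
- apply: lt_le_trans (bidw_bound ab reg mon cm a).
  by rewrite normr_gt0 gt_eqF// bidw_cm_a.
- by move=> y; exact: bidw_bound.
- by move=> y; exact: askw_bound.
- exact: Jm_smf.
- exact: JmE.
- by move=> x; rewrite divr_ge0 ?(ltW tot0)// addr_ge0//; case: ifP => // _; exact: ltW.
- by rewrite /Jm bid_nil ltxx divr_gt0// ltr_wpDl.
Qed.

Lemma recurrent_Lp_gt0 : (\sum_(n <oo) P [set w | alive n w] < +oo)%E -> 0 < Lp.
Proof.
move=> S; rewrite ltNge; apply/negP => L0; move: S.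
have q : 0 <= - L b * Lp by rewrite mulNr -mulrN mulr_ge0 ?oppr_ge0// ltW.
have q' : 0 < askw cp b * l b by rewrite mulr_gt0// askw_cp_b.
apply: (@not_recurrent (bidw cp) (askw cp) (weight_bound a b l L cp) Jp) => //.
- exact: measurable_bidw.
- exact: measurable_askw.
- apply: lt_le_trans (askw_bound ab reg mon cp b).
  by rewrite normr_gt0 gt_eqF// askw_cp_b.
- by move=> y; exact: bidw_bound.
- by move=> y; exact: askw_bound.
- exact: Jp_smf.
- exact: JpE.
- by move=> x; rewrite divr_ge0 ?(ltW tot0)// addr_ge0//; case: ifP => // _; exact: ltW.
- by rewrite /Jp ask_nil ltxx divr_gt0// ltr_wpDl.
Qed.

(** * Foster's criterion: a Lyapunov function bounds the expected return time *)

Section sufficiency.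

Variable V : seq R * seq R -> R.
Hypothesis V_ge0 : forall x, 0 <= V x.
Hypothesis V_smf : state_measurable_fun V.
Hypothesis V_bound : exists C, forall w, V (St 1 w) <= C.
Hypothesis V_drift : forall x, ordered a b x -> x != nilS ->
  (\int[rho]_o (V (step a b (clamp_o o) x))%:E <= (V x - 1)%:E)%E.

Let E k := (\int[P]_w ((alive k w)%:R * V (St k w))%:E)%E.

Let mV k : measurable_fun setT (fun w => V (St k w)).
Proof. by apply: V_smf => // i _; exact: meta. Qed.

Let mAlive k : measurable [set w | alive k w].
Proof.
rewrite (_ : [set _ | _] = alive k @^-1` [set true]); last by apply/seteqP; split.
by rewrite -[X in measurable X]setTI; exact: alive_measurable.
Qed.

Let E_ge0 k : (0 <= E k)%E.
Proof. by apply: integral_ge0 => w _; rewrite lee_fin mulr_ge0. Qed.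

(** V is nonnegative also after the step, so a mean decrease by 1 is possible only from a value of
    at least 1. *)
Let V_ge1 x : ordered a b x -> x != nilS -> 1 <= V x.
Proof.
move=> hx xn; rewrite -subr_ge0 -lee_fin; apply: le_trans (V_drift hx xn).
by apply: integral_ge0 => o _; rewrite lee_fin.
Qed.

Let alive_neq k w : alive k.+1 w -> St k.+1 w != nilS.
Proof. by rewrite aliveS => /andP[]. Qed.

(** Each step before the return pays for P(tau > k + 1) by the mean decrease of V, and telescoping
    bounds the sum. The index starts at 1 because nothing is assumed about the drift from the empty
    state; [V_bound] controls that first step. *)
Let E_step k : (E k.+2 + P [set w | alive k.+1 w] <= E k.+1)%E.
Proof.
have mA := alive_natr_measurable k.+1.
pose g w := (alive k.+1 w)%:R * (V (St k.+1 w) - 1).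
have g0 w : 0 <= g w.
  rewrite /g; case: (boolP (alive k.+1 w)) => Aw; last by rewrite mul0r.
  by rewrite mul1r subr_ge0 V_ge1//; exact: alive_neq.
have mg : measurable_fun setT g by apply: measurable_funM => //; exact: measurable_funD.
have -> : E k.+1 = (\int[P]_w (g w)%:E + P [set w | alive k.+1 w])%E.
  have -> : P [set w | alive k.+1 w] = (\int[P]_w ((alive k.+1 w)%:R : R)%:E)%E.
    have := integral_indic P measurableT (mAlive k.+1); rewrite setIT => <-.
    by apply: eq_integral => w _; rewrite indicE mem_setE.
  rewrite -ge0_integralD//.
  - by apply: eq_integral => w _; rewrite -EFinD /g; congr EFin; ring.
  - by move=> w _; rewrite lee_fin.
  - exact/measurable_EFinP.
  - exact/measurable_EFinP.
apply: leeD => //.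
apply: (@le_trans _ _ (\int[P]_w ((alive k.+1 w)%:R * V (St k.+2 w))%:E)%E).
  apply: ge0_le_integral => //.
  - by move=> w _; rewrite lee_fin mulr_ge0.
  - by apply/measurable_EFinP; apply: measurable_funM => //; exact: alive_natr_measurable.
  - by apply/measurable_EFinP; apply: measurable_funM.
  - move=> w _; rewrite lee_fin ler_wpM2r// aliveS; case: (alive k.+1 w) => //=.
    by case: (_ != _).
rewrite step_tonelli//.
have intE w : (\int[rho]_o ((alive k.+1 w)%:R * V (step a b (clamp_o o) (St k.+1 w)))%:E <= (g w)%:E)%E.
  rewrite /g; case: (boolP (alive k.+1 w)) => Aw; last first.
    rewrite mul0r; under eq_integral do rewrite mul0r.
    by rewrite integral0.
  rewrite mul1r; under eq_integral do rewrite mul1r.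
  by apply: V_drift; [exact: ox|exact: alive_neq].
apply: ge0_le_integral => //.
- by move=> w _; apply: integral_ge0 => o _; rewrite lee_fin mulr_ge0.
- exact: step_int_measurable.
- exact/measurable_EFinP.
Qed.

Lemma recurrent : (\sum_(n <oo) P [set w | alive n w] < +oo)%E.
Proof.
have [C VC] := V_bound.
have mA := alive_natr_measurable 1.
have E1 : (E 1 < +oo)%E.
  rewrite /E (@bounded_integralE _ _ _ _ C) ?ltry//; first exact: measurable_funM.
  move=> w; have V1 := V_ge0 (St 1 w); have C0 : 0 <= C by apply: le_trans (VC w).
  by case: (alive 1 w); rewrite ?mul0r ?normr0 ?mul1r ?ger0_norm.
have bnd n : (\sum_(0 <= k < n) P [set w | alive k.+1 w] + E n.+1 <= E 1)%E.
  elim: n => [|n IH]; first by rewrite big_geq// add0e.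
  rewrite big_nat_recr//= -addeA; apply: le_trans IH; apply: leeD => //.
  by rewrite addeC; exact: E_step.
apply: (@le_lt_trans _ _ (P [set w | alive 0 w] + E 1)%E); last first.
  by apply: lte_add_pinfty => //; apply: le_lt_trans (probability_le1 P (mAlive 0)) (ltry 1).
apply: lime_le.
  by apply: is_cvg_nneseries => n _ _; exact: measure_ge0.
near=> n.
have -> : n = n.-1.+1 by rewrite prednK//; near: n; exists 1%N.
rewrite big_nat_recl//=; apply: leeD => //.
by apply: le_trans (bnd n.-1); rewrite -[leLHS]adde0 leeD.
Unshelve. all: by end_near.
Qed.

End sufficiency.

(** Taylor bound for the square of the positive part, which is continuously differentiable with
    derivative of slope at most 2. The drift of this square is thus a linear term plus a bounded
    error. *)
Lemma sqr_posD_le (t e : R) :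
  Num.max 0 (t + e) ^+ 2 <= Num.max 0 t ^+ 2 + 2 * Num.max 0 t * e + e ^+ 2.
Proof.
case: (leP 0 (t + e)) => h1; case: (leP 0 t) => h2; rewrite ?expr0n/= ?mulr0 ?mul0r ?add0r.
- by rewrite le_eqVlt; apply/orP; left; apply/eqP; ring.
- by nra.
- by have -> : t ^+ 2 + 2 * t * e + e ^+ 2 = (t + e) ^+ 2 by [ring]; rewrite sqr_ge0.
- by rewrite sqr_ge0.
Qed.

(** * The Lyapunov function when both Lambda are positive *)

Section lyapunov.
Hypotheses (Lm0 : 0 < Lm) (Lp0 : 0 < Lp).

Local Notation FA := (weight (bidw cm) (askw cm)).
Local Notation FB := (weight (bidw cp) (askw cp)).
Local Notation N := (@weight R (cst 1) (cst 1)).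
Local Notation jA x := (jump a b (bidw cm) (askw cm) (bid a x) (ask b x)).
Local Notation jB x := (jump a b (bidw cp) (askw cp) (bid a x) (ask b x)).

Let A x := Num.max 0 (l b * FA x).
Let B x := Num.max 0 (L a * FB x).
Let K1 := weight_bound a b l L cm.
Let K2 := weight_bound a b l L cp.
(** C bounds the second-order errors of the two squares, [pi0] is a lower bound for the probability
    that a nonempty book loses an order, and exp(-c) = q with 2 q = [pi0]. The rate of decrease of
    the linear parts is [e], and [de] comes from [bid_comb] and [ask_comb]. [N0] solves 2 e de N0 =
    C + 1, and [Ga] makes Ga exp(-c n) / 2 >= C + 1 for n <= N0. *)
Let C := (l b * K1) ^+ 2 + (L a * K2) ^+ 2.
Let pi0 := Num.min (L a) (l b) / tot.
Let q := pi0 / 2.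
Let c := - ln q.
Let e := Num.min (l b * (l a * Lm / tot)) (L a * (L b * Lp / tot)).
Let de := Num.min (Lp * L a) (Lm * l b).
Let N0 := (C + 1) / (2 * e * de).
Let Ga := 2 * (C + 1) / expR (- (c * N0)).
(* The drift of A^2 + B^2 is at most C - 2 e (A + B), hence at most -1 once the
   number of orders N exceeds N0; for N <= N0 the last term supplies the decrease
   because each nonempty book loses an order with probability at least pi0. *)
Let V x := A x ^+ 2 + B x ^+ 2 + Ga * (1 - expR (- (c * N x))).

Let C0 : 0 <= C. Proof. by rewrite addr_ge0// sqr_ge0. Qed.
Let pi_gt0 : 0 < pi0. Proof. by rewrite divr_gt0// lt_min La0. Qed.
Let e_gt0 : 0 < e. Proof. by rewrite lt_min !mulr_gt0 ?invr_gt0. Qed.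
Let de_gt0 : 0 < de. Proof. by rewrite lt_min !mulr_gt0. Qed.
Let Ga_gt0 : 0 < Ga. Proof. by rewrite divr_gt0 ?expR_gt0// mulr_gt0// ltr_wpDl. Qed.
Let q_gt0 : 0 < q. Proof. by rewrite divr_gt0. Qed.

Let pi_le1 : pi0 <= 1.
Proof.
apply: (@le_trans _ _ (L a / tot)); first by rewrite ler_pM2r ?invr_gt0// ge_min lexx.
rewrite -lee_fin -(rho_ask haa); apply: probability_le1.
rewrite (_ : [set _ | _] = (fun o => o.2 && (o.1 <= a)) @^-1` [set true]); last by apply/seteqP; split.
by rewrite -[X in measurable X]setTI; exact: (@measurable_le_true R a).
Qed.

Let q_le : q <= 2^-1. Proof. by rewrite /q ler_piMl. Qed.
Let c_ge0 : 0 <= c. Proof. by rewrite oppr_ge0 ln_le0// (le_trans q_le)// invf_le1// ler1n. Qed.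
Let expRc : expR (- c) = q. Proof. by rewrite opprK lnK// posrE. Qed.

Let N_ge0 x : 0 <= N x. Proof. by rewrite addr_ge0// sumr_ge0. Qed.

Let V_ge0 x : 0 <= V x.
Proof.
rewrite addr_ge0 ?addr_ge0 ?sqr_ge0// mulr_ge0 ?(ltW Ga_gt0)// subr_ge0.
by rewrite -[leRHS]expR0 ler_expR oppr_le0 mulr_ge0.
Qed.

Let A_smf : state_measurable_fun A.
Proof.
move=> d' T xi k mxi hxi; apply: measurable_maxr => //; apply: measurable_funM => //.
by apply: weight_smf => //; [exact: measurable_bidw|exact: measurable_askw].
Qed.

Let B_smf : state_measurable_fun B.
Proof.
move=> d' T xi k mxi hxi; apply: measurable_maxr => //; apply: measurable_funM => //.
by apply: weight_smf => //; [exact: measurable_bidw|exact: measurable_askw].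
Qed.

Let V_smf : state_measurable_fun V.
Proof.
move=> d' T xi k mxi hxi; apply: measurable_funD.
  by apply: measurable_funD; apply: measurable_funX; [exact: A_smf|exact: B_smf].
apply: measurable_funM => //; apply: measurable_funB => //.
apply: (measurableT_comp (@measurable_expR R)); apply: measurable_funN.
by apply: measurable_funM => //; apply: weight_smf.
Qed.

Let FA_norm x : `|FA x| <= K1 * N x.
Proof. by apply: weight_norm => y; [exact: bidw_bound|exact: askw_bound]. Qed.
Let FB_norm x : `|FB x| <= K2 * N x.
Proof. by apply: weight_norm => y; [exact: bidw_bound|exact: askw_bound]. Qed.

Let V_bound : exists M, forall w, V (St 1 w) <= M.
Proof.
exists ((l b * K1) ^+ 2 + (L a * K2) ^+ 2 + Ga) => w.
have N1 : N (St 1 w) <= 1 by exact: (weight1_le 1 w).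
have K10 : 0 <= K1 by apply: le_trans (bidw_bound ab reg mon cm a).
have K20 : 0 <= K2 by apply: le_trans (bidw_bound ab reg mon cp a).
have fA : FA (St 1 w) <= K1.
  by apply: le_trans (ler_norm _) _; apply: le_trans (FA_norm _) _; rewrite ler_piMr.
have fB : FB (St 1 w) <= K2.
  by apply: le_trans (ler_norm _) _; apply: le_trans (FB_norm _) _; rewrite ler_piMr.
rewrite /V; apply: lerD; first apply: lerD.
- rewrite ler_sqr ?nnegrE ?le_max ?lexx//; last by rewrite mulr_ge0// ltW.
  by rewrite ge_max mulr_ge0 ?(ltW lb0)//= ler_pM2l.
- rewrite ler_sqr ?nnegrE ?le_max ?lexx//; last by rewrite mulr_ge0// ltW.
  by rewrite ge_max mulr_ge0 ?(ltW La0)//= ler_pM2l.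
- by rewrite ger_pMr// lerBlDr lerDl ltW// expR_gt0.
Qed.

(** L a is the mass of sell orders at a and l b that of buy orders at b. Such an order is executed
    against any bid, respectively any ask, whatever the state. *)
Let down (x : seq R * seq R) : pred (R * bool) := fun o =>
  if x.1 == [::] then ~~ o.2 && (b <= o.1) else o.2 && (o.1 <= a).

Let down_jump x o : ordered a b x -> x != nilS -> down x o ->
  jump a b (cst 1) (cst 1) (bid a x) (ask b x) o = -1.
Proof.
move=> hx xn; rewrite /down /jump; have := bid_gt hx; have := ask_lt hx.
case: x xn hx => -[|y s] t xn hx /=.
  case: t xn hx => // z t _ hx -> _ /andP[/negbTE -> bo].
  by rewrite (le_trans (ask_leb _ _) bo).
by move=> _ -> /andP[-> oa]; rewrite (le_trans oa (bid_gea _ _)).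
Qed.

(** With exp(-c) = q, the function -q^n of the number of orders increases by at most q^n (1 - q) in
    one step and decreases by q^n (1/q - 1) when an order is removed. The factor 1 + 1/q makes the
    bound exact in the latter case. *)
Let h_step x o : ordered a b x -> x != nilS ->
  - expR (- (c * (N x + jump a b (cst 1) (cst 1) (bid a x) (ask b x) o))) <=
  - expR (- (c * N x)) + expR (- (c * N x)) * (1 - q) * (1 - (1 + q^-1) * (down x o)%:R).
Proof.
move=> hx xn; set Q := expR (- (c * N x)).
have Q0 : 0 < Q by exact: expR_gt0.
have q1 : q < 1 by apply: le_lt_trans q_le _; rewrite invf_lt1// ltr1n.
have expj j : expR (- (c * (N x + j))) = Q * expR (- c * j).
  by rewrite -expRD; congr expR; ring.
have qi : q * q^-1 = 1 by rewrite mulfV// gt_eqF.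
have eN1 : expR (- c * -1) = q^-1 by rewrite mulrN1 expRN expRc.
rewrite expj; case: (boolP (down x o)) => [dn|_].
  rewrite down_jump// eN1 mulr1.
  have -> : - Q + Q * (1 - q) * (1 - (1 + q^-1)) = - Q + Q * (q * q^-1 - q^-1) by ring.
  by rewrite qi; lra.
rewrite mulr0 subr0 mulr1.
have -> : - Q + Q * (1 - q) = - (Q * q) by ring.
rewrite lerN2 ler_pM2l// -expRc ler_expR mulNr lerN2 -[leRHS]mulr1 ler_wpM2l//.
by apply: le_trans (ler_norm _) _; apply: jump_norm => y; rewrite normr1.
Qed.

(** Without bids the drift of [FA] need not be negative, but then [FA] consists of sell weights,
    which are nonpositive, so A = 0. This is why positive parts are taken before squaring. *)
Let A_drift x : ordered a b x -> A x * (l b * Jm x) <= - (e * A x).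
Proof.
move=> hx; have A0 : 0 <= A x by rewrite le_max lexx.
rewrite /Jm; case: ifPn => [_|].
  rewrite addr0 mulrC -mulNr ler_wpM2r//.
  have -> : l b * (- l a * Lm / tot) = - (l b * (l a * Lm / tot)) by ring.
  by rewrite lerN2 ge_min lexx.
rewrite (bid_gt hx) negbK => /eqP x1.
have -> : A x = 0; last by rewrite mul0r mulr0 oppr0.
rewrite /A max_l// mulr_ge0_le0 ?(ltW lb0)// /weight x1 big_nil add0r.
by apply: sumr_le0 => y _; exact: askw_cm_le0.
Qed.

Let B_drift x : ordered a b x -> B x * (L a * Jp x) <= - (e * B x).
Proof.
move=> hx; have A0 : 0 <= B x by rewrite le_max lexx.
rewrite /Jp; case: ifPn => [_|].
  rewrite addr0 mulrC -mulNr ler_wpM2r//.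
  have -> : L a * (- L b * Lp / tot) = - (L a * (L b * Lp / tot)) by ring.
  by rewrite lerN2 ge_min lexx orbT.
rewrite (ask_lt hx) negbK => /eqP x1.
have -> : B x = 0; last by rewrite mul0r mulr0 oppr0.
rewrite /B max_l// mulr_ge0_le0 ?(ltW La0)// /weight x1 big_nil addr0.
by apply: sumr_le0 => y _; exact: bidw_cp_le0.
Qed.

Let AB_ge x : de * N x <= A x + B x.
Proof.
apply: (@le_trans _ _ (l b * FA x + L a * FB x)); last first.
  by apply: lerD; rewrite le_max lexx orbT.
rewrite /weight !mulrDr !mulr_sumr addrACA -!big_split/=; apply: lerD.
  apply: ler_sum => y _; rewrite mulr1; apply: le_trans (bid_comb ab reg mon y).
  by rewrite ge_min lexx.
apply: ler_sum => y _; rewrite mulr1; apply: le_trans (ask_comb ab reg mon y).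
by rewrite ge_min lexx orbT.
Qed.

Let N_drift (n : R) : 0 <= n ->
  - (2 * e * de * n) + C - Ga * expR (- (c * n)) / 2 <= -1.
Proof.
move=> n0; have ed : 0 < 2 * e * de by rewrite !mulr_gt0.
have Q0 := expR_gt0 (- (c * n)).
have [nN|Nn] := leP N0 n.
  have : C + 1 <= 2 * e * de * n by rewrite mulrC -ler_pdivrMr.
  have : 0 <= Ga * expR (- (c * n)) / 2 by rewrite divr_ge0// mulr_ge0// ltW.
  lra.
have : C + 1 <= Ga * expR (- (c * n)) / 2.
  rewrite /Ga (_ : _ * _ / 2 = (C + 1) * (expR (- (c * n)) / expR (- (c * N0)))); last first.
    by field; rewrite gt_eqF// expR_gt0.
  apply: ler_peMr; first by rewrite addr_ge0.
  rewrite ler_pdivlMr ?expR_gt0// mul1r ler_expR lerN2 ler_wpM2l//.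
  exact: ltW.
have : 0 <= 2 * e * de * n by rewrite mulr_ge0// ltW.
lra.
Qed.

Let V_drift x : ordered a b x -> x != nilS ->
  (\int[rho]_o (V (step a b (clamp_o o) x))%:E <= (V x - 1)%:E)%E.
Proof.
move=> hx xn.
pose Q := expR (- (c * N x)).
have Q0 : 0 < Q by exact: expR_gt0.
have q1 : q < 1 by apply: le_lt_trans q_le _; rewrite invf_lt1// ltr1n.
pose g := Ga * (Q * (1 - q)).
have g0 : 0 <= g.
  by apply: mulr_ge0; [exact: ltW|apply: mulr_ge0; [exact: ltW|rewrite subr_ge0 ltW]].
(* A pointwise bound that is affine in the two jumps and in the indicator of [down], so that its
   integral is known. *)
pose rhs (o : R * bool) := (V x + C + g) +
  (2 * A x * l b * jA x (clamp_o o) + (2 * B x * L a * jB x (clamp_o o) +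
   (- (g * (1 + q^-1))) * (down x (clamp_o o))%:R)).
have pw o : V (step a b (clamp_o o) x) <= rhs o.
  rewrite /V /A /B !weight_step//.
  have sA : (l b * jA x (clamp_o o)) ^+ 2 <= (l b * K1) ^+ 2.
    rewrite -ler_sqrt ?sqr_ge0// !sqrtr_sqr !normrM ler_pM2l ?normr_gt0 ?gt_eqF//.
    apply: le_trans (ler_norm _); apply: jump_norm => y; [exact: bidw_bound|exact: askw_bound].
  have sB : (L a * jB x (clamp_o o)) ^+ 2 <= (L a * K2) ^+ 2.
    rewrite -ler_sqrt ?sqr_ge0// !sqrtr_sqr !normrM ler_pM2l ?normr_gt0 ?gt_eqF//.
    apply: le_trans (ler_norm _); apply: jump_norm => y; [exact: bidw_bound|exact: askw_bound].
  have hA := sqr_posD_le (l b * FA x) (l b * jA x (clamp_o o)).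
  have hB := sqr_posD_le (L a * FB x) (L a * jB x (clamp_o o)).
  have hh : Ga * (1 - expR (- (c * (N x + jump a b (cst 1) (cst 1) (bid a x) (ask b x) (clamp_o o))))) <=
      Ga * (1 - Q) + g * (1 - (1 + q^-1) * (down x (clamp_o o))%:R).
    have -> : Ga * (1 - Q) + g * (1 - (1 + q^-1) * (down x (clamp_o o))%:R) =
       Ga * (1 + (- Q + Q * (1 - q) * (1 - (1 + q^-1) * (down x (clamp_o o))%:R))) by rewrite /g; ring.
    by rewrite ler_pM2l// lerD2l; exact: h_step.
  rewrite !mulrDr; rewrite !mulrDr in hh; move: hA hB hh sA sB; rewrite /rhs /V /A /B /C -/Q !mulrDr.
  set sd := (down x _)%:R.
  set t1 := jump _ _ _ _ _ _ _; set t2 := jump _ _ (bidw cp) _ _ _ _.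
  by move=> hA hB hh sA sB; lra.
have mjA := jump_clamp_meas (bid a x) (ask b x) (measurable_bidw ab reg mon cm) (measurable_askw ab reg mon cm).
have mjB := jump_clamp_meas (bid a x) (ask b x) (measurable_bidw ab reg mon cp) (measurable_askw ab reg mon cp).
have mdn : measurable_fun setT (fun o => (down x o)%:R : R).
  rewrite [X in measurable_fun _ X](_ : _ = fun o => if down x o then 1 else 0); last first.
    by apply/funext => o; case: (down x o).
  apply: measurable_fun_ifT => //; rewrite /down; case: (x.1 == [::]).
    exact: (@measurable_ge_false R b).
  exact: (@measurable_le_true R a).
have mdnc : measurable_fun setT (fun o => (down x (clamp_o o))%:R : R).
  exact: (measurableT_comp mdn measurable_clamp_o).
have iA k : rho.-integrable setT (EFin \o (fun o => k * jA x (clamp_o o))).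
  apply: (@bounded_integrable _ _ _ _ _ (`|k| * K1)); first exact: measurable_funM.
  move=> o; rewrite normrM ler_wpM2l//.
  by apply: jump_norm => y; [exact: bidw_bound|exact: askw_bound].
have iB k : rho.-integrable setT (EFin \o (fun o => k * jB x (clamp_o o))).
  apply: (@bounded_integrable _ _ _ _ _ (`|k| * K2)); first exact: measurable_funM.
  move=> o; rewrite normrM ler_wpM2l//.
  by apply: jump_norm => y; [exact: bidw_bound|exact: askw_bound].
have iD k : rho.-integrable setT (EFin \o (fun o => k * (down x (clamp_o o))%:R)).
  apply: (@bounded_integrable _ _ _ _ _ `|k|); first exact: measurable_funM.
  by move=> o; case: (down x _); rewrite ?mulr0 ?normr0 ?mulr1.
have iBD := integrableD measurableT (iB (2 * B x * L a)) (iD (- (g * (1 + q^-1)))).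
have iABD := integrableD measurableT (iA (2 * A x * l b)) iBD.
have iC : rho.-integrable setT (EFin \o cst (V x + C + g)).
  exact: (@bounded_integrable _ _ _ _ _ `|V x + C + g|).
have irhs : rho.-integrable setT (EFin \o rhs) := integrableD measurableT iC iABD.
have mV : measurable_fun setT (fun o => V (step a b (clamp_o o) x)).
  rewrite (_ : (fun o => _) = fun o =>
    Num.max 0 (l b * (FA x + jA x (clamp_o o))) ^+ 2 +
    Num.max 0 (L a * (FB x + jB x (clamp_o o))) ^+ 2 +
    Ga * (1 - expR (- (c * (N x + jump a b (cst 1) (cst 1) (bid a x) (ask b x) (clamp_o o)))))); last first.
    by apply/funext => o; rewrite /V /A /B !weight_step.
  apply: measurable_funD; first apply: measurable_funD.
  - apply: measurable_funX; apply: measurable_maxr => //; apply: measurable_funM => //.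
    exact: measurable_funD.
  - apply: measurable_funX; apply: measurable_maxr => //; apply: measurable_funM => //.
    exact: measurable_funD.
  - apply: measurable_funM => //; apply: measurable_funB => //.
    apply: (measurableT_comp (@measurable_expR R)); apply: measurable_funN.
    apply: measurable_funM => //; apply: measurable_funD => //; exact: jump_clamp_meas.
apply: (@le_trans _ _ (\int[rho]_o (rhs o)%:E)%E).
  apply: ge0_le_integral => //.
  - by move=> o _; rewrite lee_fin.
  - exact/measurable_EFinP.
  - exact: measurable_int irhs.
  - by move=> o _; rewrite lee_fin.
have -> : (\int[rho]_o (rhs o)%:E)%E = (\int[rho]_o rhs o)%:E.
  by rewrite /Rintegral fineK//; apply: integrable_fin_num.
have i1 k : \int[rho]_o (k * jA x (clamp_o o)) = k * Jm x.
  rewrite RintegralZl//; last by have := iA 1; under eq_fun do rewrite mul1r.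
  by rewrite jump_clamp_int ?JmE//; [exact: measurable_bidw|exact: measurable_askw].
have i2 k : \int[rho]_o (k * jB x (clamp_o o)) = k * Jp x.
  rewrite RintegralZl//; last by have := iB 1; under eq_fun do rewrite mul1r.
  by rewrite jump_clamp_int ?JpE//; [exact: measurable_bidw|exact: measurable_askw].
pose px := \int[rho]_o (down x o)%:R.
have i3 k : \int[rho]_o (k * (down x (clamp_o o))%:R) = k * px.
  rewrite RintegralZl//; last by have := iD 1; under eq_fun do rewrite mul1r.
  by rewrite (rho_clamp_int mdn).
have ppx : pi0 <= px.
  have mdx : measurable [set o | down x o].
    rewrite /down; case: (x.1 == [::]).
      rewrite (_ : [set _ | _] = (fun o => ~~ o.2 && (b <= o.1)) @^-1` [set true]); last by apply/seteqP; split.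
      by rewrite -[X in measurable X]setTI; exact: (@measurable_ge_false R b).
    rewrite (_ : [set _ | _] = (fun o => o.2 && (o.1 <= a)) @^-1` [set true]); last by apply/seteqP; split.
    by rewrite -[X in measurable X]setTI; exact: (@measurable_le_true R a).
  rewrite /px (Rintegral_pred rho mdx) /down; case: (x.1 == [::]).
    by rewrite rho_bid//= ler_pM2r ?invr_gt0// ge_min lexx orbT.
  by rewrite rho_ask//= ler_pM2r ?invr_gt0// ge_min lexx.
have rhsE : \int[rho]_o rhs o = (V x + C + g) +
    (2 * A x * l b * Jm x + (2 * B x * L a * Jp x + - (g * (1 + q^-1)) * px)).
  rewrite -i1 -i2 -i3; apply: etrans (RintegralD measurableT iC iABD) _; congr (_ + _).
    rewrite Rintegral_cst// [X in _ * fine X](_ : _ = 1%E); last exact: probability_setT.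
    by rewrite mulr1.
  apply: etrans (RintegralD measurableT (iA _) iBD) _; congr (_ + _).
  exact: (RintegralD measurableT (iB _) (iD _)).
rewrite lee_fin rhsE.
have hA := A_drift hx; have hB := B_drift hx; have hN := N_drift (N_ge0 x).
have hAB : e * (de * N x) <= e * (A x + B x) by rewrite ler_pM2l// AB_ge.
(* Since px >= pi0 = 2 q, already px / q >= 2. The expected change of the last term of V is then at
   most g (1 - 2) = -g. *)
have qpx : 2 <= (1 + q^-1) * px.
  apply: (@le_trans _ _ ((1 + q^-1) * pi0)).
    rewrite mulrDl mul1r /q invfM invrK mulrAC mulVf ?gt_eqF// mul1r.
    by rewrite lerDr ltW.
  by rewrite ler_pM2l// addr_gt0// invr_gt0.
have gq : g * 2 <= g * ((1 + q^-1) * px) by rewrite ler_wpM2l.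
have gQ : Ga * Q / 2 <= g.
  have hq : 2^-1 <= 1 - q by move: q_le; lra.
  by rewrite /g mulrA; apply: ler_wpM2l => //; apply: ltW; rewrite mulr_gt0.
move: hN; rewrite -/Q => hN.
lra.
Qed.

Lemma positive_Lambda_recurrent : (\sum_(n <oo) P [set w | alive n w] < +oo)%E.
Proof. exact: (recurrent V_ge0 V_smf V_bound V_drift). Qed.

End lyapunov.

End process.

(** * From the order measure to the chain on lists *)

Section realization.
Context {R : realType} (a b : R) (lm lp : \bar R -> R).
Hypothesis ab : a < b.
Local Notation l := (fun x : R => lm x%:E).
Local Notation L := (fun x : R => lp x%:E).
Hypothesis reg : regular_on l L a b.
Hypothesis mon : monotone_on l L a b.
Variable mu : {finite_measure set (\bar R * bool)%type -> \bar R}.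
Hypothesis hmu : is_order_measure a%:E b%:E lm lp mu.

Let tot := l a + L b.

Lemma measurable_clamp_order : measurable_fun setT (@clamp_order R a b).
Proof.
apply: measurable_fun_pair; last exact: measurable_snd.
apply: (measurableT_comp (fine_measurable measurableT)).
apply: measurable_maxe => //; apply: measurable_mine => //; exact: measurable_fst.
Qed.

Let itv_cc (x y : \bar R) : measurable (`[x, y]%classic : set (\bar R)).
Proof. exact: emeasurable_itv. Qed.

Let mu_inside (S : set (\bar R * bool)) : measurable S ->
  mu S = mu (S `&` (`[a%:E, b%:E] `*` setT)).
Proof.
move=> mS; have [out _ _] := hmu.
have mI : measurable (`[a%:E, b%:E] `*` setT : set (\bar R * bool)) by exact: measurableX.
have mO : measurable ((~` `[a%:E, b%:E]) `*` setT : set (\bar R * bool)).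
  by apply: measurableX => //; exact: measurableC.
rewrite -[in LHS](setUIDK S (`[a%:E, b%:E] `*` setT)) measureU//.
- rewrite [X in (_ + X)%E](_ : _ = 0%E) ?adde0//.
  apply/eqP; rewrite eq_le measure_ge0 andbT -out; apply: le_measure; rewrite ?inE//.
    exact: measurableD.
  by move=> z [_ nz]; split => // zI; apply: nz; split.
- exact: measurableI.
- exact: measurableD.
- by apply/seteqP; split => // z [[_ zI] [_]].
Qed.

Let haa : a <= a <= b. Proof. by rewrite lexx ltW. Qed.
Let hbb : a <= b <= b. Proof. by rewrite lexx ltW. Qed.

Let in_cc (x : R) : a <= x <= b -> x%:E \in `[a%:E, b%:E].
Proof. by rewrite in_itv/= !lee_fin. Qed.

Lemma order_measure_total : mu setT = tot%:E.
Proof.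
have [_ hm hp] := hmu; rewrite mu_inside// setTI.
have -> : `[a%:E, b%:E] `*` setT =
    (`[a%:E, b%:E] `*` [set false]) `|` (`[a%:E, b%:E] `*` [set true]) :> set (\bar R * bool).
  apply/seteqP; split => [[u []] [/= h _]|[u s] [] [] //=]; by [left|right].
have -> : (tot%:E = mu (`[a%:E, b%:E] `*` [set false]) + mu (`[a%:E, b%:E] `*` [set true]))%E.
  by rewrite hm ?in_cc// hp ?in_cc// EFinD.
apply: measureU; [exact: measurableX|exact: measurableX|].
by apply/seteqP; split => // z [[_ /= ->] [_]].
Qed.

Lemma tot_gt0 : 0 < tot.
Proof. by have [? _ _ _] := reg haa; have [_ ? _ _] := reg hbb; rewrite addr_gt0. Qed.

Let clamp_in (u : \bar R) : (a%:E <= u <= b%:E)%E -> (fine (Order.max a%:E (Order.min u b%:E)))%:E = u.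
Proof. by move=> /andP[au ub]; rewrite -clamp_orderE// min_l// max_r. Qed.

Let mpre (B : set (R * bool)) : measurable B -> measurable (@clamp_order R a b @^-1` B).
Proof. by move=> mB; rewrite -[X in measurable X]setTI; exact: measurable_clamp_order. Qed.

Lemma order_measure_bid x : a <= x <= b ->
  mu (@clamp_order R a b @^-1` [set o | ~~ o.2 && (x <= o.1)]) = (l x)%:E.
Proof.
move=> hx; have [_ hm _] := hmu; rewrite -hm ?in_cc// mu_inside; last first.
  apply: mpre; rewrite (_ : [set _ | _] = (fun o => ~~ o.2 && (x <= o.1)) @^-1` [set true]); last by apply/seteqP; split.
  by rewrite -[X in measurable X]setTI; exact: measurable_ge_false.
congr (mu _); apply/seteqP; split => -[u s] /=.
  move=> [/andP[/negbTE -> xu] [+ _]]; rewrite !in_itv/= => h; split => //.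
  apply/andP; split; last by case/andP: h.
  by rewrite -(clamp_in h) lee_fin.
rewrite !in_itv/= => -[/andP[xu ub] ->].
have h : (a%:E <= u <= b%:E)%E by rewrite ub andbT (le_trans _ xu)// lee_fin; case/andP: hx.
by split => //=; rewrite -lee_fin clamp_in.
Qed.

Lemma order_measure_ask x : a <= x <= b ->
  mu (@clamp_order R a b @^-1` [set o | o.2 && (o.1 <= x)]) = (L x)%:E.
Proof.
move=> hx; have [_ _ hp] := hmu; rewrite -hp ?in_cc// mu_inside; last first.
  apply: mpre; rewrite (_ : [set _ | _] = (fun o => o.2 && (o.1 <= x)) @^-1` [set true]); last by apply/seteqP; split.
  by rewrite -[X in measurable X]setTI; exact: measurable_le_true.
congr (mu _); apply/seteqP; split => -[u s] /=.
  move=> [/andP[-> xu] [+ _]]; rewrite !in_itv/= => h; split => //.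
  apply/andP; split; first by case/andP: h.
  by rewrite -(clamp_in h) lee_fin.
rewrite !in_itv/= => -[/andP[au ux] ->].
have h : (a%:E <= u <= b%:E)%E by rewrite au/= (le_trans ux)// lee_fin; case/andP: hx.
by split => //=; rewrite -lee_fin clamp_in.
Qed.

Variables (d : measure_display) (Om : measurableType d) (P : probability Om R).
Variable xi : nat -> {RV P >-> (\bar R * bool)%type}.
Hypothesis hxi : iid_normalized xi mu.

Let eta (k : nat) (w : Om) : R * bool := clamp_order a b (xi k w).

Let meta k : measurable_fun setT (eta k).
Proof. by apply: (measurableT_comp measurable_clamp_order); exact: measurable_funPT. Qed.

Let eta0 : {mfun Om >-> (R * bool)%type} := HB.pack (eta 0) (isMeasurableFun.Build _ _ _ _ _ (meta 0)).
Let rho : probability (R * bool)%type R := distribution P eta0.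

Let xi_law k B : measurable B -> P (eta k @^-1` B) = ((tot^-1)%:E * mu (@clamp_order R a b @^-1` B))%E.
Proof.
move=> mB; have [_ /(_ k _ (mpre mB))] := hxi.
by rewrite order_measure_total.
Qed.

Let rhoE k B : measurable B -> P (eta k @^-1` B) = rho B.
Proof. by move=> mB; rewrite xi_law// -(xi_law 0). Qed.

Let rho_bid x : a <= x <= b -> rho [set o | ~~ o.2 && (x <= o.1)] = (l x / tot)%:E.
Proof.
move=> hx; rewrite -(rhoE 0); last first.
  rewrite (_ : [set _ | _] = (fun o => ~~ o.2 && (x <= o.1)) @^-1` [set true]); last by apply/seteqP; split.
  by rewrite -[X in measurable X]setTI; exact: measurable_ge_false.
rewrite xi_law.
  by rewrite order_measure_bid// -EFinM mulrC.
rewrite (_ : [set _ | _] = (fun o => ~~ o.2 && (x <= o.1)) @^-1` [set true]); last by apply/seteqP; split.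
by rewrite -[X in measurable X]setTI; exact: measurable_ge_false.
Qed.

Let rho_ask x : a <= x <= b -> rho [set o | o.2 && (o.1 <= x)] = (L x / tot)%:E.
Proof.
have mS : measurable [set o : R * bool | o.2 && (o.1 <= x)].
  rewrite (_ : [set _ | _] = (fun o => o.2 && (o.1 <= x)) @^-1` [set true]); last by apply/seteqP; split.
  by rewrite -[X in measurable X]setTI; exact: measurable_le_true.
by move=> hx; rewrite -(rhoE 0)// xi_law// order_measure_ask// -EFinM mulrC.
Qed.

Let heta k w : a <= (eta k w).1 <= b. Proof. exact: clamp_order_bound. Qed.

Let rho_out : rho [set o | ~~ (a <= o.1 <= b)] = 0%E.
Proof.
have -> : rho [set o | ~~ (a <= o.1 <= b)] = P (eta 0 @^-1` [set o | ~~ (a <= o.1 <= b)]) by [].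
rewrite (_ : _ @^-1` _ = set0) ?measure0//.
by rewrite -subset0 => w /=; rewrite heta.
Qed.

(** Mutual independence is applied to the index lists 0, ..., k and 0, ..., k - 1; the two products
    differ by the factor of order k. *)
Let ind k A B : cylinders eta k A -> measurable B ->
  P (A `&` eta k @^-1` B) = (P A * rho B)%E.
Proof.
move=> [C mC ->] mB; have [hind _] := hxi.
pose D i := @clamp_order R a b @^-1` (if (i < k)%N then C i else B).
have mD i : measurable (D i) by apply: mpre; case: ifP.
have inI n i : [set` iota 0 n] i <-> (i < n)%N.
  by rewrite /mkset mem_iota.
have h n : P (\bigcap_(i in [set` iota 0 n]) (xi i @^-1` D i)) = (\prod_(i <- iota 0 n) P (xi i @^-1` D i))%E.
  by apply: hind => //; exact: iota_uniq.
have -> : \bigcap_(i in [set i | (i < k)%N]) (eta i @^-1` C i) `&` eta k @^-1` B =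
    \bigcap_(i in [set` iota 0 k.+1]) (xi i @^-1` D i).
  apply/seteqP; split => w.
    move=> [hC hB] i /inI; rewrite ltnS leq_eqVlt /D => /orP[/eqP->|ik].
      by rewrite ltnn.
    by rewrite ik; exact: hC.
  move=> hD; split.
    by move=> i /= ik; have := hD i (iffRL (inI _ _) (leqW ik)); rewrite /D ik.
  by have := hD k (iffRL (inI _ _) (ltnSn k)); rewrite /D ltnn.
have -> : \bigcap_(i in [set i | (i < k)%N]) (eta i @^-1` C i) =
    \bigcap_(i in [set` iota 0 k]) (xi i @^-1` D i).
  apply/seteqP; split => w.
    by move=> hC i /inI ik; rewrite /D ik; exact: hC.
  by move=> hD i /= ik; have := hD i (iffRL (inI _ _) ik); rewrite /D ik.
rewrite !h -[in LHS]addn1 iotaD big_cat/= big_seq1; congr (_ * _)%E.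
by rewrite /D add0n ltnn -(rhoE k).
Qed.

Lemma return_time_alive :
  (\int[P]_w return_time a%:E b%:E (fun k => xi k w) =
   \sum_(n <oo) P [set w | alive eta a b n w])%E.
Proof.
rewrite -expected_return_time//; apply: eq_integral => w _; rewrite /return_time.
congr ereal_inf; apply/seteqP; split => _ [k [k0 /= hk] <-]; exists k => //; split => //;
  move: hk; have := luckock_chain_book (fun i => xi i w) k ab => ->;
  by have /book_eq0 h := lchain_ordered k ab (fun i => heta i w) => /h.
Qed.

Lemma realization_recurrent :
  (\int[P]_w return_time a%:E b%:E (fun k => xi k w) < +oo)%E <->
  0 < Lm a b l L /\ 0 < Lp a b l L.
Proof.
rewrite return_time_alive; split.
  move=> h; split.
    exact: (recurrent_Lm_gt0 ab reg mon tot_gt0 rho_bid rho_ask rho_out meta heta ind h).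
  exact: (recurrent_Lp_gt0 ab reg mon tot_gt0 rho_bid rho_ask rho_out meta heta ind h).
move=> [h1 h2].
exact: (positive_Lambda_recurrent ab reg mon tot_gt0 rho_bid rho_ask rho_out meta heta ind h1 h2).
Qed.

End realization.

(** * Independent orders *)

(** Write each base-4 digit as 2 e + o with bits e and o. From the last n digits, [even_bits]
    collects the bits e and [odd_bits] the bits o, as binary numbers; [interleave] is the inverse on
    numbers below 4^n. *)
Fixpoint even_bits (n N : nat) : nat :=
  if n is m.+1 then (2 * even_bits m (N %/ 4) + (N %/ 2) %% 2)%N else 0.
Fixpoint odd_bits (n N : nat) : nat :=
  if n is m.+1 then (2 * odd_bits m (N %/ 4) + N %% 2)%N else 0.
Fixpoint interleave (n i j : nat) : nat :=
  if n is m.+1 then (4 * interleave m (i %/ 2) (j %/ 2) + 2 * (i %% 2) + j %% 2)%N else 0.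

Lemma interleave_lt n i j : (interleave n i j < 4 ^ n)%N.
Proof.
elim: n i j => [|n IH] i j //=; rewrite expnS.
have := IH (i %/ 2)%N (j %/ 2)%N; move: (interleave _ _ _) (4 ^ n)%N => u v; lia.
Qed.

Lemma bits_lt n N : (even_bits n N < 2 ^ n)%N /\ (odd_bits n N < 2 ^ n)%N.
Proof.
elim: n N => [|n IH] N //=; rewrite expnS; have [] := IH (N %/ 4)%N.
move: (even_bits _ _) (odd_bits _ _) (2 ^ n)%N => u v w; lia.
Qed.

Lemma bits_interleave n i j : (i < 2 ^ n)%N -> (j < 2 ^ n)%N ->
  even_bits n (interleave n i j) = i /\ odd_bits n (interleave n i j) = j.
Proof.
elim: n i j => [|n IH] i j /=; first by rewrite expn0 !ltnS !leqn0 => /eqP -> /eqP ->.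
rewrite expnS => hi hj; have := IH (i %/ 2)%N (j %/ 2)%N.
have -> : ((4 * interleave n (i %/ 2) (j %/ 2) + 2 * (i %% 2) + j %% 2) %/ 4 = interleave n (i %/ 2) (j %/ 2))%N.
  by move: (interleave _ _ _) => u; lia.
move: (2 ^ n)%N hi hj => w hi hj /(_ ltac:(lia) ltac:(lia)) [-> ->].
move: (interleave _ _ _) => u; lia.
Qed.

Lemma interleave_bits n N : (N < 4 ^ n)%N -> interleave n (even_bits n N) (odd_bits n N) = N.
Proof.
elim: n N => [|n IH] N /=; first by rewrite expn0 ltnS leqn0 => /eqP ->.
rewrite expnS => hN; have := IH (N %/ 4)%N.
have -> : ((2 * even_bits n (N %/ 4) + (N %/ 2) %% 2) %/ 2 = even_bits n (N %/ 4))%N.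
  by move: (even_bits _ _) => u; lia.
have -> : ((2 * odd_bits n (N %/ 4) + N %% 2) %/ 2 = odd_bits n (N %/ 4))%N.
  by move: (odd_bits _ _) => u; lia.
move: (4 ^ n)%N hN => w hN /(_ ltac:(lia)) ->.
move: (even_bits _ _) (odd_bits _ _) => u v; lia.
Qed.

Section dyadic_digits.
Context {R : realType}.

Definition digits_value (D : nat -> nat) : R := sups (fun n => (D n)%:R / 2 ^+ n) 0.

Variable D : nat -> nat.
Hypothesis DS : forall n, (2 * D n <= D n.+1 <= 2 * D n + 1)%N.
Hypothesis D_lt : forall n, (D n < 2 ^ n)%N.

Let lo n : R := (D n)%:R / 2 ^+ n.
Let hi n : R := (D n).+1%:R / 2 ^+ n.

Let lo_nd : {homo lo : m n / (m <= n)%N >-> m <= n}.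
Proof.
apply: homo_leq => [x|y x z|n]; [exact: lexx|exact: le_trans|].
rewrite /lo ler_pdivlMr// mulrAC ler_pdivrMr// exprS mulrA ler_pM2r//.
by rewrite -natrM ler_nat mulnC; have /andP[] := DS n.
Qed.

Let hi_ni : {homo hi : m n / (m <= n)%N >-> n <= m}.
Proof.
apply: (homo_leq (r := fun x y : R => y <= x)) => [x|y x z xy yz|n]; [exact: lexx|exact: le_trans yz xy|].
rewrite /hi ler_pdivrMr// mulrAC ler_pdivlMr// exprS mulrA ler_pM2r//.
by rewrite -natrM ler_nat mulnC; have /andP[] := DS n; lia.
Qed.

Let lo_hi m n : lo m <= hi n.
Proof.
have lh k : lo k <= hi k by rewrite /lo /hi ler_pM2r ?invr_gt0// ler_nat.
have [mn|nm] := leqP m n; first exact: le_trans (lo_nd mn) (lh n).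
exact: le_trans (lh m) (hi_ni (ltnW nm)).
Qed.

(** Appending a bit shrinks the dyadic interval, so every lower end is below every upper end. The
    upper end can be attained, by digits that are eventually 1. *)
Lemma digits_value_bounds n :
  (D n)%:R / 2 ^+ n <= digits_value D <= (D n).+1%:R / 2 ^+ n.
Proof.
rewrite /digits_value /sups; apply/andP; split.
  apply: ub_le_sup; last by exists n.
  by exists (hi 0) => _ [m _ <-]; exact: lo_hi.
apply: ge_sup; first by exists (lo 0); exists 0%N.
by move=> _ [m _ <-]; exact: lo_hi.
Qed.

Lemma digits_has_ubound : has_ubound (range (fun n => (D n)%:R / 2 ^+ n : R)).
Proof. by exists (hi 0) => _ [m _ <-]; exact: lo_hi. Qed.

Lemma digits_value_itv : 0 <= digits_value D <= 1.
Proof.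
have /andP[h1 h2] := digits_value_bounds 0; have D0 : D 0 = 0%N by have := D_lt 0; case: (D 0).
by move: h1 h2; rewrite D0 expr0 !divr1 => -> ->.
Qed.

End dyadic_digits.

(** * Splitting a uniform variable into two independent ones *)

Section unit_split.
Context {R : realType}.

Definition unit_prob : probability (measurableTypeR R) R := uniform_prob (@ltr01 R).
Local Notation P := unit_prob.

Lemma unit_prob_co (u v : R) : 0 <= u -> u <= v -> v <= 1 -> P [set` `[u, v[] = (v - u)%:E.
Proof.
move=> u0 uv v1; rewrite /unit_prob/= /uniform_prob.
rewrite (eq_integral (fun=> 1%E)); last first.
  move=> x; rewrite inE/= in_itv/= => /andP[ux xv].
  by rewrite /uniform_pdf (le_trans u0 ux) (ltW (lt_le_trans xv v1)) subr0 invr1.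
rewrite integral_cst//= mul1e lebesgue_measure_itv/= lte_fin.
have [//|vu] := ltP u v.
by rewrite (_ : v = u) ?subrr//; apply/le_anti; rewrite uv vu.
Qed.

Lemma unit_prob_restr (A : set R) : measurable A -> P A = P (A `&` [set` `[0, 1[]).
Proof.
move=> mA; pose J : set R := [set` `[0, 1[].
have mI : measurable J by exact: measurable_itv.
have PI : P J = 1%E by rewrite unit_prob_co// subr0.
have PC : P (~` J) = 0%E.
  by have := probability_setC P mI; rewrite PI subee.
have -> : P A = (P (A `&` J) + P (A `\` J))%E.
  rewrite -measureU//; [by rewrite setUIDK|exact: measurableI|exact: measurableD|].
  by apply/seteqP; split => // z [[_ zI] [_]].
rewrite [X in (_ + X)%E](_ : _ = 0%E) ?adde0//.
apply/eqP; rewrite eq_le measure_ge0 andbT -PC; apply: le_measure; rewrite ?inE//.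
- exact: measurableD.
- exact: measurableC.
Qed.

Definition quaternary (n : nat) (x : R) : nat := Num.truncn (4 ^+ n * x).

Lemma quaternaryS n x : (quaternary n.+1 x %/ 4 = quaternary n x)%N.
Proof.
rewrite /quaternary; have [x0|x0] := leP 0 x; last first.
  have h m : Num.truncn (4 ^+ m * x) = 0%N.
    by rewrite truncn_floor leNgt pmulr_rlt0 ?exprn_gt0// x0.
  by rewrite !h.
apply/esym/truncn_def; have h0 : 0 <= 4 ^+ n.+1 * x by rewrite mulr_ge0// exprn_ge0.
have /andP[h1 h2] := truncn_itv h0; move: h1 h2; rewrite exprS -mulrA.
move: (4 ^+ n * x) => y; move: (Num.truncn _) => k h1 h2.
have := divn_eq k 4; have := ltn_pmod k (isT : (0 < 4)%N).
move: (k %/ 4)%N (k %% 4)%N => c r rk kE.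
move: h1 h2; rewrite kE -addn1 !natrD natrM.
have : (r.+1%:R : R) <= 4 by rewrite ler_nat.
have : (0 : R) <= r%:R by [].
rewrite -[r.+1]addn1 -[c.+1]addn1 !natrD => h3 h4 h1 h2.
by apply/andP; split; lra.
Qed.

Let En n x := even_bits n (quaternary n x).
Let On n x := odd_bits n (quaternary n x).

Lemma digits_step n x : (2 * En n x <= En n.+1 x <= 2 * En n x + 1)%N /\
                (2 * On n x <= On n.+1 x <= 2 * On n x + 1)%N.
Proof. by rewrite /En /On /= quaternaryS; lia. Qed.

Lemma even_digits_lt n x : (En n x < 2 ^ n)%N. Proof. by have [] := bits_lt n (quaternary n x). Qed.
Lemma odd_digits_lt n x : (On n x < 2 ^ n)%N. Proof. by have [] := bits_lt n (quaternary n x). Qed.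

Definition even_part (x : R) : R := digits_value (fun n => En n x).
Definition odd_part (x : R) : R := digits_value (fun n => On n x).

Lemma measurable_quaternary_comp (f : nat -> nat) n :
  measurable_fun setT (fun x : R => (f (quaternary n x))%:R : R).
Proof.
have mq (k : nat) : measurable [set x : R | (quaternary n x <= k)%N].
  rewrite (_ : [set _ | _] = [set` `]-oo, (k.+1%:R / 4 ^+ n)[]); first exact: measurable_itv.
  apply/seteqP; split => x /=; rewrite in_itv/= ltr_pdivlMr ?exprn_gt0// mulrC /quaternary;
    by rewrite truncn_le_nat.
have mq1 (k : nat) : measurable [set x : R | quaternary n x = k].
  case: k => [|k].
    rewrite (_ : [set _ | _] = [set x : R | (quaternary n x <= 0)%N])//.
    by apply/seteqP; split => x /=; rewrite leqn0 => /eqP.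
  rewrite (_ : [set _ | _] = [set x : R | (quaternary n x <= k.+1)%N] `\` [set x : R | (quaternary n x <= k)%N]).
    exact: measurableD.
  apply/seteqP; split => x /=; first by move=> ->; split => //; rewrite ltnn.
  by move=> [h1 /negP]; rewrite -ltnNge => h2; apply/eqP; rewrite eqn_leq h1 h2.
move=> _ B mB; rewrite setTI.
rewrite (_ : _ @^-1` B = \bigcup_(k in [set k | B (f k)%:R]) [set x : R | quaternary n x = k]).
  by apply: bigcup_measurable => k _; exact: mq1.
apply/seteqP; split => x /=.
  by move=> Bx; exists (quaternary n x).
by move=> [k /= Bk ->].
Qed.

Lemma measurable_even_part : measurable_fun setT even_part.
Proof.
apply: measurable_fun_sups => [x _|n].
  by apply: digits_has_ubound => n; have [] := digits_step n x.
by apply: measurable_funM => //; exact: (measurable_quaternary_comp (even_bits n)).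
Qed.

Lemma measurable_odd_part : measurable_fun setT odd_part.
Proof.
apply: measurable_fun_sups => [x _|n].
  by apply: digits_has_ubound => n; have [] := digits_step n x.
by apply: measurable_funM => //; exact: (measurable_quaternary_comp (odd_bits n)).
Qed.

Lemma even_part_itv x : 0 <= even_part x <= 1.
Proof. by apply: digits_value_itv => n; [have [] := digits_step n x|exact: even_digits_lt]. Qed.

Lemma odd_part_itv x : 0 <= odd_part x <= 1.
Proof. by apply: digits_value_itv => n; [have [] := digits_step n x|exact: odd_digits_lt]. Qed.

Lemma measurable_quaternary_set (A : pred nat) n : measurable [set x : R | A (quaternary n x)].
Proof.
rewrite (_ : [set _ | _] = (fun x : R => ((A (quaternary n x) : nat)%:R : R)) @^-1` [set 1]).
  by rewrite -[X in measurable X]setTI; apply: (measurable_quaternary_comp (fun N => A N : nat)).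
apply/seteqP; split => x /=; first by move=> ->.
by case: (A _) => //= /eqP; rewrite eq_sym oner_eq0.
Qed.

(** The two bit strings determine the first n base-4 digits, so within [0, 1[ the event is a single
    interval of length 4^-n. *)
Let cell n i j : (i < 2 ^ n)%N -> (j < 2 ^ n)%N ->
  P [set x : R | (En n x == i) && (On n x == j)] = ((4 ^+ n)^-1)%:E.
Proof.
move=> hi hj; rewrite unit_prob_restr; last first.
  exact: (measurable_quaternary_set (fun N => (even_bits n N == i) && (odd_bits n N == j))).
pose N := interleave n i j; have NN : (N < 4 ^ n)%N by exact: interleave_lt.
have p4 : 0 < (4 : R) ^+ n by rewrite exprn_gt0.
have -> : [set x : R | (En n x == i) && (On n x == j)] `&` [set` `[0, 1[] =
    [set` `[N%:R / 4 ^+ n, N.+1%:R / 4 ^+ n[].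
  apply/seteqP; split => x /=.
    move=> [/andP[/eqP ei /eqP oj]]; rewrite !in_itv/= => /andP[x0 x1].
    have h0 : 0 <= 4 ^+ n * x by rewrite mulr_ge0// ltW.
    have q4 : (quaternary n x < 4 ^ n)%N.
      by rewrite truncn_lt_nat// natrX gtr_pMr.
    have qN : quaternary n x = N by rewrite -(interleave_bits q4) -/(En n x) -/(On n x) ei oj.
    have /andP := truncn_itv h0; rewrite -/(quaternary n x) qN.
    by rewrite ler_pdivrMr// ltr_pdivlMr// ![x * _]mulrC => -[-> ->].
  rewrite in_itv/= ler_pdivrMr// ltr_pdivlMr// ![x * _]mulrC => h.
  have qN : quaternary n x = N by exact: truncn_def.
  have [e1 e2] := bits_interleave hi hj.
  split; first by rewrite /En /On qN e1 e2 !eqxx.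
  move: h; rewrite in_itv/= => /andP[h1 h2]; apply/andP; split.
    by rewrite -(pmulr_rge0 _ p4); apply: le_trans h1.
  rewrite -(ltr_pM2l p4) mulr1; apply: (lt_le_trans h2).
  by rewrite -natrX ler_nat.
rewrite unit_prob_co.
- by rewrite -mulrBl -natrB// subSnn mul1r.
- by rewrite divr_ge0// ltW.
- by rewrite ler_pM2r ?invr_gt0// ler_nat.
- by rewrite ler_pdivrMr// mul1r -natrX ler_nat.
Qed.

Let mcell n (A : nat -> nat -> bool) : measurable [set x : R | A (En n x) (On n x)].
Proof. exact: (measurable_quaternary_set (fun N => A (even_bits n N) (odd_bits n N))). Qed.

Let add_disj n (A B C : nat -> nat -> bool) (u v : R) :
  (forall i j, C i j = A i j || B i j) -> (forall i j, A i j -> B i j -> False) ->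
  P [set x : R | A (En n x) (On n x)] = u%:E -> P [set x : R | B (En n x) (On n x)] = v%:E ->
  P [set x : R | C (En n x) (On n x)] = (u + v)%:E.
Proof.
move=> CAB AB PA PB; rewrite EFinD -PA -PB -measureU.
- congr (P _); apply/seteqP; split => x /=; rewrite CAB; first by move=> /orP.
  by case=> ->; rewrite ?orbT.
- exact: mcell.
- exact: mcell.
- by apply/seteqP; split => // x [/= h1 h2]; exact: AB h1 h2.
Qed.

Let row n i J : (i < 2 ^ n)%N -> (J <= 2 ^ n)%N ->
  P [set x : R | (En n x == i) && (On n x < J)%N] = (J%:R / 4 ^+ n)%:E.
Proof.
move=> hi; elim: J => [_|J IH hJ].
  rewrite mul0r (_ : [set _ | _] = set0) ?measure0// -subset0 => x /=.
  by rewrite ltn0 andbF.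
rewrite -addn1 natrD mulrDl mul1r.
apply: (@add_disj n (fun u v => (u == i) && (v < J)%N) (fun u v => (u == i) && (v == J))
  (fun u v => (u == i) && (v < J + 1)%N)).
- by move=> u v; rewrite -andb_orr addn1 ltnS leq_eqVlt orbC.
- by move=> u v /andP[_ vJ] /andP[_ /eqP vE]; rewrite vE ltnn in vJ.
- by apply: IH; exact: ltnW.
- exact: cell.
Qed.

Let box n I J : (I <= 2 ^ n)%N -> (J <= 2 ^ n)%N ->
  P [set x : R | (En n x < I)%N && (On n x < J)%N] = (I%:R * J%:R / 4 ^+ n)%:E.
Proof.
move=> + hJ; elim: I => [_|I IH hI].
  by rewrite !mul0r (_ : [set _ | _] = set0) ?measure0// -subset0 => x /=.
rewrite -addn1 natrD !mulrDl mul1r.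
apply: (@add_disj n (fun u v => (u < I)%N && (v < J)%N) (fun u v => (u == I) && (v < J)%N)
  (fun u v => (u < I + 1)%N && (v < J)%N)).
- by move=> u v; rewrite -andb_orl addn1 ltnS leq_eqVlt orbC.
- by move=> u v /andP[uI _] /andP[/eqP uE _]; rewrite uE ltnn in uI.
- by apply: IH; exact: ltnW.
- exact: row.
Qed.

Let box_le n I J : (P [set x : R | (En n x < I)%N && (On n x < J)%N] <= (I%:R * J%:R / 4 ^+ n)%:E)%E.
Proof.
have p4 : 0 < (4 : R) ^+ n by rewrite exprn_gt0.
rewrite (_ : [set _ | _] = [set x : R | (En n x < minn I (2 ^ n))%N && (On n x < minn J (2 ^ n))%N]).
  rewrite box ?geq_minr// lee_fin ler_pM2r ?invr_gt0// -!natrM ler_nat.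
  by rewrite leq_mul// geq_minl.
by apply/seteqP; split => x /=; rewrite !leq_min even_digits_lt odd_digits_lt !andbT.
Qed.

(** The event lies between two boxes of cells with about 2^n s and 2^n t cells per side. Their
    probabilities differ from s t by at most 4 / 2^n, for every n. *)
Lemma parts_joint_ray (s t : R) : 0 <= s <= 1 -> 0 <= t <= 1 ->
  P [set x : R | (even_part x < s) && (odd_part x < t)] = (s * t)%:E.
Proof.
move=> /andP[s0 s1] /andP[t0 t1].
have mS : measurable [set x : R | (even_part x < s) && (odd_part x < t)].
  rewrite (_ : [set _ | _] = even_part @^-1` [set` `]-oo, s[] `&` odd_part @^-1` [set` `]-oo, t[]).
    apply: measurableI; rewrite -[X in measurable X]setTI.
      by apply: measurable_even_part => //; exact: measurable_itv.
    by apply: measurable_odd_part => //; exact: measurable_itv.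
  by apply/seteqP; split => x /=; rewrite !in_itv/= => /andP.
have fS : P [set x : R | (even_part x < s) && (odd_part x < t)] \is a fin_num.
  exact: fin_num_measure.
rewrite -(fineK fS); congr EFin; set p := fine _.
apply/eqP; rewrite -subr_eq0 -normr_eq0; apply/eqP.
apply: (@le_halving_eq0 _ _ 4) => // n.
have p2 : 0 < (2 : R) ^+ n by rewrite exprn_gt0.
have p4 : (4 : R) ^+ n = 2 ^+ n * 2 ^+ n by rewrite -exprMn -natrM.
have eb x : (En n x)%:R / 2 ^+ n <= even_part x <= (En n x).+1%:R / 2 ^+ n.
  by apply: digits_value_bounds => m; have [] := digits_step m x.
have ob x : (On n x)%:R / 2 ^+ n <= odd_part x <= (On n x).+1%:R / 2 ^+ n.
  by apply: digits_value_bounds => m; have [] := digits_step m x.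
pose I := Num.truncn (2 ^+ n * s); pose J := Num.truncn (2 ^+ n * t).
have s0' : 0 <= 2 ^+ n * s by rewrite mulr_ge0// ltW.
have t0' : 0 <= 2 ^+ n * t by rewrite mulr_ge0// ltW.
have /andP[I1 I2] := truncn_itv s0'; have /andP[J1 J2] := truncn_itv t0'.
rewrite -/I -/J in I1 I2 J1 J2.
have up : p <= I.+1%:R * J.+1%:R / 4 ^+ n.
  rewrite -lee_fin fineK//; apply: le_trans (box_le n I.+1 J.+1).
  apply: le_measure; rewrite ?inE//.
    exact: (mcell n (fun u v => (u < I.+1)%N && (v < J.+1)%N)).
  move=> x /= /andP[es ut]; have /andP[e1 _] := eb x; have /andP[w1 _] := ob x.
  have := le_lt_trans e1 es; have := le_lt_trans w1 ut.
  rewrite !ltr_pdivrMr// ![_ * 2 ^+ n]mulrC => h1 h2.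
  by rewrite -!(@ltr_nat R) (lt_trans h1 J2) (lt_trans h2 I2).
have Ile : (I <= 2 ^ n)%N by rewrite -(@ler_nat R) natrX (le_trans I1)// ler_piMr// ltW.
have Jle : (J <= 2 ^ n)%N by rewrite -(@ler_nat R) natrX (le_trans J1)// ler_piMr// ltW.
(* The inner box uses I - 1 and not I: the part may equal the upper end of its dyadic interval, and
   a strict inequality below s is needed. *)
have low : I.-1%:R * J.-1%:R / 4 ^+ n <= p.
  rewrite -lee_fin fineK// -box ?(leq_trans (leq_pred _))//.
  apply: le_measure; rewrite ?inE//.
    exact: (mcell n (fun u v => (u < I.-1)%N && (v < J.-1)%N)).
  move=> x /= /andP[es ut]; have /andP[_ e1] := eb x; have /andP[_ w1] := ob x.
  apply/andP; split.
    apply: (le_lt_trans e1); rewrite ltr_pdivrMr// mulrC; apply: lt_le_trans I1.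
    by rewrite ltr_nat -ltn_predRL.
  apply: (le_lt_trans w1); rewrite ltr_pdivrMr// mulrC; apply: lt_le_trans J1.
  by rewrite ltr_nat -ltn_predRL.
have I3 : 2 ^+ n * s - 2 <= I.-1%:R.
  have : (I%:R : R) <= I.-1%:R + 1 by rewrite natr1 ler_nat leqSpred.
  by move: I2; rewrite -natr1; lra.
have J3 : 2 ^+ n * t - 2 <= J.-1%:R.
  have : (J%:R : R) <= J.-1%:R + 1 by rewrite natr1 ler_nat leqSpred.
  by move: J2; rewrite -natr1; lra.
have S1 : 2 ^+ n * s <= 2 ^+ n by rewrite ler_piMr// ltW.
have T1 : 2 ^+ n * t <= 2 ^+ n by rewrite ler_piMr// ltW.
have w1 : 1 <= (2 : R) ^+ n by rewrite exprn_ege1// ler1n.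
have I0 : 0 <= (I.-1%:R : R) by []. have J0 : 0 <= (J.-1%:R : R) by [].
have st : s * t = (2 ^+ n * s) * (2 ^+ n * t) / 4 ^+ n.
  by rewrite p4; field; rewrite gt_eqF.
move: up low; rewrite st; rewrite -[I.+1]addn1 -[J.+1]addn1 !natrD => up low.
rewrite ler_norml; apply/andP; split.
  have : 2 ^+ n * s * (2 ^+ n * t) - I.-1%:R * J.-1%:R <= 4 * 2 ^+ n.
    move: I3 J3 S1 T1 w1 I0 J0 s0' t0'.
    move: (2 ^+ n * s) (2 ^+ n * t) => S T; move: (2 ^+ n) (I.-1%:R) (J.-1%:R) => w i j.
    move=> I3 J3 S1 T1 w1 I0 J0 S0 T0; have ij0 : 0 <= i * j by rewrite mulr_ge0.
    have [S2|S2] := leP 2 S; last first.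
      have : S * T <= 2 * T by rewrite ler_wpM2r// ltW.
      lra.
    have [T2|T2] := leP 2 T; last first.
      have : S * T <= S * 2 by rewrite ler_wpM2l// ltW.
      lra.
    have : (S - 2) * (T - 2) <= i * j by rewrite ler_pM// subr_ge0.
    lra.
  rewrite -(@ler_pM2r _ (4 ^+ n)^-1) ?invr_gt0 ?exprn_gt0// mulrBl.
  have -> : 4 * 2 ^+ n * (4 ^+ n)^-1 = 4 / 2 ^+ n :> R by rewrite p4; field; rewrite gt_eqF.
  by move: low; lra.
have : (I%:R + 1) * (J%:R + 1) - 2 ^+ n * s * (2 ^+ n * t) <= 4 * 2 ^+ n.
  move: I1 J1 S1 T1 w1 s0' t0'.
  have : 0 <= (I%:R : R) by []. have : 0 <= (J%:R : R) by [].
  move: (2 ^+ n * s) (2 ^+ n * t) => S T; move: (2 ^+ n) (I%:R) (J%:R) => w i j.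
  move=> j0 i0 I1 J1 S1 T1 w1 S0 T0; have : i * j <= S * T by rewrite ler_pM.
  lra.
rewrite -(@ler_pM2r _ (4 ^+ n)^-1) ?invr_gt0 ?exprn_gt0// mulrBl.
have -> : 4 * 2 ^+ n * (4 ^+ n)^-1 = 4 / 2 ^+ n :> R by rewrite p4; field; rewrite gt_eqF.
by move: up; lra.
Qed.

End unit_split.

Lemma ray_measure_unique (R : realType) (m1 m2 : {measure set (measurableTypeR R) -> \bar R}) :
  (forall x : R, m1 [set` `]-oo, x[] = m2 [set` `]-oo, x[]) ->
  (forall x : R, (m1 [set` `]-oo, x[] < +oo)%E) ->
  forall A : set R, measurable A -> m1 A = m2 A.
Proof.
move=> h hoo A mA.
have mG : RGenInftyO.G (R := R) `<=` measurable.
  by move=> _ [x ->]; exact: measurable_itv.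
apply: (@g_sigma_algebra_measure_unique _ R (measurableTypeR R) (@RGenInftyO.G R) mG
   (fun n => [set` `]-oo, (n%:R : R)[])).
- by move=> n; exists n%:R.
- apply/seteqP; split => // x _; exists (Num.bound x) => //=.
  rewrite in_itv/=; have [x0|x0] := leP 0 x; first exact: archi_boundP.
  by apply: lt_le_trans x0 _.
- move=> _ _ [x ->] [y ->]; exists (Num.min x y).
  by apply/seteqP; split => z /=; rewrite !in_itv/= lt_min => /andP.
- by move=> _ [x ->].
- by move=> n.
- have : (R.-ocitv.-measurable).-sigma.-measurable A := mA.
  by rewrite RGenInftyO.measurableE.
Qed.

Section split_law.
Context {R : realType}.
Local Notation P := (@unit_prob R).

Let k01 (s : R) := Num.max 0 (Num.min s 1).
Let k01_itv s : 0 <= k01 s <= 1.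
Proof. by rewrite /k01 le_max lexx/= ge_max ler01 ge_min lexx orbT. Qed.

Lemma unit_prob_ray (s : R) : P [set` `]-oo, s[] = (k01 s)%:E.
Proof.
rewrite unit_prob_restr; last exact: measurable_itv.
have /andP[k0 k1] := k01_itv s.
rewrite (_ : _ `&` _ = [set` `[0, k01 s[]) ?unit_prob_co ?subr0//.
apply/seteqP; split => x /=; rewrite !in_itv/= /k01 lt_max lt_min.
  by move=> [xs /andP[x0 x1]]; rewrite x0 xs x1 orbT.
by move=> /andP[x0]; rewrite ltNge x0/= => /andP[-> ->].
Qed.

Let ray2 s t := [set x : R | (even_part x < s) && (odd_part x < t)].

Let mray2 s t : measurable (ray2 s t).
Proof.
rewrite (_ : ray2 s t = even_part @^-1` [set` `]-oo, s[] `&` odd_part @^-1` [set` `]-oo, t[]).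
  apply: measurableI; rewrite -[X in measurable X]setTI.
    by apply: measurable_even_part => //; exact: measurable_itv.
  by apply: measurable_odd_part => //; exact: measurable_itv.
by apply/seteqP; split => x /=; rewrite !in_itv/= => /andP.
Qed.

Let ray2_11 : P (~` ray2 1 1) = 0%E.
Proof.
have := probability_setC P (mray2 1 1).
by rewrite parts_joint_ray ?ler01 ?lexx// mulr1 subee.
Qed.

Let k01_lt (y s : R) : 0 <= y -> y < 1 -> (y < k01 s) = (y < s).
Proof. by move=> y0 y1; rewrite /k01 lt_max lt_min ltNge y0 y1 andbT. Qed.

Let k01_le (y s : R) : 0 <= y -> y < k01 s -> y < s.
Proof. by move=> y0; rewrite /k01 lt_max lt_min ltNge y0 => /andP[]. Qed.

(** Clamping s and t to [0, 1] loses only points where one of the parts equals 1, and these are null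
    by [ray2_11]. *)
Lemma parts_rays s t : P (ray2 s t) = (P [set` `]-oo, s[] * P [set` `]-oo, t[])%E.
Proof.
rewrite !unit_prob_ray -EFinM -parts_joint_ray// -/(ray2 _ _).
apply/le_anti/andP; split; last first.
  apply: le_measure; rewrite ?inE//; try exact: mray2.
  move=> x /= /andP[h1 h2]; apply/andP; split; [apply: k01_le h1|apply: k01_le h2].
    by have /andP[] := even_part_itv x.
  by have /andP[] := odd_part_itv x.
apply: (@le_trans _ _ (P (ray2 (k01 s) (k01 t) `|` ~` ray2 1 1))).
  apply: le_measure; rewrite ?inE//; first exact: mray2.
    by apply: measurableU; [exact: mray2|apply: measurableC; exact: mray2].
  move=> x /= /andP[h1 h2]; have [/andP[x1 x2]|] := boolP ((even_part x < 1) && (odd_part x < 1)).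
    left; apply/andP; split; rewrite k01_lt//.
      by have /andP[] := even_part_itv x.
    by have /andP[] := odd_part_itv x.
  by move=> /negP nx; right.
have n0 : (P (~` ray2 1%R 1%R) <= 0)%E by rewrite ray2_11.
apply: le_trans (measureU2 _ _ _) _; [exact: mray2|apply: measurableC; exact: mray2|].
by rewrite -[leRHS]adde0; apply: leeD.
Qed.

End split_law.

(** * A sequence of independent uniform variables *)

Section iid_uniform.
Context {R : realType}.
Local Notation P := (@unit_prob R).

Let meven_fun : @measurable_fun _ _ (measurableTypeR R) (measurableTypeR R) setT (@even_part R).
Proof. exact: measurable_even_part. Qed.
Let modd_fun : @measurable_fun _ _ (measurableTypeR R) (measurableTypeR R) setT (@odd_part R).
Proof. exact: measurable_odd_part. Qed.
Let even_mfun : {mfun (measurableTypeR R) >-> (measurableTypeR R)} :=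
  HB.pack (@even_part R) (isMeasurableFun.Build _ _ _ _ _ meven_fun).
Let odd_mfun : {mfun (measurableTypeR R) >-> (measurableTypeR R)} :=
  HB.pack (@odd_part R) (isMeasurableFun.Build _ _ _ _ _ modd_fun).

Let law_aux (f g : {mfun (measurableTypeR R) >-> (measurableTypeR R)}) (C : set R) :
  measurable C ->
  (forall s : R, P (f @^-1` [set` `]-oo, s[] `&` g @^-1` C) = (P [set` `]-oo, s[] * P C)%E) ->
  forall A : set R, measurable A -> P (f @^-1` A `&` g @^-1` C) = (P A * P C)%E.
Proof.
move=> mC h A mA.
have mgC : measurable (g @^-1` C) by rewrite -[X in measurable X]setTI; exact: measurable_funPT.
have r0 : 0 <= fine (P C) by exact: fine_ge0.
pose m1 := pushforward (mrestr P mgC) f; pose m2 := mscale (NngNum r0) P.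
have e2 X : m2 X = (P X * P C)%E.
  by rewrite /m2 /mscale/= fineK ?fin_num_measure// muleC.
rewrite -e2; have -> : P (f @^-1` A `&` g @^-1` C) = m1 A by [].
apply: ray_measure_unique => // x.
- by apply: etrans (h x) _; rewrite -e2.
- apply: le_lt_trans (probability_le1 P _) (ltry 1).
  apply: measurableI => //; rewrite -[X in measurable X]setTI; apply: measurable_funPT => //.
Qed.

(** Rays determine finite measures; they are replaced by measurable sets one coordinate at a time,
    first with a ray fixed in the odd part, then with A fixed in the even part. *)
Lemma parts_law (A B : set R) : measurable A -> measurable B ->
  P (@even_part R @^-1` A `&` @odd_part R @^-1` B) = (P A * P B)%E.
Proof.
move=> mA mB.
have h t : forall A : set R, measurable A ->
    P (@even_part R @^-1` A `&` @odd_part R @^-1` [set` `]-oo, t[]) = (P A * P [set` `]-oo, t[])%E.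
  apply: (@law_aux even_mfun odd_mfun) => [|s]; first exact: measurable_itv.
  rewrite -parts_rays; congr (P _).
  by apply/seteqP; split => x /=; rewrite !in_itv/= => /andP.
rewrite setIC muleC; apply: (@law_aux odd_mfun even_mfun) => // s.
by rewrite setIC muleC; exact: h.
Qed.

(** At each stage the even part is output, and the odd part, again uniform and independent of it, is
    split further. *)
Definition uniform_seq (k : nat) (x : R) : R := even_part (iter k odd_part x).

Lemma measurable_uniform_seq k : measurable_fun setT (uniform_seq k).
Proof.
apply: (measurableT_comp measurable_even_part).
elim: k => [|k IH]; first exact: measurable_id.
exact: (measurableT_comp measurable_odd_part IH).
Qed.

Lemma uniform_seq_indep n (B : nat -> set R) : (forall k, measurable (B k)) ->
  P (\bigcap_(k in [set k | (k < n)%N]) (uniform_seq k @^-1` B k)) =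
  (\prod_(0 <= k < n) P (B k))%E.
Proof.
elim: n B => [|n IH] B mB.
  rewrite big_geq// (_ : \bigcap_(_ in _) _ = setT) ?probability_setT//.
  by apply/seteqP; split.
rewrite big_nat_recl// -(IH (fun k => B k.+1))// -parts_law//; last first.
  apply: bigcap_measurableType => k _; rewrite -[X in measurable X]setTI.
  exact: measurable_uniform_seq.
congr (P _); apply/seteqP; split => x /=.
  move=> h; split; first exact: (h 0%N).
  by move=> k /= kn; have := h k.+1 kn; rewrite /= /uniform_seq iterSr.
by move=> [h0 h] [|k] kn //; have := h k kn; rewrite /= /uniform_seq iterSr.
Qed.

Lemma uniform_seq_law k (B : set R) : measurable B -> P (uniform_seq k @^-1` B) = P B.
Proof.
move=> mB; have := @uniform_seq_indep k.+1 (fun i => if i == k then B else setT).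
rewrite big_nat_recr//= eqxx big1_seq; last first.
  by move=> i; rewrite mem_index_iota => /andP[_ /andP[_ ik]]; rewrite ltn_eqF// probability_setT.
rewrite mul1e => <-; last by move=> i; case: ifP.
congr (P _); apply/seteqP; split => x /=.
  by move=> Bx i /= ik; case: eqP => [->|].
by move=> /(_ k (ltnSn k)); rewrite /= eqxx.
Qed.

End iid_uniform.

(** * Quantile transform *)

Section quantile.
Context {R : realType}.
Variables (a b : R) (f : R -> R).
Hypothesis ab : a < b.
Hypothesis nd : nd_on a b f.
Hypothesis cf : forall x, a <= x <= b -> {for x, continuous f}.

(** Generalized inverse of [f]. Cutting y off at f b keeps b in the set, so the infimum is monotone
    in y and lies in [a, b] for every real y. *)
Definition quantile (y : R) : R := inf [set x | a <= x <= b /\ Num.min y (f b) <= f x].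

Let S y := [set x | a <= x <= b /\ Num.min y (f b) <= f x].

Let Sb y : S y b. Proof. by split; rewrite ?lexx ?(ltW ab)// ge_min lexx orbT. Qed.
Let Slb y : has_lbound (S y). Proof. by exists a => x [/andP[]]. Qed.

Lemma quantile_itv y : a <= quantile y <= b.
Proof.
apply/andP; split; last exact: (ge_inf (Slb y) (Sb y)).
by apply: lb_le_inf; [exists b; exact: Sb|move=> x [/andP[ax _] _]].
Qed.

(** If f x < y, continuity keeps f below y up to some z > x, so the infimum is at least z. *)
Lemma quantile_le x y : a <= x <= b -> y <= f b -> (quantile y <= x) = (y <= f x).
Proof.
move=> hx yb; have miny : Num.min y (f b) = y by apply/min_idPl.
apply/idP/idP => [qx|yx]; last by apply: ge_inf; [exact: Slb|split; rewrite ?miny].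
rewrite leNgt; apply/negP => fxy.
have [xb|bx] := ltP x b; last first.
  have xb : x = b by apply/le_anti; rewrite bx; case/andP: hx => _ ->.
  by move: fxy; rewrite xb ltNge yb.
have e0 : 0 < y - f x by rewrite subr_gt0.
have [t t0 ht] := small_drop (cf hx) e0.
pose z := Num.min b (x + t / 2).
have xz : x < z by rewrite lt_min xb ltrDl divr_gt0.
have fz : f z < y.
  have := ht z; rewrite distrC gtr0_norm ?subr_gt0// => /(_ _).
  have zt : z <= x + t / 2 by rewrite ge_min lexx orbT.
  have zx : z - x < t by lra.
  by move=> /(_ zx); rewrite distrC => /(le_lt_trans (ler_norm _)); rewrite ltrD2r.
have /andP[ax _] := hx.
have zb : z <= b by rewrite ge_min lexx.
have : z <= quantile y.
  apply: lb_le_inf; first by exists b; exact: Sb.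
  move=> u [/andP[au ub]]; rewrite miny => yu; rewrite leNgt; apply/negP => uz.
  have := nd au (ltW uz) zb; lra.
lra.
Qed.

Lemma quantile_nd x y : x <= y -> quantile x <= quantile y.
Proof.
move=> xy; apply: lb_le_inf; first by exists b; exact: Sb.
move=> u [hu yu]; apply: (ge_inf (Slb x)); split => //; apply: le_trans yu.
by rewrite le_min !ge_min xy lexx orbT.
Qed.

End quantile.

(** * A realization of the i.i.d. orders *)

Section existence.
Context {R : realType} (a b : R) (lm lp : \bar R -> R).
Hypothesis ab : a < b.
Local Notation l := (fun x : R => lm x%:E).
Local Notation L := (fun x : R => lp x%:E).
Hypothesis reg : regular_on l L a b.
Hypothesis mon : monotone_on l L a b.
Local Notation P := (@unit_prob R).

Let haa : a <= a <= b. Proof. by rewrite lexx ltW. Qed.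
Let hbb : a <= b <= b. Proof. by rewrite lexx ltW. Qed.
Let la0 : 0 < l a. Proof. by have [] := reg haa. Qed.
Let Lb0 : 0 < L b. Proof. by have [] := reg hbb. Qed.
Let tot := l a + L b.
Let tot0 : 0 < tot. Proof. by rewrite addr_gt0. Qed.

Lemma unit_prob_closed_ray (c : R) : 0 <= c <= 1 -> P [set` `]-oo, c]] = c%:E.
Proof.
move=> /andP[c0 c1]; rewrite /unit_prob/= /uniform_prob integral_uniform_pdf.
rewrite (_ : _ `&` _ = [set` `[0, c]]); last first.
  apply/seteqP; split => x /=; rewrite !in_itv/=; first by move=> [-> /andP[->]].
  by move=> /andP[-> xc]; rewrite xc (le_trans xc).
rewrite (eq_integral (fun=> 1%E)); last first.
  move=> x; rewrite inE/= in_itv/= => /andP[x0 xc].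
  by rewrite /uniform_pdf x0 (le_trans xc c1) subr0 invr1.
rewrite integral_cst//= mul1e lebesgue_measure_itv/= lte_fin.
have [_|c0'] := ltP 0 c; first by rewrite sube0.
by rewrite (_ : c = 0)//; apply/le_anti; rewrite c0 c0'.
Qed.

(** Reflection makes the demand function nondecreasing, so that the same quantile transform serves
    for buy prices. *)
Let fm (x : R) := l (- x).
Let fm_nd : nd_on (- b) (- a) fm.
Proof.
move=> x y bx xy ya.
have h1 : a <= - y by rewrite lerNr.
have h2 : - y <= - x by rewrite lerN2.
have h3 : - x <= b by rewrite lerNl.
by have [] := mon h1 h2 h3.
Qed.
Let fm_c x : - b <= x <= - a -> {for x, continuous fm}.
Proof.
move=> /andP[bx xa]; apply: (@continuous_comp _ _ _ (fun x : R => - x) l).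
  exact: opp_continuous.
have hx : a <= - x <= b by rewrite lerNr xa lerNl.
by have [] := reg hx.
Qed.
Let Nab : - b < - a. Proof. by rewrite ltrN2. Qed.

Let xm (y : R) : R := - quantile (- b) (- a) fm y.
Let xp (y : R) : R := quantile a b L y.

Let L_nd : nd_on a b L.
Proof. by move=> x y ax xy yb; have [] := mon ax xy yb. Qed.
Let L_c x : a <= x <= b -> {for x, continuous L}.
Proof. by move=> /reg[]. Qed.

Let xm_itv y : a <= xm y <= b.
Proof. by have /andP[h1 h2] := quantile_itv fm Nab y; rewrite /xm lerNr h2 lerNl. Qed.

Let xp_itv y : a <= xp y <= b. Proof. exact: quantile_itv. Qed.

Let xm_ge x y : a <= x <= b -> y <= l a -> (x <= xm y) = (y <= l x).
Proof.
move=> /andP[ax xb] ya; rewrite /xm lerNr (quantile_le Nab fm_nd fm_c).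
- by rewrite /fm opprK.
- by rewrite !lerN2 ax xb.
- by rewrite /fm opprK.
Qed.

(** One uniform variable t gives both sign and price: if t tot <= l a, the order is a buy order with
    level t tot in the range of l; otherwise the excess over l a, at most L b for t <= 1, is the
    level of a sell order. *)
Let q (t : R) : \bar R * bool :=
  if t * tot <= l a then ((xm (t * tot))%:E, false) else ((xp (t * tot - l a))%:E, true).

Let mq : measurable_fun (setT : set (measurableTypeR R)) q.
Proof.
have mtot : measurable_fun (setT : set R) (fun t => t * tot) by exact: measurable_funM.
have : measurable_fun (setT : set R) q.
  apply: measurable_fun_ifT; first exact: measurable_fun_ler.
    apply: measurable_fun_pair => //; apply/measurable_EFinP.
    apply: (@measurableT_comp _ _ _ _ _ _ xm) => //; apply: measurable_funN.
    by apply: nondecreasing_measurable => // x y; exact: quantile_nd.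
  apply: measurable_fun_pair => //; apply/measurable_EFinP.
  apply: (@measurableT_comp _ _ _ _ _ _ xp); last exact: measurable_funB.
  by apply: nondecreasing_measurable => // x y; exact: quantile_nd.
exact.
Qed.

Let qm : {mfun (measurableTypeR R) >-> (\bar R * bool)%type} :=
  HB.pack q (isMeasurableFun.Build _ _ _ _ _ mq).

Let mqS (S : set (\bar R * bool)) : measurable S -> measurable (q @^-1` S : set R).
Proof. by move=> mS; have := mq measurableT mS; rewrite setTI. Qed.

Let mu : {finite_measure set (\bar R * bool)%type -> \bar R} := mscale (NngNum (ltW tot0)) (distribution P qm).

Let muE S : mu S = (tot%:E * P (q @^-1` S))%E.
Proof. by []. Qed.

Let itv_cc (x y : \bar R) : measurable (`[x, y]%classic : set (\bar R)).
Proof. exact: emeasurable_itv. Qed.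

(** A buy order at or above r occurs when t tot <= l r, and almost surely a sell order at or below r
    occurs when l a < t tot <= l a + L r. *)
Let mu_order : is_order_measure a%:E b%:E lm lp mu.
Proof.
have la_itv x : a <= x <= b -> 0 <= l x / tot <= 1.
  move=> hx; have [lx0 _ _ _] := reg hx; rewrite divr_ge0 ?(ltW lx0) ?(ltW tot0)//=.
  rewrite ler_pdivrMr// mul1r; apply: (@le_trans _ _ (l a)); last by rewrite lerDl ltW.
  by case/andP: hx => ax xb; have [] := mon (lexx a) ax xb.
have real_of x : x \in `[a%:E, b%:E] -> exists2 r : R, x = r%:E & a <= r <= b.
  case: x => [r||]; rewrite in_itv/= ?lee_fin.
  - by exists r.
  - by rewrite leye_eq andbF.
  - by [].
split.
- rewrite [LHS]muE (_ : _ @^-1` _ = set0) ?measure0 ?mule0//.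
  rewrite -subset0 => t [+ _]; rewrite /q /= in_itv/=.
  by case: ifP => _ /=; rewrite !lee_fin ?xm_itv ?xp_itv.
- move=> x /real_of [r -> hr]; rewrite [LHS]muE.
  rewrite (_ : _ @^-1` _ = [set` `]-oo, (l r / tot)]]); last first.
    apply/seteqP; split => t /=; rewrite !in_itv/= /q.
      case: ifPn => //= tla [/andP[+ _] e]; last by [].
      rewrite lee_fin xm_ge// => h.
      by rewrite ler_pdivlMr.
    rewrite ler_pdivlMr// => tr; have tla : t * tot <= l a.
      by apply: le_trans tr _; case/andP: hr => ar rb; have [] := mon (lexx a) ar rb.
    by rewrite tla /= !lee_fin xm_ge// tr; have /andP[_ ->] := xm_itv (t * tot).
  by rewrite unit_prob_closed_ray ?la_itv// -EFinM mulrC mulfVK// gt_eqF.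
- move=> x /real_of [r -> hr]; rewrite [LHS]muE.
  have [_ Lr0 _ _] := reg hr.
  have Lrb : L r <= L b by case/andP: hr => ar rb; have [] := mon ar rb (lexx b).
  have c_itv : 0 <= (l a + L r) / tot <= 1.
    have h0 : 0 <= l a + L r by apply: addr_ge0; exact: ltW.
    by rewrite divr_ge0 ?(ltW tot0)//= ler_pdivrMr// mul1r lerD2l.
  have mS : measurable (q @^-1` (`[a%:E, r%:E] `*` [set true]) : set R).
    by apply: mqS; apply: measurableX.
  pose A1 : set R := [set` `]-oo, ((l a + L r) / tot)]].
  pose A2 : set R := [set` `]-oo, (l a / tot)]].
  have mA1 : measurable A1 by exact: measurable_itv.
  have mA2 : measurable A2 by exact: measurable_itv.
  have A1E t : A1 t <-> t * tot <= l a + L r by rewrite /A1 /= in_itv/= ler_pdivlMr.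
  have A2E t : A2 t <-> t * tot <= l a by rewrite /A2 /= in_itv/= ler_pdivlMr.
  have A21 : A2 `<=` A1.
    by move=> t /A2E h; apply/A1E; apply: (le_trans h); rewrite lerDl ltW.
  have -> : P (q @^-1` (`[a%:E, r%:E] `*` [set true])) = P (A1 `\` A2).
    (* The restriction to t in [0, 1[ ensures t tot - l a <= L b, which [quantile_le] requires. *)
    rewrite (unit_prob_restr mS) (unit_prob_restr (measurableD mA1 mA2)).
    congr (P _); apply/seteqP; split => t [] /= + t01; move: (t01); rewrite !in_itv/= => /andP[t0 t1].
      rewrite /q; case: ifPn => //=; first by move=> _ [].
      rewrite -ltNge => h [/andP[_]]; rewrite lee_fin (quantile_le ab L_nd L_c)//; last first.
        by rewrite lerBlDl -/tot ler_piMl ?ltW.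
      move=> h2 _; split => //; split; first by apply/A1E; rewrite -lerBlDl.
      by move=> /A2E; rewrite leNgt h.
    move=> -[/A1E h1 h2]; split => //; have {}h2 : t * tot <= l a = false.
      by apply/negP => /A2E.
    rewrite /q h2 /= !lee_fin; split => //.
    have /andP[-> _] /= := xp_itv (t * tot - l a).
    rewrite (quantile_le ab L_nd L_c)// ?lerBlDl//.
    by rewrite -/tot ler_piMl ?ltW.
  have -> : P (A1 `\` A2) = (P A1 - P (A1 `&` A2))%E.
    by apply: measureD => //; apply: le_lt_trans (probability_le1 P mA1) (ltry 1).
  rewrite setIidr// !unit_prob_closed_ray ?la_itv//.
  by rewrite -EFinB -EFinM; congr EFin; field; rewrite gt_eqF.
Qed.

Let xi_fun k (t : R) : \bar R * bool := q (uniform_seq k t).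

Let mxi k : @measurable_fun _ _ (measurableTypeR R) _ setT (xi_fun k).
Proof.
have mu' : @measurable_fun _ _ (measurableTypeR R) (measurableTypeR R) setT (uniform_seq k).
  exact: measurable_uniform_seq.
exact: (measurableT_comp mq mu').
Qed.

Let xi (k : nat) : {RV P >-> (\bar R * bool)%type} :=
  HB.pack (xi_fun k) (isMeasurableFun.Build _ _ _ _ _ (mxi k)).

Lemma order_realization :
  exists (mu : {finite_measure set (\bar R * bool)%type -> \bar R})
         (d : measure_display) (Om : measurableType d) (Q : probability Om R)
         (xi : nat -> {RV Q >-> (\bar R * bool)%type}),
    is_order_measure a%:E b%:E lm lp mu /\ iid_normalized xi mu.
Proof.
exists mu, _, (measurableTypeR R), P, xi; split; first exact: mu_order.
have xi_law k A : measurable A -> P (xi k @^-1` A) = P (q @^-1` A).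
  move=> mA; have -> : xi k @^-1` A = uniform_seq k @^-1` (q @^-1` A) by [].
  by rewrite uniform_seq_law//; exact: mqS.
split.
  move=> s B us mB.
  (* The index list is enlarged to an initial segment, with the whole space as target set at the
     added indices. *)
  pose n := (\max_(k <- s) k).+1.
  have sn k : k \in s -> (k < n)%N by move=> ks; rewrite ltnS; exact: leq_bigmax_seq.
  pose C k : set R := if k \in s then q @^-1` B k else setT.
  have mC k : measurable (C k) by rewrite /C; case: ifP => // _; exact: mqS.
  have -> : \bigcap_(k in [set` s]) (xi k @^-1` B k) =
      \bigcap_(k in [set k | (k < n)%N]) (uniform_seq k @^-1` C k).
    apply/seteqP; split => t h k /= ks.
      by rewrite /C; case: ifP => // /h.
    by have := h k (sn k ks); rewrite /C /= ks.
  rewrite uniform_seq_indep// (bigID (fun k => k \in s))/= [X in (_ * X)%E]big1 ?mule1; last first.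
    by move=> k /negbTE ks; rewrite /C ks probability_setT.
  rewrite -big_filter; transitivity (\prod_(k <- s) P (C k))%E.
    apply: perm_big; apply: uniq_perm => //; first by rewrite filter_uniq// iota_uniq.
    move=> k; rewrite mem_filter mem_index_iota andb_idr// => ks; exact: sn.
  rewrite big_seq [RHS]big_seq; apply: eq_bigr => k ks.
  rewrite /C ks; exact: (esym (xi_law k (B k) (mB k))).
move=> k A mA. have -> : distribution P (xi k) A = P (q @^-1` A) by exact: xi_law.

rewrite (order_measure_total ab mu_order) -/tot/=.
rewrite [X in (_ * X)%E]muE muleA -EFinM mulVf ?mul1e// gt_eqF//.
Qed.

End existence.

(** The criterion holds for every realization of the orders; the direction from right to left also
    needs one to exist, which [order_realization] provides. *)
Lemma positive_recurrentP (R : realType) (a b : R) (lm lp : \bar R -> R) :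
  a < b -> regular_on (fun x => lm x%:E) (fun x => lp x%:E) a b ->
  monotone_on (fun x => lm x%:E) (fun x => lp x%:E) a b ->
  positive_recurrent a%:E b%:E lm lp <->
  0 < Lambda_minus lm lp a b /\ 0 < Lambda_plus lm lp a b.
Proof.
move=> ab reg mon.
rewrite (Lambda_minusE reg mon) (Lambda_plusE_parts (ltW ab) reg mon).
split.
  move=> [mu [d [Om [P [xi [hmu hxi]]]]]].
  by move=> /(realization_recurrent ab reg mon hmu hxi).
move=> h; have [mu [d [Om [P [xi [hmu hxi]]]]]] := order_realization ab reg mon.
exists mu, d, Om, P, xi; split => //.
exact/(realization_recurrent ab reg mon hmu hxi).
Qed.

Theorem lemma4 (R : realType) (Im Ip : \bar R) (lm lp : \bar R -> R)
    (hI : (Im < Ip)%E)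
    (lm_ge0 : forall x, x \in `[Im, Ip] -> 0 <= lm x)
    (lp_ge0 : forall x, x \in `[Im, Ip] -> 0 <= lp x)
    (lm_cont : {within [set` `[Im, Ip]], continuous lm})
    (lp_cont : {within [set` `[Im, Ip]], continuous lp})
    (lm_noninc : {in `[Im, Ip] &, forall x y, (x <= y)%E -> lm y <= lm x})
    (lp_nondec : {in `[Im, Ip] &, forall x y, (x <= y)%E -> lp x <= lp y})
    (lm_gt0 : forall x : R, in_itv_oo Im Ip x%:E -> 0 < lm x%:E)
    (lp_gt0 : forall x : R, in_itv_oo Im Ip x%:E -> 0 < lp x%:E) :
  [/\ forall Jp : R, in_itv_oo Im Ip Jp%:E ->
        (phi_minus Im lm lp Jp < Jp%:E)%E,
      forall Jm : R, in_itv_oo Im Ip Jm%:E ->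
        (Jm%:E < phi_plus Ip lm lp Jm)%E &
      forall Jm Jp : R, in_itv_oo Im Ip Jm%:E -> in_itv_oo Im Ip Jp%:E ->
        (recurrent_set Im Ip lm lp (Jm, Jp) <->
         [/\ (phi_minus Im lm lp Jp < Jm%:E)%E,
             (Jp%:E < phi_plus Ip lm lp Jm)%E & Jm < Jp])].

Proof.
split.
(* Taken at J_- = J_+, where the integral vanishes and Lambda_- is 1/lambda_-(J_+)^2 > 0. *)
- move=> Jp IJp; apply: (phi_minus_lt lm_cont lp_cont lm_noninc lp_nondec) => //.
  exact: (Lambda_minus_diag lm_cont lp_cont lm_noninc lp_nondec).
- move=> Jm IJm; apply: (phi_plus_gt lm_cont lp_cont lm_noninc lp_nondec) => //.
  exact: (Lambda_plus_diag lm_cont lp_cont lm_noninc lp_nondec).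
move=> Jm Jp IJm IJp.
have key : Jm < Jp -> positive_recurrent Jm%:E Jp%:E lm lp <->
    (phi_minus Im lm lp Jp < Jm%:E)%E /\ (Jp%:E < phi_plus Ip lm lp Jm)%E.
  move=> J; have reg := interior_regular lm_cont lp_cont lm_gt0 lp_gt0 IJm IJp.
  have mon := interior_monotone lm_noninc lp_nondec IJm IJp.
  apply: iff_trans (positive_recurrentP J reg mon) _.
  have hm := phi_minus_ltP lm_cont lp_cont lm_noninc lp_nondec lm_gt0 lp_gt0 IJm IJp J.
  have hp := phi_plus_gtP lm_cont lp_cont lm_noninc lp_nondec lm_gt0 lp_gt0 IJp IJm J.
  by split => -[h1 h2]; split; [apply/hm|apply/hp|apply/hm|apply/hp].
split; first by move=> [_ _ /= J /(key J)[]].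
by move=> [h1 h2 J]; split => //=; apply/(key J).
Qed.
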